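(* For a nontrivial compact group $G$, consider the following two assertions. $\mathrm{BU}(G)$: for every nonempty compact Hausdorff space $X$ with a free continuous action of $G$, there is no $G$-equivariant continuous map $X*G\to X$. $\mathrm{T1}(G)$: for every nonzero unital $C^*$-algebra $A$ with a free coaction $\delta:A\to A\otimes\mathcal{C}(G)$ of the compact quantum group $(\mathcal{C}(G),\Delta)$, there is no $(\delta,\delta_\Delta)$-equivariant unital $*$-homomorphism $A\to A\circledast_\delta\mathcal{C}(G)$. Then: (i) if $\mathrm{BU}(\mathbb{Z}_p)$ holds for all primes $p$, then $\mathrm{BU}(G)$ holds for every nontrivial compact group $G$; (ii) if $\mathrm{T1}(\mathbb{Z}_p)$ holds for all primes $p$, then $\mathrm{T1}(G)$ holds for every nontrivial compact group $G$.
   Context: Compact groups are Hausdorff topological groups; $\mathbb{Z}_p=\varprojlim\mathbb{Z}/p^n$ is the compact group of $p$-adic integers. The join $X*Y$ is the quotient of $X\times Y\times[0,1]$ by the relation identifying, for each fixed $x_0\in X$, all points $(x_0,y,1)$, and, for each fixed $y_0\in Y$, all points $(x,y_0,0)$. For a right action of $G$ on $X$, $X*G$ carries the diagonal action $[(x,g,t)]\cdot h=[(x\cdot h,gh,t)]$. $\otimes$ denotes the minimal tensor product of $C^*$-algebras. The comultiplication on $\mathcal{C}(G)$ is $\Delta(f)(g,h)=f(gh)$. A coaction of $H=\mathcal{C}(G)$ on a unital $C^*$-algebra $A$ is the same as a point-norm continuous action of $G$ on $A$ by $*$-automorphisms, via $\delta(a)(g)=g\triangleright a$ in $A\otimes\mathcal{C}(G)\cong\mathcal{C}(G,A)$.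 It is free if the set of finite sums $\sum_i (a_i \otimes 1)\delta(b_i)$, with $a_i, b_i \in A$, is dense in $A \otimes H$. The equivariant noncommutative join is $$A \circledast_\delta H = \{f \in \mathcal{C}([0,1], A\otimes H) : f(0)\in \mathbb{C} \otimes H,\ f(1)\in \delta(A)\},$$ with coaction $\delta_\Delta$ of $(H,\Delta)$ given by applying $\mathrm{id}_A\otimes\Delta$ at each $t\in[0,1]$. A $*$-homomorphism $\phi:A\to B$ between $C^*$-algebras with coactions $\delta_A,\delta_B$ of $(H,\Delta)$ is $(\delta_A,\delta_B)$-equivariant if $\delta_B\circ\phi=(\phi\otimes\mathrm{id}_H)\circ\delta_A$. *)

(* Defs.v *)
From HB Require Import structures.
From mathcomp Require Import all_boot all_order all_algebra.
From mathcomp Require Import generic_quotient complex.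
From mathcomp Require Import all_classical all_reals all_analysis.

Set Implicit Arguments.
Unset Strict Implicit.
Unset Printing Implicit Defensive.

Import Order.TTheory GRing.Theory Num.Theory.
Import numFieldNormedType.Exports.

Local Open Scope classical_set_scope.
Local Open Scope ring_scope.
Local Open Scope complex_scope.
Local Open Scope quotient_scope.

HB.mixin Record isCompactGroup G & Topological G & monoid.Group G := {
  mulg_continuous : continuous (fun p : G * G => (p.1 * p.2)%g);
  invg_continuous : continuous (fun g : G => (g^-1)%g);
  group_hausdorff : hausdorff_space G;
  group_compact : compact [set: G]
}.

#[short(type="compactGroupType")]
HB.structure Definition CompactGroup :=
  {G of Topological G & monoid.Group G & isCompactGroup G}.

Definition nontrivial_group (G : compactGroupType) := exists g : G, g <> 1%g.

(* The inverse limit of the additive groups Z/p^n, n >= 1 (the term n = 0 is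
   trivial, and 'Z_1 would denote Z/2), each with the discrete topology. *)
Definition padic_prod (p : nat) :=
  prod_topology (fun n => discrete_topology 'Z_(p ^ n.+1)).

Definition padic_set (p : nat) : set (padic_prod p) :=
  [set x : padic_prod p |
    forall n, x n = inZp (x n.+1 : 'Z_(p ^ n.+2)) :> 'Z_(p ^ n.+1)].

Definition padic (p : nat) : Type := set_type (@padic_set p).

HB.instance Definition _ p := Topological.on (padic p).

Section padic_group.
Variable p : nat.
Implicit Types x y z : padic p.

Lemma padic_trunc_dvd n :
  ((Zp_trunc (p ^ n.+1)).+2 %| (Zp_trunc (p ^ n.+2)).+2)%N.
Proof.
case: p => [|[|q]]; first by rewrite !exp0n.
  by rewrite !exp1n.
by rewrite !Zp_cast ?dvdn_exp2l// -{1}(expn0 q.+2) ltn_exp2l.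
Qed.

Lemma padic_inZpD n (a b : 'Z_(p ^ n.+2)) :
  inZp (a + b)%R = (inZp a + inZp b)%R :> 'Z_(p ^ n.+1).
Proof.
apply: val_inj => /=.
by rewrite modn_dvdm ?padic_trunc_dvd// modnDm.
Qed.

Lemma padic_inZp0 n : inZp (0%R : 'Z_(p ^ n.+2)) = 0%R :> 'Z_(p ^ n.+1).
Proof. by apply: val_inj => /=; rewrite mod0n. Qed.

Lemma padic_inZpN n (a : 'Z_(p ^ n.+2)) :
  inZp (- a)%R = (- inZp a)%R :> 'Z_(p ^ n.+1).
Proof.
by apply/eqP; rewrite -addr_eq0 -padic_inZpD addNr padic_inZp0.
Qed.


Lemma padic_add_subproof x y : (fun n => val x n + val y n)%R \in @padic_set p.
Proof.
apply: mem_set => n /=; rewrite padic_inZpD.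
by rewrite -(set_valP x n) -(set_valP y n).
Qed.

Lemma padic_opp_subproof x : (fun n => - val x n)%R \in @padic_set p.
Proof. by apply: mem_set => n /=; rewrite padic_inZpN -(set_valP x n). Qed.

Lemma padic_zero_subproof : (fun n => 0)%R \in @padic_set p.
Proof. by apply: mem_set => n /=; rewrite padic_inZp0. Qed.

Definition padic_add x y : padic p :=
  exist (fun u => u \in @padic_set p) _ (padic_add_subproof x y).
Definition padic_opp x : padic p :=
  exist (fun u => u \in @padic_set p) _ (padic_opp_subproof x).
Definition padic_zero : padic p := exist (fun u => u \in @padic_set p) _ padic_zero_subproof.

Lemma padicP x y : (forall n, val x n = val y n) -> x = y.
Proof. by move=> xy; apply: val_inj; apply: functional_extensionality_dep. Qed.

Lemma padic_addA : associative padic_add.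
Proof. by move=> x y z; apply: padicP => n /=; rewrite addrA. Qed.
Lemma padic_add0 : left_id padic_zero padic_add.
Proof. by move=> x; apply: padicP => n /=; rewrite add0r. Qed.
Lemma padic_addr0 : right_id padic_zero padic_add.
Proof. by move=> x; apply: padicP => n /=; rewrite addr0. Qed.
Lemma padic_addN : left_inverse padic_zero padic_opp padic_add.
Proof. by move=> x; apply: padicP => n /=; rewrite addNr. Qed.
Lemma padic_addrN : right_inverse padic_zero padic_opp padic_add.
Proof. by move=> x; apply: padicP => n /=; rewrite subrr. Qed.

HB.instance Definition _ := isGroup.Build (padic p)
  padic_addA padic_add0 padic_addr0 padic_addN padic_addrN.

End padic_group.

Section padic_topology.
Variable p : nat.

Lemma continuous_to_discrete (T : topologicalType) (S : discreteTopologicalType)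
    (f : T -> S) :
  continuous f <-> forall t, nbhs t [set u | f u = f t].
Proof.
split=> [cf t|h t A fA]; first exact: (cf t [set f t] (discrete_set1 _)).
by apply: filterS (h t) => u /= ->; exact: nbhs_singleton.
Qed.

Lemma padic_continuous (T : topologicalType) (f : T -> padic p) :
  (forall n, continuous (fun t => val (f t) n : discrete_topology 'Z_(p ^ n.+1))) ->
  continuous f.
Proof.
move=> cf; apply: (@continuous_comp_initial (padic p) _ _ set_val) => t.
apply/cvg_sup => n.
by apply: (@continuous_comp_initial (padic_prod p) _ _ (fun u => u n)); exact: cf.
Qed.

Lemma padic_val_continuous n :
  continuous (fun x : padic p => val x n : discrete_topology 'Z_(p ^ n.+1)).
Proof.
move=> x; apply: (@continuous_comp (padic p) (padic_prod p) _ set_val (proj n)).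
  exact: initial_continuous.
exact: proj_continuous.
Qed.

Lemma padic_mul_continuous :
  continuous (fun u : padic p * padic p => (u.1 * u.2)%g).
Proof.
apply: padic_continuous => n; apply/continuous_to_discrete => u /=.
have h := (@continuous_to_discrete _ _ _).1 (@padic_val_continuous n).
exists ([set x : padic p | val x n = val u.1 n], [set x : padic p | val x n = val u.2 n]).
  by split => /=; exact: h.
by move=> [x y] [/= -> ->].
Qed.

Lemma padic_inv_continuous : continuous (fun x : padic p => (x^-1)%g).
Proof.
apply: padic_continuous => n; apply/continuous_to_discrete => u /=.
have h := (@continuous_to_discrete _ _ _).1 (@padic_val_continuous n).
by apply: filterS (h u) => x /= ->.
Qed.

Lemma padic_hausdorff : hausdorff_space (padic p).
Proof.
move=> x y xy; apply: padicP => n.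
apply: (@discrete_hausdorff (discrete_topology 'Z_(p ^ n.+1))) => A B nA nB.
have [z [Az Bz]] := xy _ _ (padic_val_continuous nA) (padic_val_continuous nB).
by exists (val z n).
Qed.

Lemma padic_set_closed : closed (@padic_set p).
Proof.
have -> : @padic_set p = \bigcap_n [set x : padic_prod p |
    x n = inZp (x n.+1 : 'Z_(p ^ n.+2)) :> 'Z_(p ^ n.+1)].
  by apply/seteqP; split => [x xp n _|x xp n]; [exact: xp|exact: (xp n I)].
apply: closed_bigI => n _.
rewrite -[X in closed X]setCK closedC openE => x /= xn.
have h m : nbhs x [set y : padic_prod p | y m = x m].
  have : continuous (proj m : padic_prod p -> _) by exact: proj_continuous.
  by move/(@continuous_to_discrete _ (discrete_topology 'Z_(p ^ m.+1)) _).1; exact.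
by apply: filterS2 (h n) (h n.+1) => y /= -> ->.
Qed.

Lemma padic_compact : compact [set: padic p].
Proof.
have cP : compact (@padic_set p).
  apply: (subclosed_compact padic_set_closed); last exact: (@subsetT _ (@padic_set p)).
  have := @tychonoff nat (fun n => discrete_topology 'Z_(p ^ n.+1)) (fun=> setT).
  have -> : [set f : forall i, discrete_topology 'Z_(p ^ i.+1) |
     forall i, [set: discrete_topology 'Z_(p ^ i.+1)] (f i)] = setT.
    by apply/seteqP; split.
  by apply=> n; apply: finite_compact; exact: (@finite_finset 'Z_(p ^ n.+1)).
move=> F FF _.
have vF : (set_val @ F) (@padic_set p).
  apply: (@filterS (padic p) F _ setT); last exact: filterT.
  by move=> y _; exact: (@set_valP _ (@padic_set p) y).
have [x [xp clx]] := cP (set_val @ F) _ vF.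
exists (exist (fun u => u \in @padic_set p) x (mem_set xp)); split => //.
move=> A B FA [_ [[W oW <-] Wx] WB].
have vA : (set_val @ F) (set_val @` A).
  by apply: (@filterS (padic p) F _ A) => // y Ay /=; exists y.
have [z [[y Ay yz] Wz]] := clx _ _ vA (open_nbhs_nbhs (conj oW Wx)).
by exists y; split => //; apply: WB => /=; rewrite yz.
Qed.

HB.instance Definition _ := isCompactGroup.Build (padic p)
  padic_mul_continuous padic_inv_continuous padic_hausdorff padic_compact.

End padic_topology.

Definition unit_interval (R : realType) : Type :=
  set_type (`[0, 1]%classic : set R).

HB.instance Definition _ (R : realType) := Topological.on (unit_interval R).

Section endpoints.
Variable R : realType.

Lemma unit_interval0_subproof : (0 : R) \in (`[0, 1]%classic : set R).
Proof. by apply: mem_set; rewrite /= in_itv /= lexx ler01. Qed.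

Lemma unit_interval1_subproof : (1 : R) \in (`[0, 1]%classic : set R).
Proof. by apply: mem_set; rewrite /= in_itv /= lexx ler01. Qed.

Definition unit_interval0 : unit_interval R :=
  exist (fun t => t \in (`[0, 1]%classic : set R)) 0 unit_interval0_subproof.
Definition unit_interval1 : unit_interval R :=
  exist (fun t => t \in (`[0, 1]%classic : set R)) 1 unit_interval1_subproof.

End endpoints.

Section join.
Variables (R : realType) (X Y : topologicalType).

Definition pre_join : Type := (X * Y * unit_interval R)%type.
HB.instance Definition _ := Topological.on pre_join.

Definition join_rel (p q : pre_join) : bool :=
  `[< [\/ p = q,
          [/\ p.2 = unit_interval1 R, q.2 = unit_interval1 R & p.1.1 = q.1.1] |
          [/\ p.2 = unit_interval0 R, q.2 = unit_interval0 R & p.1.2 = q.1.2]] >].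

Lemma unit_interval01 : unit_interval0 R <> unit_interval1 R.
Proof. by move/(congr1 val) => /= /eqP; rewrite eq_sym oner_eq0. Qed.

Lemma join_rel_equiv : equiv_class_of join_rel.
Proof.
split=> [p|p q|q p r].
- by apply/asboolP; apply: Or31.
- apply: asbool_equiv_eq; split; case=> [->|[? ? ->]|[? ? ->]];
    by [apply: Or31|apply: Or32|apply: Or33].
- move=> /asboolP[->//|[p1 q1 pq]|[p0 q0 pq]] /asboolP[<-|[q1' r1 qr]|[q0' r0 qr]];
    apply/asboolP.
  + exact: Or32.
  + by apply: Or32; split => //; rewrite pq.
  + by case: unit_interval01; rewrite -q1 -q0'.
  + exact: Or33.
  + by case: unit_interval01; rewrite -q0 -q1'.
  + by apply: Or33; split => //; rewrite pq.
Qed.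

Canonical join_equiv := EquivRelPack join_rel_equiv.

Definition join : Type := quotient_topology {eq_quot join_equiv}.
HB.instance Definition _ :=
  Topological.copy join (quotient_topology {eq_quot join_equiv}).

Definition join_pi (x : X) (y : Y) (t : unit_interval R) : join :=
  \pi_{eq_quot join_equiv} (x, y, t).

End join.

Record right_action (G : compactGroupType) (X : topologicalType) := RightAction {
  ract :> X -> G -> X;
  ract1 : forall x, ract x 1%g = x;
  ractM : forall x g h, ract x (g * h)%g = ract (ract x g) h;
  ract_continuous : continuous (fun p : X * G => ract p.1 p.2)
}.

Definition free_action (G : compactGroupType) (X : topologicalType)
    (a : right_action G X) :=
  forall x g, a x g = x -> g = 1%g.

Section diagonal_action.
Variables (R : realType) (G : compactGroupType) (X : topologicalType).
Variable a : right_action G X.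

Definition join_act (z : join R X G) (h : G) : join R X G :=
  let: (x, g, t) := (repr (z : {eq_quot join_equiv R X G}) : pre_join R X G) in
  join_pi (a x h) (g * h)%g t.

Lemma join_actE x g t h :
  join_act (join_pi x g t) h = join_pi (a x h) (g * h)%g t.
Proof.
rewrite /join_act; set z := join_pi x g t.
have : join_rel (repr (z : {eq_quot join_equiv R X G})) (x, g, t).
  by apply/eqmodP; rewrite reprK.
case: (repr _) => [[x' g'] t'] /asboolP[[-> -> ->]//|[/= -> -> ->]|[/= -> -> ->]].
  by apply/eqmodP; apply/asboolP; apply: Or32.
by apply/eqmodP; apply/asboolP; apply: Or33.
Qed.

End diagonal_action.

Definition BU (R : realType) (G : compactGroupType) :=
  forall X : topologicalType,
    [set: X] !=set0 -> compact [set: X] -> hausdorff_space X ->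
  forall a : right_action G X, free_action a ->
  ~ exists f : join R X G -> X,
      continuous f /\ forall z h, f (join_act a z h) = a (f z) h.

(* MathComp has no structure combining a ring with a norm valued in its scalars
   other than the integral domains of [Num.NumDomain], so the multiplication is
   part of this mixin. The zero algebra is allowed. *)
HB.mixin Record isCStarAlgebra (R : realType) A
    & CompleteNormedModule R[i] A := {
  cone : A;
  cmul : A -> A -> A;
  star : A -> A;
  cmulA : associative cmul;
  cmul1x : left_id cone cmul;
  cmulx1 : right_id cone cmul;
  cmulDl : left_distributive cmul +%R;
  cmulDr : right_distributive cmul +%R;
  cscaleAl : forall (c : R[i]) x y, c *: cmul x y = cmul (c *: x) y;
  cscaleAr : forall (c : R[i]) x y, c *: cmul x y = cmul x (c *: y);
  starK : involutive star;
  starD : {morph star : x y / x + y};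
  starZ : forall (c : R[i]) x, star (c *: x) = c^* *: star x;
  starM : forall x y, star (cmul x y) = cmul (star y) (star x);
  norm_cmul_le : forall x y, `|cmul x y| <= `|x| * `|y|;
  norm_star_cmul : forall x, `|cmul (star x) x| = `|x| ^+ 2
}.

#[short(type="cstarAlgType")]
HB.structure Definition CStarAlgebra (R : realType) :=
  {A of CompleteNormedModule R[i] A & isCStarAlgebra R A}.

Arguments cone {R} A : rename.

Definition unital_star_hom (R : realType) (A B : cstarAlgType R)
    (phi : A -> B) :=
  [/\ {morph phi : x y / x + y},
      forall (c : R[i]) x, phi (c *: x) = c *: phi x,
      {morph phi : x y / cmul x y},
      phi (cone A) = cone B &
      {morph phi : x / star x}].

(* A point-norm continuous left action by *-automorphisms; bijectivity of each
   [gact g] follows from [gact1] and [gactM]. *)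
Record coaction (R : realType) (G : compactGroupType) (A : cstarAlgType R) :=
  Coaction {
    gact : G -> A -> A;
    gact_star_hom : forall g, unital_star_hom (gact g);
    gact1 : forall a, gact 1%g a = a;
    gactM : forall g h a, gact (g * h)%g a = gact g (gact h a);
    gact_continuous : forall a, continuous (fun g => gact g a)
  }.

Section coaction.
Variables (R : realType) (G : compactGroupType) (A : cstarAlgType R).

(* The C*-algebra A (x) C(G) is identified with C(G, A), a set of functions with
   pointwise operations; its norm topology is that of uniform convergence. *)
Definition tensor_CG : set {uniform G -> A} :=
  [set F | continuous (F : G -> A)].

Variable d : coaction G A.

Definition delta (a : A) : {uniform G -> A} := fun g => gact d g a.

(* (a (x) 1) delta(b) is the function g |-> a * delta(b)(g). *)
Definition free_coaction :=
  tensor_CG `<=` closure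
    [set F : {uniform G -> A} |
      exists s : seq (A * A), F = fun g => \sum_(ab <- s) cmul ab.1 (delta ab.2 g)].

Definition nc_join : set (unit_interval R -> {uniform G -> A}) :=
  [set f | [/\ continuous f,
               forall t, tensor_CG (f t),
               exists2 h : G -> R[i]^o, continuous h &
                 f (unit_interval0 R) = (fun g => h g *: cone A) &
               exists a, f (unit_interval1 R) = delta a]].

(* id_A (x) Delta, where A (x) C(G) (x) C(G) is C(G * G, A) in curried form. *)
Definition id_comult (F : {uniform G -> A}) : G -> G -> A :=
  fun g h => F (g * h)%g.

(* An element of (A \circledast C(G)) (x) C(G) is seen as a function of the
   variable h of the last tensor factor. *)
Definition nc_join_delta (f : unit_interval R -> {uniform G -> A}) :
    G -> unit_interval R -> {uniform G -> A} :=
  fun h t g => id_comult (f t) g h.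

(* The operations of the noncommutative join are pointwise, so that a unital
   *-homomorphism into it is a map all of whose evaluations are such. *)
Definition nc_join_star_hom (phi : A -> unit_interval R -> {uniform G -> A}) :=
  (forall a, nc_join (phi a)) /\
  forall t g, unital_star_hom (fun a => phi a t g).

(* delta_Delta \o phi = (phi (x) id) \o delta, evaluated at a in A. *)
Definition nc_join_equivariant
    (phi : A -> unit_interval R -> {uniform G -> A}) :=
  forall a, nc_join_delta (phi a) = phi \o delta a.

End coaction.

Definition T1 (R : realType) (G : compactGroupType) :=
  forall (A : cstarAlgType R), cone A <> 0 ->
  forall d : coaction G A, free_coaction d ->
  ~ exists phi : A -> unit_interval R -> {uniform G -> A},
      nc_join_star_hom d phi /\ nc_join_equivariant d phi.

(* Main.v *)
(* A nontrivial compact group G contains, for some prime p, an element x <> 1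
   such that x^(p^n m) is close to 1 for n large, uniformly in m. Indeed, by
   Bogolyubov's theorem the powers of any g close to 1 are detected by finitely
   many points of the circle, so that G receives a map from (a quotient of) the
   Bohr compactification of Z; a subgroup of it minimal among the closed
   subgroups that are not sent close to 1 has only torsion characters, and thus
   contains elements all of whose characters have p-power order. Then m |-> x^m
   extends to a continuous homomorphism Z_p -> G, which is injective or else x
   has finite order.

   In the first case free actions and free coactions of G restrict to Z_p, and
   so do the equivariant maps. In the second case G contains Z/n with n > 1 and
   both assertions hold outright: an equivariant map X * G -> X yields a homotopy
   from a constant to a Z/n-equivariant map X -> X. For a C*-algebra A, X is the
   space of its characters, which is nonempty because evaluation at t = 0 and
   g = 1 is a character.

   Such a homotopy cannot exist. Germs along the diagonal of augmented
   Alexander-Spanier cochains modulo n that are cocycles become coboundaries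
   after pulling back along the end map. Labelling X by a finite free complex
   gives a zigzag b_0, ..., b_k with b_0 the unit of degree -1, the coboundary
   of b_i being the image of b_(i+1) under the norm or under 1 - a alternately,
   and b_k a cocycle; the end map shortens it until the unit itself is a
   cocycle, which is absurd. *)

Require Import Defs.
From HB Require Import structures.
From mathcomp Require Import all_boot all_order all_algebra.
From mathcomp Require Import generic_quotient complex.
From mathcomp Require Import all_classical all_reals all_analysis.
From mathcomp Require Import zify ring lra.

Set Implicit Arguments.
Unset Strict Implicit.
Unset Printing Implicit Defensive.

Import Order.TTheory GRing.Theory Num.Theory.
Import numFieldNormedType.Exports.

Local Open Scope classical_set_scope.
Local Open Scope ring_scope.

(** Neither $G$ nor $X$ comes with any finiteness: $G$ need not be a Lie group and $X$ is an
    arbitrary compact Hausdorff space. On the side of $G$, representation theory is replaced by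
    counting among $g^0,\dots,g^{N-1}$; the number of circle points obtained does not depend on $N$,
    so a compactness argument in a power of the disc produces points that serve all powers at once.
    On the side of $X$, the finite quantity is the number $m$ of labels: small sequences are
    labelled by simplices with at most $m$ distinct vertices, so alternating cochains of large
    degree vanish there, whatever the dimension of $X$. The coefficients are Z/n, with $n$ possibly
    composite, because the norm and $1-a$ then both have coefficient sum 0. They therefore kill the
    value of a cochain on the empty sequence, and this keeps the unit intact while the zigzag is
    shortened. Cochains are functions on sequences of all sizes together, which avoids any indexing
    by degree. *)

Lemma pair_continuous (T U V : topologicalType) (f : T -> U) (g : T -> V) :
  continuous f -> continuous g -> continuous (fun x => (f x, g x)).
Proof. by move=> cf cg x; apply: cvg_pair => /=; [exact: cf|exact: cg]. Qed.

Lemma comp_continuous (T U V : topologicalType) (f : T -> U) (g : U -> V) :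
  continuous f -> continuous g -> continuous (fun x => g (f x)).
Proof. by move=> cf cg x; apply: (@cvg_comp _ _ _ f g); [exact: cf|exact: cg]. Qed.

(** * Cochains *)

Section cochains.
Variable F : comNzRingType.

(* Augmented ordered cochains: the value on [[::]] is the part of degree -1. *)
Fixpoint coboundary (V : Type) (c : seq V -> F) (s : seq V) : F :=
  if s is v :: s' then c s' - coboundary (fun t => c (v :: t)) s' else 0.

Definition pullback (V W : Type) (h : V -> W) (c : seq W -> F) (s : seq V) : F :=
  c (map h s).

Lemma coboundary_local (V : eqType) (c c' : seq V -> F) s :
  (forall t, {subset t <= s} -> c t = c' t) -> coboundary c s = coboundary c' s.
Proof.
elim: s c c' => [//|v s IH] c c' cc' /=; rewrite cc'; last first.
  by move=> u us; rewrite inE us orbT.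
congr (_ - _); apply: IH => t ts; apply: cc' => u; rewrite !inE.
by move=> /orP[->//|/ts ->]; rewrite orbT.
Qed.

Lemma eq_coboundary (V : Type) (c c' : seq V -> F) : c =1 c' -> coboundary c =1 coboundary c'.
Proof. by move=> /funext ->. Qed.

Lemma coboundary0 (V : Type) s : coboundary (fun _ : seq V => 0) s = 0.
Proof. by elim: s => //= v s ->; rewrite subr0. Qed.

Lemma coboundaryD (V : Type) (c d : seq V -> F) s :
  coboundary (fun t => c t + d t) s = coboundary c s + coboundary d s.
Proof.
elim: s c d => [|v s IH] c d /=; first by rewrite addr0.
by rewrite IH opprD addrACA.
Qed.

Lemma coboundaryN (V : Type) (c : seq V -> F) s :
  coboundary (fun t => - c t) s = - coboundary c s.
Proof.
by elim: s c => [|v s IH] c /=; rewrite ?oppr0// IH opprD.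
Qed.

Lemma coboundaryZ (V : Type) (w : F) (c : seq V -> F) s :
  coboundary (fun t => w * c t) s = w * coboundary c s.
Proof. by elim: s c => [|v s IH] c /=; rewrite ?mulr0// IH mulrBr. Qed.

Lemma coboundary_sum (V I : Type) (r : seq I) (c : I -> seq V -> F) s :
  coboundary (fun t => \sum_(i <- r) c i t) s = \sum_(i <- r) coboundary (c i) s.
Proof.
elim: r => [|i r IH].
  by rewrite big_nil -[RHS](@coboundary0 V s); apply: eq_coboundary => t; rewrite big_nil.
rewrite big_cons -IH -coboundaryD; apply: eq_coboundary => t.
by rewrite big_cons.
Qed.

Lemma coboundaryK (V : Type) (c : seq V -> F) s : coboundary (coboundary c) s = 0.
Proof.
elim: s c => //= v s IH c; rewrite coboundaryD coboundaryN IH.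
by rewrite subr0 subrr.
Qed.

Lemma coboundary_pullback (V W : Type) (h : V -> W) (c : seq W -> F) s :
  coboundary (pullback h c) s = coboundary c (map h s).
Proof. by elim: s c => //= v s IH c; rewrite -IH. Qed.

(** Unrolled, this is the alternating sum over $i$ of $c(h v_0,\dots,h v_i,h' v_i,\dots,h' v_k)$. *)
Fixpoint prism (V W : Type) (h h' : V -> W) (c : seq W -> F) (s : seq V) : F :=
  if s is v :: s' then c [:: h v, h' v & map h' s'] - prism h h' (fun t => c (h v :: t)) s'
  else 0.

(** Peeling off the first vertex $v$ leaves the same formula for the cochain [c (h v :: _)]; the
    other terms cancel. *)
Lemma prismE (V W : Type) (h h' : V -> W) (c : seq W -> F) s :
  coboundary (prism h h' c) s + prism h h' (coboundary c) s =
  pullback h' c s - pullback h c s.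
Proof.
rewrite /pullback; elim: s c => [|v s IH] c /=; first by rewrite subrr addr0.
have -> : coboundary (fun t => c [:: h v, h' v & map h' t] -
    prism h h' (fun t0 => c (h v :: t0)) t) s =
    coboundary (fun t => c [:: h v, h' v & t]) (map h' s) -
    coboundary (prism h h' (fun t0 => c (h v :: t0))) s.
  by rewrite coboundaryD coboundaryN -coboundary_pullback.
have prismB c1 c2 : prism h h' (fun t => c1 t - c2 t) s =
    prism h h' c1 s - prism h h' c2 s.
  elim: s c1 c2 {IH} => [|w s IHs] c1 c2 /=; first by rewrite subrr.
  by rewrite IHs; ring.
have /(canRL (addrK _)) -> := IH (fun t => c (h v :: t)).
by rewrite prismB; ring.
Qed.
End cochains.

(** * Germs along the diagonal *)

Section germs.
Variable X : topologicalType.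

(** On a compact Hausdorff space these are the entourages of its unique uniformity. *)
Definition diag_nbhs (U : set (X * X)) := forall x : X, nbhs (x, x) U.

(** The empty sequence is small for every $U$, so a germ still determines the value in degree -1. *)
Definition small (U : set (X * X)) (s : seq X) :=
  forall x y, x \in s -> y \in s -> U (x, y).

Lemma diag_nbhsI U V : diag_nbhs U -> diag_nbhs V -> diag_nbhs (U `&` V).
Proof. by move=> hU hV x; apply: filterI. Qed.

Lemma smallS (U V : set (X * X)) s : U `<=` V -> small U s -> small V s.
Proof. by move=> UV Us x y xs ys; apply: UV; exact: Us. Qed.

Lemma diag_small1 U x : diag_nbhs U -> small U [:: x].
Proof. by move=> hU y z; rewrite !inE => /eqP-> /eqP->; exact: nbhs_singleton. Qed.

Variable F : comNzRingType.
Implicit Types c d : seq X -> F.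

Definition germ_eq c d :=
  exists2 U, diag_nbhs U & forall s, small U s -> c s = d s.

Lemma germ_eq_refl c : germ_eq c c.
Proof. by exists setT => // x; exact: filterT. Qed.

Lemma germ_eq_sym c d : germ_eq c d -> germ_eq d c.
Proof. by case=> U hU cd; exists U => // s /cd. Qed.

Lemma germ_eq_trans c d e : germ_eq c d -> germ_eq d e -> germ_eq c e.
Proof.
move=> [U hU cd] [V hV de]; exists (U `&` V) => [|s UVs]; first exact: diag_nbhsI.
by rewrite cd ?de//; apply: smallS UVs => ? [].
Qed.

Lemma germ_eqB c c' d d' : germ_eq c c' -> germ_eq d d' ->
  germ_eq (fun s => c s - d s) (fun s => c' s - d' s).
Proof.
move=> [U hU cc'] [V hV dd']; exists (U `&` V) => [|s UVs]; first exact: diag_nbhsI.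
by rewrite cc' ?dd'//; apply: smallS UVs => ? [].
Qed.

Lemma germ_eq_sum (r : seq nat) (c c' : nat -> seq X -> F) :
  (forall i, germ_eq (c i) (c' i)) ->
  germ_eq (fun s => \sum_(i <- r) c i s) (fun s => \sum_(i <- r) c' i s).
Proof.
move=> cc'; elim: r => [|i r [U hU IH]].
  by exists setT => [x|s _]; rewrite ?big_nil//; exact: filterT.
have [V hV ci] := cc' i; exists (U `&` V) => [|s UVs]; first exact: diag_nbhsI.
by rewrite !big_cons IH ?ci//; apply: smallS UVs => ? [].
Qed.

Lemma germ_eqM (w : F) c c' : germ_eq c c' -> germ_eq (fun s => w * c s) (fun s => w * c' s).
Proof. by case=> U hU cc'; exists U => // s /cc' ->. Qed.

Lemma germ_eq_pullback (h : X -> X) c c' : continuous h ->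
  germ_eq c c' -> germ_eq (pullback h c) (pullback h c').
Proof.
move=> ch [U hU cc']; exists (fun p => U (h p.1, h p.2)) => [x|s Us].
  have : {for (x, x), continuous (fun p : X * X => (h p.1, h p.2))}.
    apply: cvg_pair => /=.
    - by apply: (@cvg_comp _ _ _ fst h _ (nbhs x)); [exact: cvg_fst|exact: ch].
    - by apply: (@cvg_comp _ _ _ snd h _ (nbhs x)); [exact: cvg_snd|exact: ch].
  by apply; exact: hU.
apply: cc' => _ _ /mapP[x xs ->] /mapP[y ys ->]; exact: Us.
Qed.

End germs.

(** * Shortening a zigzag along an equivariant map *)

Section zigzag.
Variables (X : topologicalType) (F : comNzRingType) (n : nat) (a : X -> X).
Hypotheses (n_gt1 : (1 < n)%N) (nF : n%:R = 0 :> F).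
Hypotheses (a_cont : continuous a) (an : forall x, iter n a x = x).
Implicit Types c d : seq X -> F.

(* The action on cochains of an element of the group ring of Z/n. *)
Definition grop (V : Type) (a : V -> V) (w : nat -> F) (c : seq V -> F) (s : seq V) : F :=
  \sum_(i <- iota 0 n) w i * c (map (iter i a) s).

(* Multiplication by the norm element and by [1 - a] give the periodic
   resolution of the trivial module. *)
Definition zzop (b : bool) : nat -> F :=
  if b then fun i => (i == 0)%:R - (i == 1)%:R else fun => 1.

Lemma grop_diff (V : Type) (f : V -> V) (c : seq V -> F) s :
  grop f (zzop true) c s = c s - c (map f s).
Proof.
(* Since $1<n$, both indices 0 and 1 occur in the sum. *)
rewrite /grop; case: n n_gt1 => [|[|m]]// _ /=.
rewrite !big_cons big1_seq => [|i]; last first.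
  by rewrite mem_iota => /andP[_]; case: i => [|[|i]]//; rewrite subrr mul0r.
by rewrite addr0 subr0 sub0r mul1r mulN1r map_id.
Qed.

Lemma grop_norm (V : Type) (f : V -> V) (c : seq V -> F) s :
  grop f (zzop false) c s = \sum_(i < n) c (map (iter i f) s).
Proof.
rewrite /grop -[n in iota 0 n]subn0 big_mkord.
by apply: eq_bigr => i _; rewrite mul1r.
Qed.

Lemma zzop_sum b : \sum_(i <- iota 0 n) zzop b i = 0.
Proof.
transitivity (@grop unit id (zzop b) (fun=> 1) [::]).
  by apply: eq_bigr => i _; rewrite mulr1.
by case: b; rewrite ?grop_diff ?subrr// grop_norm sumr_const card_ord nF.
Qed.

(** The empty sequence is fixed by the action, so an operator multiplies the value there by the sum
    of its coefficients. *)
Lemma grop_zz_nil (V : Type) (f : V -> V) b (c : seq V -> F) :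
  grop f (zzop b) c [::] = 0.
Proof. by rewrite -[RHS](mul0r (c [::])) -(zzop_sum b) mulr_suml. Qed.

Lemma telescope_orbit (V : Type) (f : V -> V) (c : seq V -> F) s :
  (forall x, iter n f x = x) ->
  \sum_(i < n) (c (map (iter i f) s) - c (map (iter i.+1 f) s)) = 0.
Proof.
move=> fn; rewrite -(big_mkord xpredT (fun i => c (map (iter i f) s) - c (map (iter i.+1 f) s))).
under eq_bigr do rewrite -opprB; rewrite sumrN telescope_sumr//.
by rewrite map_id (eq_map fn) map_id subrr oppr0.
Qed.

Lemma grop_zz (V : Type) (f : V -> V) b (c : seq V -> F) s :
  (forall x, iter n f x = x) -> grop f (zzop b) (grop f (zzop (~~ b)) c) s = 0.
Proof.
move=> fn; case: b => /=.
  rewrite grop_diff !grop_norm -sumrB -[RHS](telescope_orbit c s fn).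
  apply: eq_bigr => i _; rewrite -map_comp; congr (_ - c _).
  by apply: eq_map => x /=; rewrite -iterSr.
rewrite grop_norm -[RHS](telescope_orbit c s fn); apply: eq_bigr => i _.
by rewrite grop_diff -map_comp.
Qed.

Lemma gropB (w : nat -> F) c d s :
  grop a w (fun t => c t - d t) s = grop a w c s - grop a w d s.
Proof. by rewrite /grop -sumrB; apply: eq_bigr => i _; rewrite mulrBr. Qed.

Lemma grop_coboundary (V : Type) (f : V -> V) (w : nat -> F) (c : seq V -> F) s :
  coboundary (grop f w c) s = grop f w (coboundary c) s.
Proof.
rewrite /grop coboundary_sum; apply: eq_bigr => i _.
by rewrite coboundaryZ -coboundary_pullback.
Qed.

Lemma grop_pullback (V W : Type) (f : V -> V) (g : W -> W) (h : V -> W) w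
    (c : seq W -> F) s : (forall x, h (f x) = g (h x)) ->
  grop f w (pullback h c) s = grop g w c (map h s).
Proof.
move=> hfg; apply: eq_bigr => i _; rewrite /pullback -!map_comp; congr (_ * c _).
by apply: eq_map => x /=; elim: (i) => //= j <-; rewrite hfg.
Qed.

Lemma germ_eq_grop w c d : germ_eq c d -> germ_eq (grop a w c) (grop a w d).
Proof.
move=> cd; apply: (@germ_eq_sum _ _ _ (fun i s => w i * c (map (iter i a) s))
  (fun i s => w i * d (map (iter i a) s))) => i.
apply: germ_eqM; apply: germ_eq_pullback cd => /=.
elim: i => [|i IH] x; first exact: cvg_id.
by apply: (@cvg_comp _ _ _ (iter i a) a); [exact: IH|exact: a_cont].
Qed.

Variable phi : X -> X.
Hypotheses (phi_cont : continuous phi) (phia : forall x, phi (a x) = a (phi x)).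
Hypothesis phi0 : forall c : seq X -> F, germ_eq (coboundary c) (fun=> 0) ->
  exists d, germ_eq (pullback phi c) (coboundary d).

(** The cocycle at the end of the zigzag becomes a coboundary $\delta d$ after pullback. Subtracting
    the operator applied to $d$ from the previous cochain makes that one a cocycle, so the zigzag
    loses a step. *)
Lemma no_zigzag k (b : nat -> seq X -> F) (x0 : X) : b 0%N [::] = 1 ->
  (forall i, (i < k)%N -> germ_eq (coboundary (b i)) (grop a (zzop (odd i)) (b i.+1))) ->
  ~ germ_eq (coboundary (b k)) (fun=> 0).
Proof.
elim: k b => [|k IH] b b0 bi bk.
  (* On a single point the coboundary of [b 0] is its value on the empty sequence, namely 1. *)
  case: bk => U hU /(_ [:: x0] (@diag_small1 _ _ x0 hU)) /=.
  by rewrite b0 subr0; apply/eqP; exact: oner_neq0.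
have [d bd] := phi0 bk.
(* Only the new last cochain is corrected; [grop_zz_nil] protects its value on the empty sequence in
   case it is also the first. *)
pose b' i := if (i < k)%N then pullback phi (b i)
  else fun s => pullback phi (b i) s - grop a (zzop (odd i)) d s.
have pg w c : grop a w (pullback phi c) =1 pullback phi (grop a w c).
  by move=> s; exact: (grop_pullback _ _ _ phia).
have pb c : coboundary (pullback phi c) =1 pullback phi (coboundary c).
  by move=> s; exact: coboundary_pullback.
apply: (IH b').
- by rewrite /b'; case: ifP => _; rewrite ?grop_zz_nil ?subr0.
- move=> i ik; rewrite {1}/b' ik (funext (pb _)).
  apply: germ_eq_trans (germ_eq_pullback phi_cont (bi _ (ltnW ik))) _.
  rewrite -(funext (pg _ _)) /b'; case: ifP => _; first exact: germ_eq_refl.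
  rewrite (funext (gropB _ _ _)) /=.
  (* The correction is invisible one step earlier, because consecutive operators compose to zero. *)
  under [X in germ_eq _ X]eq_fun do rewrite grop_zz// subr0.
  exact: germ_eq_refl.
- rewrite /b' ltnn /=.
  set g := fun s => _.
  have -> : coboundary g = fun s => pullback phi (coboundary (b k)) s -
      grop a (zzop (odd k)) (coboundary d) s.
    by apply/funext => s; rewrite /g coboundaryD coboundaryN grop_coboundary pb.
  have := germ_eqB (germ_eq_pullback phi_cont (bi _ (ltnSn k)))
    (germ_eq_grop (zzop (odd k)) (germ_eq_sym bd)).
  move=> h; apply: germ_eq_trans h _.
  by exists setT => [x|s _]; [exact: filterT|rewrite -pg subrr].
Qed.

End zigzag.

(** * Compactness and null-homotopies *)

Lemma compact_finite_subcover (X : topologicalType) (U : X -> set X) :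
  compact [set: X] -> (forall x, nbhs x (U x)) ->
  exists s : seq X, forall y, exists2 x, x \in s & U x y.
Proof.
move=> /compact_near_coveringP cX hU.
(* Finite sequences directed by inclusion: a property that holds eventually along this filter and
   locally on $X$ holds for one sequence on all of $X$. *)
pose F : set_system (seq X) :=
  [set S : set (seq X) | exists s0 : seq X, forall s : seq X, {subset s0 <= s} -> S s].
have FF : Filter F.
  split; first by exists [::].
    move=> P Q [s hP] [t hQ]; exists (s ++ t) => u su; split.
      by apply: hP => x xs; apply: su; rewrite mem_cat xs.
    by apply: hQ => x xs; apply: su; rewrite mem_cat xs orbT.
  by move=> P Q PQ [s hP]; exists s => u su; apply: PQ; exact: hP.
have [x _|s hs] := cX _ F (fun s y => exists2 x, x \in s & U x y) FF.
  exists (U x, [set s : seq X | x \in s]) => /=; last by move=> [y s] [/= Uy xs]; exists x.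
  by split=> //=; exists [:: x] => s; apply; rewrite inE.
by exists s => y; exact: (hs s).
Qed.

Lemma nbhs_diagP (X : topologicalType) (x : X) (U : set (X * X)) :
  nbhs (x, x) U -> exists2 A, nbhs x A & forall y z, A y -> A z -> U (y, z).
Proof.
move=> [[A B] /= [hA hB] AB]; exists (A `&` B); first exact: filterI.
by move=> y z [Ay _] [_ Bz]; exact: AB.
Qed.

Section unit_interval.
Variable R : realType.
Local Notation I := (unit_interval R).

Lemma nbhs_unit_interval (t : I) (A : set I) : nbhs t A ->
  exists2 e : R, 0 < e & forall u : I, `|val u - val t| < e -> A u.
Proof.
move=> [_ [[W oW <-] Wt] WA].
have /nbhs_ballP[e /= e0 eW] : nbhs (val t) W by exact: open_nbhs_nbhs.
by exists e => // u ut; apply: WA; apply: eW; rewrite /ball/= distrC.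
Qed.

Lemma unit_interval_near (t : I) (e : R) : 0 < e ->
  nbhs t [set u : I | `|val u - val t| < e].
Proof.
move=> e0; have c : continuous (set_val : I -> R) by exact: initial_continuous.
apply: (@filterS I (nbhs t) _ _ _ _ (c t (ball (val t) e) (nbhsx_ballx _ _ e0))) => u.
by rewrite /ball/= distrC.
Qed.

Lemma compact_set_type (T : topologicalType) (A : set T) :
  compact A -> compact [set: set_type A].
Proof.
move=> cA F FF _.
have vF : (set_val @ F) A.
  by apply: (@filterS _ F _ setT); [move=> y _; exact: set_valP|exact: filterT].
have [x [xA clx]] := cA (set_val @ F) _ vF.
exists (exist (fun u => u \in A) x (mem_set xA)); split=> //.
move=> B C FB [_ [[W oW <-] Wx] WC].
have vB : (set_val @ F) (set_val @` B).
  by apply: (@filterS _ F _ B) => // y By /=; exists y.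
have [z [[y By yz] Wz]] := clx _ _ vB (open_nbhs_nbhs (conj oW Wx)).
by exists y; split => //; apply: WC => /=; rewrite yz.
Qed.

Lemma unit_interval_compact : compact [set: I].
Proof. by apply: compact_set_type; exact: segment_compact. Qed.

Lemma unit_interval_frac_subproof (N j : nat) :
  (Num.min (j%:R / N%:R) 1 : R) \in `[0, 1]%classic.
Proof.
by apply: mem_set; rewrite /= in_itv/= ge_min lexx orbT le_min ler01 divr_ge0.
Qed.

(** The truncation at 1 makes the grid point total in [j]; for [j <= N] with [N] positive it is
    $j/N$. *)
Definition unit_interval_frac (N j : nat) : I :=
  exist (fun t => t \in (`[0, 1]%classic : set R)) _ (unit_interval_frac_subproof N j).

(** Uniform continuity without a uniform structure, by compactness first of the interval and then of
    $X$. The bound on times is not strict because neighbouring grid points are exactly $1/(N+1)$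
    apart. *)
Lemma uniform_homotopy (X : topologicalType) (H : X * I -> X) (U : set (X * X)) :
  compact [set: X] -> continuous H -> diag_nbhs U ->
  exists N : nat, exists2 V, diag_nbhs V &
    forall (x y : X) (s t : I), V (x, y) -> `|val s - val t| <= N.+1%:R^-1 -> U (H (x, s), H (y, t)).
Proof.
move=> cX cH hU.
pose Q (N : nat) (x y : X) (s : I) := forall t : I, `|val s - val t| <= N.+1%:R^-1 ->
  U (H (x, s), H (y, t)).
have h1 (x : X) : \forall p \near nbhs (x, x) & N \near \oo, forall s, Q N p.1 p.2 s.
  have /compact_near_coveringP cI := unit_interval_compact.
  have FF : Filter (filter_prod (nbhs (x, x)) \oo) by exact _.
  have [t _|[A B] /= [hA hB] AB] := cI _ (filter_prod (nbhs (x, x)) \oo)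
    (fun pN s => Q pN.2 pN.1.1 pN.1.2 s) FF; last first.
    by exists (A, B) => // -[p N] /= pN s; exact: (AB (p, N) pN s Logic.I).
  have [W hW WU] := nbhs_diagP (hU (H (x, t))).
  have [[A B] /= [hA /nbhs_unit_interval[e e0 eB]] AB] := cH (x, t) _ hW.
  (* One half of [e] bounds the distance from [s] to the centre [t], the other the time step. *)
  have e20 : 0 < e / 2 by rewrite divr_gt0.
  have key (a b c d : R) : `|a - b| <= d -> d < e / 2 -> `|a - c| < e / 2 -> `|b - c| < e.
    by move=> ad de ac; have := ler_distD a b c; rewrite (distrC b a) => ?; lra.
  exists ([set s | `|val s - val t| < e / 2],
    [set pN : (X * X) * nat | A pN.1.1 /\ A pN.1.2 /\ pN.2.+1%:R^-1 < e / 2]); last first.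
    move=> [s [[y z] N]] /= [st [Ay [Az Ne]]] t' t'N; apply: WU; apply: AB; split=> //=.
      by apply: eB; lra.
    exact/eB/(key _ _ _ _ t'N Ne st).
  split => /=; first exact: unit_interval_near.
  exists ([set p | A p.1 /\ A p.2], [set N | N.+1%:R^-1 < e / 2]).
    split => /=; first by exists (A, A).
    exact: near_infty_natSinv_lt (PosNum e20).
  by move=> [p N] /= [[? ?] ?].
(* The bound is now uniform in time near each diagonal point; compactness of $X$ gives one [N] for
   all points. *)
have /compact_near_coveringP cX' := cX.
have [x _|N _ /(_ N (leqnn N)) hN] := cX' _ (nbhs \oo)
    (fun N x => nbhs (x, x) [set p | forall s, Q N p.1 p.2 s]) _.
  have [[A B] /= [/nbhs_diagP[C hC CA] hB] AB] := h1 x.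
  exists (C^°, B) => /=; first by split => //; exact: nbhs_interior.
  move=> [y N] /= [Cy BN]; exists (C, C) => [//|[u v] /= [Cu Cv] s].
  by apply: (AB ((u, v), N)); split => //; exact: CA.
exists N, [set p | forall s, Q N p.1 p.2 s] => [x|x y s t]; first exact: hN.
exact.
Qed.

End unit_interval.

Lemma prism_eq0 (V W : eqType) (F : comNzRingType) (h h' : V -> W) (c : seq W -> F) s :
  (forall t, (forall w, w \in t -> exists2 v, v \in s & w = h v \/ w = h' v) -> c t = 0) ->
  prism h h' c s = 0.
Proof.
elim: s c => //= v s IH c c0; rewrite c0 ?sub0r ?IH ?oppr0//.
  move=> t ts; apply: c0 => w; rewrite inE => /orP[/eqP->|/ts[u us wu]].
    by exists v; [rewrite mem_head|left].
  by exists u => //; rewrite inE us orbT.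
move=> w; rewrite !inE => /or3P[/eqP->|/eqP->|/mapP[u us ->]].
- by exists v; [rewrite mem_head|left].
- by exists v; [rewrite mem_head|right].
- by exists u; [rewrite inE us orbT|right].
Qed.

Section null_homotopy.
Variables (R : realType) (F : comNzRingType) (X : topologicalType).
Variables (H : X * unit_interval R -> X) (pt : X).
Hypotheses (cX : compact [set: X]) (cH : continuous H).
Hypothesis H0 : forall x, H (x, unit_interval0 R) = pt.

(** On a grid so fine that every prism is small, the prisms link the end map to the constant map at
    [pt]; there a cocycle bounds its cone with apex [pt]. *)
Lemma null_homotopy_germ (c : seq X -> F) : germ_eq (coboundary c) (fun=> 0) ->
  exists d, germ_eq (pullback (fun x => H (x, unit_interval1 R)) c) (coboundary d).
Proof.
move=> [U hU c0]; have [N [V hV VU]] := uniform_homotopy cX cH hU.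
pose u := unit_interval_frac R N.+1.
have uE j : (j <= N.+1)%N -> val (u j) = j%:R / N.+1%:R.
  by move=> jN; apply/min_idPl; rewrite ler_pdivrMr ?mul1r ?ler_nat.
have u0 : u 0%N = unit_interval0 R by apply: val_inj; rewrite uE//= mul0r.
have u1 : u N.+1 = unit_interval1 R by apply: val_inj; rewrite uE//= divff.
pose h j x := H (x, u j).
have hs j (i i' : nat) x y : (j < N.+1)%N -> (j <= i <= j.+1)%N -> (j <= i' <= j.+1)%N ->
    V (x, y) -> U (h i x, h i' y).
  move=> jN ij i'j Vxy; apply: VU => //; rewrite !uE; [|lia|lia].
  rewrite -mulrBl normrM [X in _ * X]ger0_norm// ler_piMl//.
  have : i = i' \/ (i = i'.+1 \/ i' = i.+1) by lia.
  move=> [->|[->|->]]; rewrite ?subrr ?normr0// -natr1.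
    by rewrite addrAC subrr add0r normr1.
  by rewrite opprD addrA subrr add0r normrN1.
(* The coboundary of the prisms telescopes to time 1 minus time 0, and the cone supplies the time 0
   term. *)
pose d s := \sum_(j <- iota 0 N.+1) prism (h j) (h j.+1) c s + c (pt :: map (h 0%N) s).
exists d; exists V => // s Vs; rewrite coboundaryD coboundary_sum.
have -> : coboundary (fun t => c (pt :: map (h 0%N) t)) s = pullback (h 0%N) c s.
  rewrite -/(pullback (h 0%N) (fun t => c (pt :: t))) coboundary_pullback.
  have /c0/= : small U (pt :: map (h 0%N) s).
    have pE w : w \in pt :: map (h 0%N) s -> w = pt.
      by rewrite inE => /orP[/eqP//|/mapP[x _ ->]]; rewrite /h u0.
    by move=> x y /pE -> /pE ->; exact: nbhs_singleton.
  by move/eqP; rewrite subr_eq0 => /eqP.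
have -> : \sum_(j <- iota 0 N.+1) coboundary (prism (h j) (h j.+1) c) s =
    \sum_(0 <= j < N.+1) (pullback (h j.+1) c s - pullback (h j) c s).
  apply: eq_big_seq => j; rewrite mem_iota add0n => /andP[_ jN].
  rewrite -prismE [X in _ + X]prism_eq0 ?addr0// => t ts; apply: c0 => x y /ts[x' xs xE] /ts[y' ys yE].
  have Vxy := Vs _ _ xs ys.
  by case: xE yE => -> [] ->; apply: (hs j) Vxy => //; lia.
by rewrite telescope_sumr// subrK /pullback/h u1.
Qed.

End null_homotopy.

(** * Zigzags on finite complexes of labels *)

Section alternating.
Variables (F : comNzRingType).

(** The predicate describes a simplicial complex by its vertex sequences, repetitions allowed. *)
Definition hereditary (V : eqType) (K : seq V -> Prop) :=
  forall s t, {subset t <= s} -> K s -> K t.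

(** Vanishing on repeated vertices is a separate clause, since 2 may be zero or a zero divisor in
    [F]. *)
Definition alternating (V : eqType) (K : seq V -> Prop) (c : seq V -> F) :=
  forall r u v t, K (r ++ [:: u, v & t]) ->
    c (r ++ [:: u, v & t]) = - c (r ++ [:: v, u & t]) /\
    (u = v -> c (r ++ [:: u, v & t]) = 0).

Lemma hereditary_cons (V : eqType) (K : seq V -> Prop) v :
  hereditary K -> hereditary (fun t => K (v :: t)).
Proof.
move=> hK s t ts; apply: hK => w; rewrite !inE => /orP[->//|/ts ->].
by rewrite orbT.
Qed.

(** Induction on the prefix, passing to the link of its first vertex. For an empty prefix, the faces
    omitting [u] and [v] exchange roles and the other faces alternate. *)
Lemma alternating_coboundary (V : eqType) (K : seq V -> Prop) (c : seq V -> F) :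
  hereditary K -> alternating K c -> alternating K (coboundary c).
Proof.
move=> + + r; elim: r K c => [|w r IH] K c hK cK u v t Kt; last first.
  rewrite /= in Kt *.
  have [] := IH (fun t => K (w :: t)) (fun t => c (w :: t)) _ _ u v t Kt.
  - exact: hereditary_cons.
  - by move=> r' u' v' t' /(cK (w :: r')).
  have [] := cK r u v t; first by apply: hK Kt => x; rewrite inE => ->; rewrite orbT.
  move=> h1 h1' h2 h2'; split; first by rewrite h1 h2 -opprD.
  by move=> uv; rewrite h1' ?h2' ?subr0.
have ht t' : {subset t' <= t} -> K [:: u, v & t'].
  move=> tt'; apply: hK Kt => x; rewrite !inE => /or3P[->//|->|/tt' ->];
    by rewrite !orbT.
split=> /= [|uv].
  have -> : coboundary (fun t => c [:: u, v & t]) t =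
            - coboundary (fun t => c [:: v, u & t]) t.
    rewrite -coboundaryN; apply: coboundary_local => t' /ht Kt'.
    by have [] := cK [::] _ _ _ Kt'.
  by ring.
have -> : coboundary (fun t => c [:: u, v & t]) t = 0.
  rewrite -(coboundary0 F t); apply: coboundary_local => t' /ht Kt'.
  by have [_ ->] := cK [::] _ _ _ Kt'.
by rewrite uv; ring.
Qed.

Lemma coboundary_size (V : Type) (i : nat) (c : seq V -> F) s :
  (forall t, (size t < i)%N -> c t = 0) -> (size s <= i)%N -> coboundary c s = 0.
Proof.
elim: s i c => //= v s IH i c ci si; rewrite ci// sub0r (IH i.-1) ?oppr0//; last lia.
by move=> t ti; apply: ci => /=; lia.
Qed.

(** Transpositions bring the second copy of a repeated head next to the first. *)
Lemma alternating_dup (V : eqType) (K : seq V -> Prop) (c : seq V -> F) s :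
  hereditary K -> alternating K c -> K s -> ~~ uniq s -> c s = 0.
Proof.
move=> hK cK; elim: s K c hK cK => //= v s IH K c hK cK Ks.
rewrite negb_and negbK => /orP[vs|us]; last first.
  apply: (IH (fun t => K (v :: t)) (fun t => c (v :: t))) => //.
    exact: hereditary_cons.
  by move=> r' u' v' t' /(cK (v :: r')).
case/splitPr: vs Ks => r t; elim: r {IH} K c hK cK => [|w r IH] K c hK cK Ks.
  by have [_ ->] := cK [::] v v t Ks.
have [-> _] := cK [::] v w (r ++ v :: t) Ks.
rewrite (IH (fun t => K (w :: t)) (fun t => c (w :: t))) ?oppr0//.
- exact: hereditary_cons.
- by move=> r' u' v' t' /(cK (w :: r')).
- by apply: hK Ks => x; rewrite !inE orbCA.
Qed.

End alternating.

Section labels.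
Variables (F : comNzRingType) (n : nat).
Hypotheses (n_gt1 : (1 < n)%N) (nF : n%:R = 0 :> F).

(* The vertex [l * n + s] with [s < n] carries the label [l] and the sign [s]. *)
Definition vertex_shift (v : nat) := (v %/ n * n + v.+1 %% n)%N.

(** At most one sign per label: these are the simplices of an iterated join of copies of the
    discrete set Z/n, as in Milnor's construction of the universal bundle. *)
Definition vertex_simplex (s : seq nat) :=
  forall u v, u \in s -> v \in s -> (u %/ n = v %/ n)%N -> u = v.

Lemma hereditary_simplex : hereditary vertex_simplex.
Proof. by move=> s t ts Ks u v /ts us /ts vs; exact: Ks. Qed.

Lemma vertex_shift_div v : (vertex_shift v %/ n = v %/ n)%N.
Proof. by rewrite /vertex_shift divnMDl 1?ltnW// (divn_small (ltn_pmod _ _)) ?addn0// ltnW. Qed.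

Lemma vertex_shift_mod v : (vertex_shift v %% n = (v %% n).+1 %% n)%N.
Proof. by rewrite /vertex_shift modnMDl modn_mod -addn1 -modnDml addn1. Qed.

Lemma iter_vertex_shift i v : iter i vertex_shift v = (v %/ n * n + (v + i) %% n)%N.
Proof.
elim: i => [|i IH] /=; first by rewrite addn0 -divn_eq.
have E u w : (u %/ n = w %/ n)%N -> (u %% n = w %% n)%N -> u = w.
  by move=> h1 h2; rewrite (divn_eq u n) (divn_eq w n) h1 h2.
have d j : ((v %/ n * n + (v + j) %% n) %/ n = v %/ n)%N.
  by rewrite divnMDl 1?ltnW// (divn_small (ltn_pmod _ _)) ?addn0// ltnW.
apply: E; first by rewrite vertex_shift_div IH !d.
rewrite vertex_shift_mod IH !modnMDl !modn_mod addnS -addn1 modnDml addn1//.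
Qed.

Lemma vertex_shift_order v : iter n vertex_shift v = v.
Proof. by rewrite iter_vertex_shift modnDr -divn_eq. Qed.

Lemma simplex_shift i s : vertex_simplex s -> vertex_simplex (map (iter i vertex_shift) s).
Proof.
move=> Ks _ _ /mapP[u us ->] /mapP[v vs ->] uv; congr (iter i _ _); apply: Ks => //.
have d w : (iter i vertex_shift w %/ n = w %/ n)%N.
  by elim: i {uv} => //= i <-; rewrite vertex_shift_div.
by rewrite -(d u) uv d.
Qed.

Definition least_vertex (s : seq nat) := head 0%N (sort leq s).

Lemma least_vertexP s : s != [::] ->
  least_vertex s \in s /\ forall v, v \in s -> (least_vertex s <= v)%N.
Proof.
move=> s0; rewrite /least_vertex; have := sort_sorted leq_total s.
have : size (sort leq s) != 0%N by rewrite size_sort size_eq0.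
have sE : sort leq s =i s by exact: mem_sort.
case: (sort leq s) sE => //= v t sE _ vt; split; first by rewrite -sE mem_head.
move=> w; rewrite -sE inE => /orP[/eqP->//|wt].
by have /allP/(_ _ wt) := order_path_min leq_trans vt.
Qed.

Lemma least_vertex_perm s t : perm_eq s t -> least_vertex s = least_vertex t.
Proof.
by move=> st; rewrite /least_vertex; congr head; apply/perm_sortP => //;
  [exact: leq_total|exact: leq_trans|exact: anti_leq].
Qed.

(** The shift may wrap a sign around and so change the order within a label; but it keeps labels,
    and in a simplex the order of the vertices is that of their labels. *)
Lemma least_vertex_shift s : s != [::] -> vertex_simplex s ->
  least_vertex (map vertex_shift s) = vertex_shift (least_vertex s).
Proof.
move=> s0 Ks; have [ls lmin] := least_vertexP s0.
have s0' : map vertex_shift s != [::] by case: (s) s0.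
have [/mapP[v vs vE] l'min] := least_vertexP s0'.
have := l'min _ (map_f _ ls); rewrite vE => le.
suff -> : v = least_vertex s by [].
apply: Ks => //; apply/eqP; rewrite eqn_leq; apply/andP; split.
  by have := leq_div2r n le; rewrite !vertex_shift_div.
by rewrite leq_div2r ?lmin.
Qed.

Definition sign (s : seq nat) := (least_vertex s %% n)%N.

Lemma sign_shift s : s != [::] -> vertex_simplex s ->
  sign (map vertex_shift s) = ((sign s).+1 %% n)%N.
Proof. by move=> s0 Ks; rewrite /sign least_vertex_shift// vertex_shift_mod. Qed.

Lemma sign_shift_iter i s : s != [::] -> vertex_simplex s ->
  sign (map (iter i vertex_shift) s) = ((sign s + i) %% n)%N.
Proof.
move=> s0 Ks; elim: i => [|i IH]; first by rewrite map_id addn0 /sign modn_mod.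
have -> : map (iter i.+1 vertex_shift) s = map vertex_shift (map (iter i vertex_shift) s).
  by rewrite -map_comp.
rewrite sign_shift; last exact: simplex_shift.
  by rewrite IH addnS -addn1 modnDml addn1.
by case: (s) s0.
Qed.

(* The sign trivialises the action on simplices, so that cocycles for one
   operator of the periodic resolution are images of the other. *)
Definition zzsolve (b : bool) (c : seq nat -> F) (s : seq nat) : F :=
  if b then - \sum_(i < sign s) c (map (iter (n - sign s + i) vertex_shift) s)
  else (sign s == 0)%:R * c s.

Lemma zzsolveP b c s : c [::] = 0 -> vertex_simplex s ->
  (forall t, vertex_simplex t -> grop n vertex_shift (zzop F (~~ b)) c t = 0) ->
  grop n vertex_shift (zzop F b) (zzsolve b c) s = c s.
Proof.
move=> c0 Ks Ec; have [->|s0] := eqVneq s [::].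
  by rewrite grop_zz_nil.
have n0 : (0 < n)%N by exact: ltnW.
have sn : (sign s < n)%N by rewrite ltn_pmod.
case: b Ec => Ec; rewrite [~~ _]/= in Ec; last first.
  (* Here [c] is invariant, so the norm of its restriction to sign 0 recovers it: on the orbit of
     [s] only the index congruent to minus the sign contributes. *)
  have cinv i : c (map (iter i vertex_shift) s) = c s.
    elim: i => [|i IH]; first by rewrite map_id.
    have := Ec _ (@simplex_shift i s Ks); rewrite grop_diff// => /eqP.
    by rewrite subr_eq0 IH -map_comp => /eqP.
  have i0n : ((n - sign s) %% n < n)%N by rewrite ltn_pmod.
  rewrite grop_norm (bigD1 (Ordinal i0n))//= big1 => [|i ii0].
    by rewrite addr0 /zzsolve sign_shift_iter// modnDmr subnKC ?(ltnW sn)// modnn mul1r.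
  rewrite /zzsolve sign_shift_iter//; case: eqP => [si|]; last by rewrite mul0r.
  have [] := negP ii0; apply/eqP/val_inj => /=; have ni := ltn_ord i.
  have [s1|s1] := eqVneq (sign s) 0%N; first by move: si; rewrite s1 subn0 modnn modn_small.
  rewrite modn_small; last lia.
  have /dvdnP[k] : (n %| sign s + i)%N by rewrite /dvdn si.
  by case: k => [|[|k]]; nia.
(* The solution is minus the sum of [c] over the translates of [s] whose sign is smaller than that
   of [s]. Passing to the shift of [s] adds the single term [c s]. *)
rewrite grop_diff// /zzsolve sign_shift//.
have [sn1|sn1] := ltnP (sign s).+1 n.
  rewrite modn_small// [X in _ - - X]big_ord_recr /=.
  rewrite -map_comp.
  have E : iter (n - (sign s).+1 + sign s) vertex_shift \o vertex_shift =1 id.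
    by move=> v /=; rewrite -iterSr (_ : _.+1 = n) ?vertex_shift_order//; lia.
  rewrite (seq.eq_map E) map_id.
  rewrite opprK addrA [X in _ + X + _](eq_bigr
    (fun i : 'I_(sign s) => c [seq iter (n - sign s + i) vertex_shift x | x <- s])).
    by rewrite addNr add0r.
  move=> i _; rewrite -map_comp; congr c; apply: seq.eq_map => v /=.
  by rewrite -iterSr (_ : _.+1 = n - sign s + i)%N//; lia.
(* When the sign wraps around to 0, the missing term comes from the vanishing of the norm of [c]. *)
have sE : (sign s).+1 = n by lia.
rewrite sE modnn big_ord0 oppr0 subr0.
have := Ec s Ks; rewrite grop_norm.
rewrite -(big_mkord xpredT (fun i => c [seq iter i vertex_shift v | v <- s])).
rewrite -sE big_nat_recl// big_mkord map_id.
move/eqP; rewrite addr_eq0 => /eqP ->; congr (- _); apply: eq_bigr => i _.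
by rewrite (_ : i.+1 = (sign s).+1 - sign s + i)%N//; lia.
Qed.
End labels.

Section zigzag_existence.
Variables (F : comNzRingType) (n : nat).
Hypotheses (n_gt1 : (1 < n)%N) (nF : n%:R = 0 :> F).
Local Notation shift := (vertex_shift n).
Local Notation simplex := (vertex_simplex n).

Lemma alternating_zzsolve b (c : seq nat -> F) :
  alternating simplex c -> alternating simplex (zzsolve n b c).
Proof.
move=> cK r u v t Ks.
have sE : sign n (r ++ [:: u, v & t]) = sign n (r ++ [:: v, u & t]).
  rewrite /sign; congr (_ %% _)%N; apply: least_vertex_perm.
  by rewrite perm_cat2l -![[:: _, _ & t]]/([:: _; _] ++ t) perm_cat2r; apply/permP => x /=; lia.
rewrite /zzsolve -sE; case: b; last first.
  have [-> h] := cK _ _ _ _ Ks; split=> [|uv]; first by rewrite mulrN.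
  by rewrite h// mulr0.
have cKi i := cK (map (iter i shift) r) (iter i shift u) (iter i shift v) (map (iter i shift) t).
have Ki i := @simplex_shift n n_gt1 i _ Ks.
split=> [|uv].
  congr (- _); rewrite -sumrN; apply: eq_bigr => i _.
  have := Ki (n - sign n (r ++ [:: u, v & t]) + i)%N.
  by rewrite !map_cat => /cKi[].
rewrite big1 ?oppr0// => i _; have := Ki (n - sign n (r ++ [:: u, v & t]) + i)%N.
by rewrite !map_cat => /cKi[_]; apply; congr iter.
Qed.

Fixpoint zigzag (i : nat) : seq nat -> F :=
  if i is j.+1 then zzsolve n (odd j) (coboundary (zigzag j))
  else fun s => (size s == 0)%:R.

Lemma alternating_zigzag i : alternating simplex (zigzag i).
Proof.
elim: i => [|i IH] /=; last first.
  apply: alternating_zzsolve; apply: alternating_coboundary => //.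
  exact: hereditary_simplex.
by move=> r u v t _; rewrite !size_cat/= !addnS oppr0.
Qed.

Lemma zigzag_size i s : (size s < i)%N -> zigzag i s = 0.
Proof.
elim: i s => //= i IH s si; rewrite /zzsolve; case: odd.
  rewrite big1 ?oppr0// => j _.
  by rewrite (coboundary_size IH)// size_map -ltnS.
by rewrite (coboundary_size IH) ?mulr0// -ltnS.
Qed.

(** [zzsolveP] needs the complementary operator to kill the coboundary. At the start this is
    invariance of the unit; later it follows from the preceding relation and $\delta\delta=0$. *)
Lemma zigzag_coboundary i s : simplex s ->
  coboundary (zigzag i) s = grop n shift (zzop F (odd i)) (zigzag i.+1) s.
Proof.
elim: i s => [|i IH] s Ks; rewrite [zigzag _.+1]/= zzsolveP//.
  move=> t Kt; rewrite grop_diff//; apply/eqP; rewrite subr_eq0; apply/eqP.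
  rewrite -coboundary_pullback; apply: eq_coboundary => u.
  by rewrite /pullback/= size_map.
move=> t Kt; rewrite [~~ _]/= negbK -grop_coboundary.
rewrite -(coboundaryK (zigzag i) t); apply: coboundary_local => u ut.
rewrite IH//; apply: hereditary_simplex ut Kt.
Qed.

(** With $m$ labels a simplex has at most $m$ distinct vertices: either the sequence is too short
    for [zigzag_size], or it repeats a vertex and the cochain alternates. *)
Lemma zigzag_eq0 m s : simplex s -> (forall v, v \in s -> (v < m * n)%N) ->
  zigzag m.+1 s = 0.
Proof.
move=> Ks sm; have [us|nus] := boolP (uniq s); last first.
  apply: alternating_dup (alternating_zigzag _) Ks nus; exact: hereditary_simplex.
apply: zigzag_size; rewrite ltnS -(size_iota 0 m) -(size_map (fun v => v %/ n)%N).
apply: uniq_leq_size.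
  by rewrite map_inj_in_uniq//; move=> u v us' vs; exact: Ks.
move=> _ /mapP[v vs ->]; rewrite mem_iota/= add0n ltn_divLR ?sm//.
exact: ltnW.
Qed.

End zigzag_existence.

(** * Labelling a space with a free cyclic action *)

Lemma filter_all_seq (T : Type) (I : eqType) (G : set_system T) (s : seq I)
    (f : I -> set T) : Filter G -> (forall i, i \in s -> G (f i)) ->
  G [set x | forall i, i \in s -> f i x].
Proof.
move=> FG; elim: s => [|i s IH] fs; first by apply: filterE => x i; rewrite in_nil.
have Gi : G (f i) by apply: fs; rewrite mem_head.
have Gs : G [set x | forall i, i \in s -> f i x].
  by apply: IH => j js; apply: fs; rewrite inE js orbT.
by apply: filterS2 Gi Gs => x fi fsx j; rewrite inE => /orP[/eqP->//|]; exact: fsx.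
Qed.

Section free_cyclic.
Variables (X : topologicalType) (n : nat) (a : X -> X).
Hypotheses (n_gt1 : (1 < n)%N) (cX : compact [set: X]) (hX : hausdorff_space X).
Hypotheses (a_cont : continuous a) (an : forall x, iter n a x = x).
Hypothesis a_free : forall x i, (0 < i < n)%N -> iter i a x <> x.

Lemma iter_continuous i : continuous (iter i a).
Proof.
elim: i => [|i IH] x; first exact: cvg_id.
by apply: (@cvg_comp _ _ _ (iter i a) a); [exact: IH|exact: a_cont].
Qed.

Lemma iter_modn i x : iter (i %% n)%N a x = iter i a x.
Proof.
rewrite [in RHS](divn_eq i n) addnC iterD; elim: (i %/ n)%N => [|k IH] //.
by rewrite mulSn iterD an IH.
Qed.

Lemma free_closed_nbhs (x : X) : exists K : set X,
  [/\ closed K, nbhs x K & forall i y, (0 < i < n)%N -> K y -> ~ K (iter i a y)].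
Proof.
have h i : exists K : set X, [/\ closed K, nbhs x K &
    (0 < i < n)%N -> forall y, K y -> ~ K (iter i a y)].
  have [i_n|i_n] := boolP (0 < i < n)%N; last by exists setT; split => //; exact: filterT.
  have := hX; rewrite open_hausdorff => /(_ x (iter i a x)).
  case; first by apply/eqP => /esym; exact: a_free.
  move=> [P Q] /= [/set_mem Px /set_mem Qx] [oP oQ PQ].
  have nP : nbhs x (P `&` iter i a @^-1` Q).
    apply: filterI; first exact: open_nbhs_nbhs.
    by apply: iter_continuous; exact: open_nbhs_nbhs.
  have [] := @compact_regular _ x setT hX cX (filterT) _ nP.
  move=> B nB BPQ.
  exists (closure B); split => //; first exact: closed_closure.
    by apply: filterS nB; exact: subset_closure.
  move=> _ y /BPQ[Py Qy] /BPQ[Piy _].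
  by have : (P `&` Q) (iter i a y) by []; rewrite (eqP PQ).
have [K hK] := choice h.
exists [set y | forall i, i \in iota 0 n -> K i y]; split.
- have -> : [set y | forall i, i \in iota 0 n -> K i y] = \bigcap_(i in [set` iota 0 n]) K i.
    by apply/seteqP; split.
  by apply: closed_bigI => i _; have [] := hK i.
- by apply: filter_all_seq => i _; have [] := hK i.
- move=> i y i_n Ky Kiy; have /andP[_ i_n'] := i_n.
  have [_ _ /(_ i_n y)] := hK i; by apply; [apply: Ky|apply: Kiy]; rewrite mem_iota.
Qed.

(** The label of $y$ is the first set of a finite cover that meets its orbit, and the sign tells
    which translate of $y$ lies in it. Labels jump, but as the sets are closed and disjoint from
    their translates, nearby points with equal labels have equal signs. *)
Lemma free_labelling : exists m (lambda : X -> nat),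
  [/\ forall x, lambda (a x) = vertex_shift n (lambda x),
      forall x, (lambda x < m * n)%N &
      exists2 U, diag_nbhs U & forall x y, U (x, y) ->
        (lambda x %/ n = lambda y %/ n)%N -> lambda x = lambda y].
Proof.
have n0 : (0 < n)%N by exact: ltnW.
have [K hK] := choice free_closed_nbhs.
have [s hs] := compact_finite_subcover cX (fun x => (let: And3 _ k _ := hK x in k)).
(* Disjointness of [K x] from its translates makes the exponent unique modulo $n$. *)
have Kmod x y i j : K x (iter i a y) -> K x (iter j a y) -> (i = j %[mod n])%N.
  wlog ij : i j / (i %% n <= j %% n)%N => [hw|] Ki Kj.
    by have /orP[ij|ij] := leq_total (i %% n) (j %% n); [|apply/esym]; exact: hw.
  apply: contrapT => /eqP ij'.
  have [_ _ /(_ (j %% n - i %% n)%N (iter (i %% n) a y))] := hK x; apply.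
  - by rewrite subn_gt0 ltn_neqAle ij' ij/= (leq_ltn_trans (leq_subr _ _)) ?ltn_pmod.
  - by rewrite iter_modn.
  - by rewrite -iterD subnK// iter_modn.
pose Q y x := `[< exists i, K x (iter i a y) >].
pose l y := find (Q y) s.
have lQ y : has (Q y) s.
  by have [x xs Kxy] := hs y; apply/hasP; exists x => //; apply/asboolP; exists 0%N.
have la y : l (a y) = l y.
  apply: eq_find => x; apply: asbool_equiv_eq; split=> -[i Ki].
    by exists i.+1; rewrite iterSr.
  exists (n.-1 + i)%N; rewrite -iterSr -addSn prednK// addnC iterD an//.
have hl y : exists v, (v %/ n = l y)%N /\ K (nth y s (l y)) (iter (n - v %% n) a y).
  have /asboolP[i Ki] := nth_find y (lQ y).
  (* The sign is $-i$ modulo $n$, so that the shift by [a] raises it by one. *)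
  exists (l y * n + (n - i %% n) %% n)%N.
  have im : (i %% n < n)%N by rewrite ltn_pmod.
  rewrite divnMDl// (divn_small (ltn_pmod _ _))// addn0 modnMDl modn_mod; split=> //.
  rewrite -iter_modn; set e := (_ %% n)%N.
  suff -> : e = (i %% n)%N by rewrite iter_modn.
  rewrite /e; have [->|i0] := eqVneq (i %% n)%N 0%N; first by rewrite subn0 modnn subn0 modnn.
  by rewrite [X in (n - X)%N]modn_small ?subKn ?modn_mod//; [exact: ltnW|lia].
have [lam hlam] := choice hl.
have lm y : (l y < size s)%N by rewrite -has_find.
have modE' u v : (u < n)%N -> (v < n)%N -> (n - u = n - v %[mod n])%N -> u = v.
  case: u v => [|u] [|v] un vn //; rewrite ?subn0 ?modnn.
  - by rewrite modn_small; lia.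
  - by rewrite modn_small; lia.
  - by rewrite !modn_small; lia.
have modE u v : (n - u %% n = n - v %% n %[mod n])%N -> (u = v %[mod n])%N.
  by apply: modE'; rewrite ltn_pmod.
have lamE u v : (u %/ n = v %/ n)%N -> (u = v %[mod n])%N -> u = v.
  by move=> h1 h2; rewrite (divn_eq u n) (divn_eq v n) h1 h2.
exists (size s), lam; split.
- move=> y; have [l1 K1] := hlam y; have [l2 K2] := hlam (a y).
  apply: lamE; first by rewrite vertex_shift_div// l1 l2 la.
  have yn : (lam y %% n < n)%N by rewrite ltn_pmod.
  apply: modE; rewrite vertex_shift_mod.
  move: K2; rewrite -iterSr la (set_nth_default y)// => K2.
  have /eqP := Kmod _ _ _ _ K1 K2.
  have [rn|rn] := ltnP (lam y %% n).+1 n.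
    rewrite (modn_small rn) (_ : n - lam y %% n = (n - (lam y %% n).+1) + 1)%N; last lia.
    by rewrite -(addn1 (n - _)%N) eqn_modDr => /eqP.
  rewrite (_ : n - lam y %% n = 0 + 1)%N; last lia.
  rewrite -(addn1 (n - _)%N) eqn_modDr => /eqP <-.
  by rewrite (_ : (lam y %% n).+1 = n) ?modnn ?subn0 ?modnn ?mod0n//; lia.
- by move=> y; rewrite -ltn_divLR// (hlam y).1.
(* [W q] forbids two points from entering the same closed set with incongruent exponents. Finitely
   many conditions suffice, the exponents running up to $n$ inclusive because [n - sign] equals $n$
   at sign 0. *)
- pose W (q : X * (nat * nat)) := [set p : X * X | (q.2.1 <> q.2.2 %[mod n])%N ->
    ~ (K q.1 (iter q.2.1 a p.1) /\ K q.1 (iter q.2.2 a p.2))].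
  pose D := [seq (x, ij) | x <- s,
    ij <- [seq (i, j) | i <- iota 0 n.+1, j <- iota 0 n.+1]].
  exists [set p | forall q, q \in D -> W q p] => [y|y z Uyz lyz].
    apply: filter_all_seq => -[x [i j]] _.
    have Ko k : closed (K x) -> ~ K x (iter k a y) -> nbhs y [set z | ~ K x (iter k a z)].
      move=> cK nK; have : nbhs (iter k a y) (~` K x).
        by apply: open_nbhs_nbhs; split => //; rewrite openC.
      exact: iter_continuous.
    have [cK _ _] := hK x; rewrite /W/=.
    have [ij|ij] := pselect (i = j %[mod n])%N; first by apply: filterE => p /(_ ij).
    (* At a diagonal point one of the two memberships fails by [Kmod], and it keeps failing nearby
       since the set is closed. *)
    have [Ki|/(Ko _ cK) Ki] := pselect (K x (iter i a y)); last first.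
      by exists ([set z | ~ K x (iter i a z)], setT) => [|p [/= pi _] _ []//]; split; [exact: Ki|exact: filterT].
    have [Kj|/(Ko _ cK) Kj] := pselect (K x (iter j a y)); first by case: ij; exact: Kmod Ki Kj.
    by exists (setT, [set z | ~ K x (iter j a z)]) => [|p [/= _ pj] _ []//]; split; [exact: filterT|exact: Kj].
  apply: lamE => //; apply: modE; apply: contrapT => nyz.
  have [l1 K1] := hlam y; have [l2 K2] := hlam z.
  pose x := nth y s (l y).
  apply: (Uyz (x, (n - lam y %% n, n - lam z %% n)%N)) => //=.
    rewrite /D; apply: allpairs_f; first by rewrite mem_nth.
    by apply: allpairs_f; rewrite mem_iota add0n ltnS leq_subr.
  split => //; rewrite /x -l1 lyz l2 (set_nth_default z)//.
Qed.
End free_cyclic.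

(** The labelling sends small sequences to simplices, so the zigzag on labels pulls back to germs on
    $X$; its term of index $m+1$ vanishes there, which makes term $m$ a cocycle. *)
Theorem no_equivariant_null_homotopy (R : realType) (X : topologicalType) (n : nat)
    (a : X -> X) (H : X * unit_interval R -> X) (x0 pt : X) :
  (1 < n)%N -> compact [set: X] -> hausdorff_space X ->
  continuous a -> (forall x, iter n a x = x) ->
  (forall x i, (0 < i < n)%N -> iter i a x <> x) ->
  continuous H -> (forall x, H (x, unit_interval0 R) = pt) ->
  ~ (forall x, H (a x, unit_interval1 R) = a (H (x, unit_interval1 R))).
Proof.
move=> n1 cX hX ca an afree cH H0 H1.
have nF : n%:R = 0 :> 'Z_n by rewrite pchar_Zp.
have [m [lam [lamE lamm [U hU Ulam]]]] := free_labelling n1 cX hX ca an afree.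
have Ks (s : seq X) : small U s -> vertex_simplex n (map lam s).
  by move=> Us _ _ /mapP[x xs ->] /mapP[y ys ->]; apply: Ulam; exact: Us.
pose phi x := H (x, unit_interval1 R).
have cphi : continuous phi.
  apply: (comp_continuous _ cH); apply: pair_continuous => x; first exact: cvg_id.
  exact: cvg_cst.
pose b i := pullback lam (zigzag 'Z_n n i).
have bE i : germ_eq (coboundary (b i)) (grop n a (zzop 'Z_n (odd i)) (b i.+1)).
  exists U => // s /Ks Ks'; rewrite coboundary_pullback zigzag_coboundary//.
  by rewrite (grop_pullback _ _ _ _ lamE).
apply: (@no_zigzag X 'Z_n n a n1 nF ca an phi cphi H1 _ m b x0).
- by move=> c; exact: null_homotopy_germ.
- by [].
- by move=> i _; exact: bE.
apply: germ_eq_trans (bE m) _; exists U => // s Us.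
rewrite (grop_pullback _ _ _ _ lamE) /grop big1// => i _; rewrite (@zigzag_eq0 _ _ n1 m) ?mulr0//.
  exact/(simplex_shift n1)/Ks.
move=> _ /mapP[_ /mapP[x _ ->] ->]; rewrite -ltn_divLR ?(ltnW n1)//.
have -> : (iter i (vertex_shift n) (lam x) %/ n = lam x %/ n)%N.
  by elim: i => //= i <-; rewrite vertex_shift_div.
by rewrite ltn_divLR ?(ltnW n1).
Qed.

(** * The complex numbers and the circle *)

Import complex.
Local Open Scope complex_scope.

Section complex_topology.
Variable R : realType.
Local Notation C := (R[i]^o).

Lemma complex_gt0 (e : R[i]) : 0 < e -> (Re e)%:C = e /\ 0 < Re e.
Proof.
move=> e0; have eE := @RRe_real R e (gtr0_real e0); split=> //.
by rewrite -(ltcR 0) eE.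
Qed.

Lemma normc_ReIm (z : R[i]) : `|z| <= (`|Re z| + `|Im z|)%:C.
Proof.
rewrite normc_def lecR -[leRHS]ger0_norm ?addr_ge0// -sqrtr_sqr ler_wsqrtr//.
rewrite -(real_normK (num_real (Re z))) -(real_normK (num_real (Im z))) sqrrD.
by rewrite lerD2r lerDl mulrn_wge0 ?mulr_ge0.
Qed.

Lemma normc_ge_Im (z : R[i]) : `|Im z|%:C <= `|z|.
Proof.
by rewrite normc_def lecR -sqrtr_sqr ler_wsqrtr// lerDr sqr_ge0.
Qed.

Lemma Complex_continuous : continuous (fun p : R * R => (p.1 +i* p.2 : C)).
Proof.
move=> p; apply/cvgrPdist_lt => /= e /complex_gt0[<-]; set d := Re e => d0.
have d20 : 0 < d / 2 by rewrite divr_gt0.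
exists (ball p.1 (d / 2), ball p.2 (d / 2)).
  by split; exact: nbhsx_ballx.
move=> [x y] [/= px py]; apply: le_lt_trans (normc_ReIm _) _.
rewrite ltcR; case: p px py => a b /=; rewrite /ball/= => ? ?; lra.
Qed.

Lemma real_complex_continuous : continuous (fun x : R => (x%:C : C)).
Proof.
apply: (@comp_continuous _ _ _ (fun x : R => (x, 0 : R)) _ _ Complex_continuous).
by apply: pair_continuous => x; [exact: cvg_id|exact: cvg_cst].
Qed.

Lemma Re_continuous : continuous (fun z : C => Re z : R).
Proof.
move=> z A /nbhs_ballP[e /= e0 eA]; exists e%:C; first by rewrite /= (ltcR 0).
move=> w zw; apply: eA; rewrite /ball/= -ltcR.
by apply: le_lt_trans zw; have := normc_ge_Re (z - w); case: z w => [? ?] [? ?].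
Qed.

Lemma conjc_continuous : continuous (fun z : C => (z^* : C)).
Proof.
move=> z A /nbhs_ballP[e /= e0 eA]; exists e => // w zw.
by apply: eA; rewrite /ball/= -rmorphB/= normcJ.
Qed.

Lemma complex_mul_continuous : continuous (fun p : C * C => (p.1 * p.2 : C)).
Proof. exact: scale_continuous. Qed.

Lemma complex_hausdorff : hausdorff_space C.
Proof. exact: norm_hausdorff. Qed.

Lemma closed_eq_fun (T : topologicalType) (f g : T -> C) :
  continuous f -> continuous g -> closed [set t | f t = g t].
Proof.
move=> cf cg; have -> : [set t | f t = g t] = (fun t => f t - g t : C) @^-1` [set 0].
  apply/seteqP; split=> t /=; first by move=> ->; rewrite subrr.
  by move=> /eqP; rewrite subr_eq0 => /eqP.
apply: closed_comp; first by move=> t _; apply: cvgB; [exact: cf|exact: cg].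
exact/accessible_closed_set1/hausdorff_accessible/complex_hausdorff.
Qed.

Lemma disc_compact (r : R) : compact [set z : C | `|z| <= r%:C].
Proof.
pose I : set R := `[-r, r]%classic.
pose K := ((fun p : R * R => (p.1 +i* p.2 : C)) @` (I `*` I)).
have cK : compact K.
  apply: continuous_compact.
    by apply: continuous_subspaceT; exact: Complex_continuous.
  by apply: compact_setX; exact: segment_compact.
apply: (subclosed_compact _ cK).
  have -> : [set z : C | `|z| <= r%:C] = (fun z : C => Re `|z|) @^-1` [set x | x <= r].
    by apply/seteqP; split=> -[x y]; rewrite /= normc_def lecR.
  apply: closed_comp; last exact: closed_le.
  by move=> z _; apply: (comp_continuous (@norm_continuous _ C)); exact: Re_continuous.
move=> z /= zr; exists (Re z, Im z); last by case: z {zr}.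
split; rewrite /I /= in_itv/= -ler_norml -lecR.
  exact: le_trans (normc_ge_Re _) _.
exact: le_trans (normc_ge_Im _) _.
Qed.

End complex_topology.

(** * Closed subgroups of the line and of the circle *)

Lemma real_subgroup (R : realType) (A : set R) (T : R) : closed A -> A 0 ->
  (forall x y, A x -> A y -> A (x - y)) -> 0 < T -> A T ->
  A = setT \/ exists2 n : nat, (0 < n)%N &
    forall t, A t <-> exists k : int, t = k%:~R * (T / n%:R).
Proof.
move=> cA A0 AB T0 AT.
have AN x : A x -> A (- x) by move=> Ax; rewrite -sub0r; exact: AB.
have AD x y : A x -> A y -> A (x + y) by move=> Ax Ay; rewrite -[y]opprK; apply: AB => //; exact: AN.
have AM (k : int) x : A x -> A (k%:~R * x).
  move=> Ax; have An (n : nat) : A (n%:R * x).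
    elim: n => [|n IH]; first by rewrite mul0r.
    by rewrite -natr1 mulrDl mul1r; exact: AD.
  case: k => n; first exact: An.
  by rewrite NegzE mulrNz mulNr; apply: AN; exact: An.
pose P := [set t | 0 < t /\ A t].
have lbP : lbound P 0 by move=> t [/ltW].
have P0 : P !=set0 by exists T.
have hP : has_inf P by split => //; exists 0.
have a0 : 0 <= inf P by exact: lb_le_inf.
have fl (p t : R) : 0 < p -> 0 <= t - (Num.floor (t / p))%:~R * p < p.
  move=> p0; rewrite subr_ge0 -ler_pdivlMr// floor_le/=.
  rewrite ltrBlDl -[X in _ + X]mul1r -mulrDl -ltr_pdivrMr//.
  by have := floorD1_gt (t / p); rewrite intrD.
move: a0; rewrite le_eqVlt => /orP[/eqP a0|a0].
  (* Arbitrarily small positive elements: their multiples come close to every [t]. *)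
  left; apply/seteqP; split => // t _.
  apply: cA => B /nbhs_ballP[e /= e0 eB].
  have [p [p0 Ap]] := inf_adherent e0 hP; rewrite -a0 add0r => pe.
  exists ((Num.floor (t / p))%:~R * p); split; first exact: AM.
  apply: eB; have /andP[t1 t2] := fl p t p0.
  by rewrite /ball/= ger0_norm// (lt_trans t2).
right; set a := inf P in a0 *.
have aP x : P x -> a <= x by apply: ge_inf; exists 0.
have Aa : A a.
  (* If the infimum $a$ were missed, there would be elements $a<q<p<2a$, and $p-q$ would be a
     positive element below $a$. *)
  apply: contrapT => nAa.
  have [p [p0 Ap] pa] := inf_adherent a0 hP.
  have ap : a < p by rewrite lt_neqAle aP// andbT; apply/eqP => aE; apply: nAa; rewrite aE.
  have pa0 : 0 < p - a by rewrite subr_gt0.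
  have [q [q0 Aq] qa] := inf_adherent pa0 hP.
  have aq : a <= q by exact: aP.
  have : P (p - q).
    by split; [move: qa; rewrite -/a; lra|exact: AB].
  by move/aP; move: pa; rewrite -/a; lra.
have AE t : A t <-> exists k : int, t = k%:~R * a.
  split=> [At|[k ->]]; last exact: AM.
  exists (Num.floor (t / a)); have /andP[t1 t2] := fl a t a0.
  apply/eqP; rewrite -subr_eq0; move: t1; rewrite le_eqVlt => /orP[/eqP <-//|t1].
  have : P (t - (Num.floor (t / a))%:~R * a) by split => //; apply: AB => //; exact: AM.
  by move/aP; rewrite leNgt t2.
have [k Tk] := (AE T).1 AT.
have k0 : 0 < k by move: T0; rewrite Tk pmulr_lgt0// ltr0z.
case: k k0 Tk => // n n0 Tk; exists n => // t.
have -> : T / n%:R = a; last exact: AE.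
by rewrite Tk mulrAC -[n%:~R]/(n%:R) divff ?mul1r// pnatr_eq0 -lt0n.
Qed.

Section circle.
Variable R : realType.
Local Notation C := (R[i]^o).

Definition expi (t : R) : C := cos t +i* sin t.

Lemma expiD s t : expi (s + t) = expi s * expi t.
Proof. by rewrite /expi cosD sinD; apply/eqP; rewrite eq_complex/= eqxx/= addrC. Qed.

Lemma expi0 : expi 0 = 1.
Proof. by rewrite /expi cos0 sin0. Qed.

Lemma norm_expi t : `|expi t| = 1.
Proof. by rewrite normc_def/= cos2Dsin2 sqrtr1. Qed.

Lemma expi_neq0 t : expi t != 0.
Proof. by rewrite -normr_eq0 norm_expi oner_eq0. Qed.

Lemma expiN t : expi (- t) = (expi t)^-1.
Proof. by apply: (mulIf (expi_neq0 t)); rewrite -expiD addNr expi0 mulVf ?expi_neq0. Qed.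

Lemma expiMn n t : expi (n%:R * t) = expi t ^+ n.
Proof.
elim: n => [|n IH]; first by rewrite mul0r expi0.
by rewrite -natr1 mulrDl mul1r expiD IH exprSr.
Qed.

Lemma expi2pi : expi (pi *+ 2) = 1.
Proof. by rewrite /expi -[pi *+ 2]add0r cosD2pi sinD2pi cos0 sin0. Qed.

Lemma expi_2piMz (k : int) : expi (k%:~R * (pi *+ 2)) = 1.
Proof.
case: k => n; first by rewrite expiMn expi2pi expr1n.
by rewrite NegzE mulrNz mulNr expiN expiMn expi2pi expr1n invr1.
Qed.

Lemma expi_surj z : `|z| = 1 -> exists t, expi t = z.
Proof.
case: z => x y; rewrite normc_def/= => -[/(congr1 (fun u => u ^+ 2))].
rewrite sqr_sqrtr ?addr_ge0 ?sqr_ge0// expr1n => xy.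
have x1 : -1 <= x <= 1.
  rewrite -ler_norml -(@ler_pXn2r _ 2) ?nnegrE// expr1n real_normK ?num_real//.
  by rewrite -xy lerDl sqr_ge0.
have ca : cos (acos x) = x by rewrite acosK.
have sa : sin (acos x) = `|y|.
  by rewrite sin_acos// -xy addrAC subrr add0r sqrtr_sqr.
have [y0|y0] := leP 0 y.
  by exists (acos x); rewrite /expi ca sa ger0_norm.
by exists (- acos x); rewrite /expi cosN sinN ca sa ltr0_norm// opprK.
Qed.

Lemma expi_continuous : continuous expi.
Proof.
apply: (@comp_continuous _ _ _ (fun t => (cos t, sin t)) _ _ (@Complex_continuous R)).
by apply: pair_continuous; [exact: continuous_cos|exact: continuous_sin].
Qed.

Definition circle : set C := [set z | `|z| = 1].

Definition circle_subgroup (L : set C) :=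
  [/\ closed L, L `<=` circle, L 1 & forall z w, L z -> L w -> L (z / w)].

(** For [L] inside the circle: [L] is the group of $n$-th roots of unity, described by arguments. *)
Definition circle_index (L : set C) (n : nat) :=
  (0 < n)%N /\ forall t, L (expi t) <-> exists k : int, t = k%:~R * ((pi *+ 2) / n%:R).

Lemma circle_subgroupP L : circle_subgroup L ->
  L = circle \/ exists n, circle_index L n.
Proof.
move=> [cL Lc L1 LV]; have pi2 : 0 < (pi *+ 2 : R) by rewrite mulrn_wgt0 ?pi_gt0.
have [||||h|[n n0 h]] := @real_subgroup R (expi @^-1` L) _ _ _ _ pi2.
- by apply: closed_comp => // t _; exact: expi_continuous.
- by rewrite /= expi0.
- by move=> x y /= Lx Ly; rewrite expiD expiN; exact: LV.
- by rewrite /= expi2pi.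
- left; apply/seteqP; split => // z /expi_surj[t <-].
  by have : (expi @^-1` L) t by rewrite h.
- by right; exists n.
Qed.

Lemma circle_index_torsion L n z : L `<=` circle -> circle_index L n -> L z -> z ^+ n = 1.
Proof.
move=> Lc [n0 Ln] Lz; have [t tz] := expi_surj (Lc _ Lz).
move: Lz; rewrite -tz => /Ln[k ->].
rewrite -expiMn mulrCA [n%:R * _]mulrC divfK ?expi_2piMz//.
by rewrite pnatr_eq0 -lt0n.
Qed.

Lemma circle_index_leq L L' n n' : L' `<=` L -> circle_index L n -> circle_index L' n' ->
  (n' <= n)%N.
Proof.
move=> L'L [n0 Ln] [n'0 Ln'].
have pi2 : (pi *+ 2 : R) != 0 by rewrite mulrn_eq0/= gt_eqF// pi_gt0.
have /L'L/Ln[k] : L' (expi ((pi *+ 2) / n'%:R)) by apply/Ln'; exists 1; rewrite mul1r.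
have nz : n%:R != 0 :> R by rewrite pnatr_eq0 -lt0n.
have nz' : n'%:R != 0 :> R by rewrite pnatr_eq0 -lt0n.
rewrite mulrCA => /(mulfI pi2) E.
have : n%:R = k%:~R * n'%:R :> R.
  by apply: (mulIf (invr_neq0 nz')); rewrite mulfK// E mulrCA mulfV// mulr1.
by rewrite -[n'%:R]/(n'%:~R) -[n%:R]/(n%:~R) -intrM => /intr_inj; case: k {E} => [[|k]|k]; rewrite ?NegzE; nia.
Qed.

Lemma circle_index_eq L L' n : L `<=` circle -> L' `<=` circle ->
  circle_index L n -> circle_index L' n -> L = L'.
Proof.
move=> Lc L'c [n0 Ln] [_ L'n]; apply/seteqP; split=> z.
  by move=> Lz; have [t tz] := expi_surj (Lc _ Lz); move: Lz; rewrite -tz => /Ln/L'n.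
by move=> Lz; have [t tz] := expi_surj (L'c _ Lz); move: Lz; rewrite -tz => /L'n/Ln.
Qed.

(** A proper closed subgroup consists of the $n$-th roots of unity for some $n$ and misses a
    primitive root of order $n+1$. *)
Lemma circle_subgroup_full L : circle_subgroup L ->
  (forall n z, (0 < n)%N -> z ^+ n = 1 -> L z) -> L = circle.
Proof.
move=> hL Lt; have [//|[n [n0 Ln]]] := circle_subgroupP hL.
have pi2 : (pi *+ 2 : R) != 0 by rewrite mulrn_eq0/= gt_eqF// pi_gt0.
have nz : n%:R != 0 :> R by rewrite pnatr_eq0 -lt0n.
have nz' : n.+1%:R != 0 :> R by rewrite pnatr_eq0.
have /Ln[k] : L (expi ((pi *+ 2) / n.+1%:R)).
  apply: (Lt n.+1) => //; rewrite -expiMn mulrC divfK//; exact: expi2pi.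
rewrite mulrCA => /(mulfI pi2) E.
have : n%:R = k%:~R * n.+1%:R :> R.
  by apply: (mulIf (invr_neq0 nz')); rewrite mulfK// E mulrCA mulfV// mulr1.
by rewrite -[n.+1%:R]/(n.+1%:~R) -[n%:R]/(n%:~R) -intrM => /intr_inj; case: k {E} => [[|k]|k]; rewrite ?NegzE; nia.
Qed.

Lemma circle_nontorsion n : (0 < n)%N -> exists2 z : C, circle z & z ^+ n <> 1.
Proof.
move=> n0; exists (expi (pi / n%:R)); first exact: norm_expi.
rewrite -expiMn mulrC divfK ?pnatr_eq0 -?lt0n//.
rewrite /expi cospi sinpi => -[] /eqP; rewrite -subr_eq0.
by rewrite -opprD oppr_eq0 -(natrD _ 1 1) pnatr_eq0.
Qed.

End circle.

(** * Bogolyubov's theorem *)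

Section fourier.
Variable R : realType.
Local Notation C := (R[i]).

Lemma expi_prim_root M : (0 < M)%N ->
  M.-primitive_root (expi ((pi *+ 2 : R) / M%:R) : C).
Proof.
move=> M0; have Mn0 : M%:R != 0 :> R by rewrite pnatr_eq0 -lt0n.
have pi0 := pi_gt0 R; have pi2 : 0 < (pi *+ 2 : R) by rewrite mulrn_wgt0.
rewrite /primitive_root_of_unity M0; apply/forallP => i; apply/eqP.
rewrite unity_rootE -expiMn mulrCA; have iM := ltn_ord i.
have [->|iM'] := eqVneq i.+1 M.
  by rewrite mulfV// mulr1 expi2pi eqxx.
apply/eqP => -[]; set x := pi *+ 2 * _ => cx _.
have x0 : 0 < x.
  apply: mulr_gt0; first exact: pi2.
  by apply: mulr_gt0; rewrite ?invr_gt0 ltr0n.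
have x1 : x < pi *+ 2.
  rewrite -[ltRHS]mulr1 (ltr_pM2l pi2).
  by rewrite ltr_pdivrMr ?ltr0n// mul1r ltr_nat ltn_neqAle iM'.
have cn y : 0 < y <= pi -> cos y <> 1 :> R.
  move=> /andP[y0 yp]; rewrite -cos0 => /cos_inj; rewrite !in_itv/= yp (ltW y0) lexx (ltW pi0).
  by move=> /(_ isT isT) yE; rewrite yE ltxx in y0.
have [xp|xp] := leP x pi; first by apply: (cn x) cx; rewrite x0 xp.
have [] := cn (pi *+ 2 - x); first by rewrite mulr2n in x1 *; apply/andP; split; lra.
by rewrite addrC cosD2pi cosN.
Qed.

Lemma sum_unity_root M (z : C) : z ^+ M = 1 -> z != 1 -> \sum_(i < M) z ^+ i = 0.
Proof.
move=> zM z1; have := subrX1 z M; rewrite zM subrr => /esym/eqP.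
by rewrite mulf_eq0 subr_eq0 (negPf z1) => /eqP.
Qed.

Section transform.
Variables (M : nat) (w : C).
Hypotheses (M0 : (0 < M)%N) (wM : M.-primitive_root w) (w1 : `|w| = 1).
Variable A : {set 'I_M}.

Let w_neq0 : w != 0. Proof. by rewrite -normr_eq0 w1 oner_eq0. Qed.

Let wV : w^-1 = (w^* )%C.
Proof. by rewrite invc_norm w1 expr1n invr1 mul1r. Qed.

(** The Fourier transform of the indicator function of [A] on Z/M. *)
Definition dft (x : 'I_M) : C := \sum_(a in A) w ^+ (x * a).
Definition dft_power (x : 'I_M) : R := Re (dft x) ^+ 2 + Im (dft x) ^+ 2.

Let dft_powerE x : (dft_power x)%:C = dft x * \sum_(a in A) w^-1 ^+ (x * a).
Proof.
rewrite add_Re2_Im2 sqr_normc; congr (_ * _).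
by rewrite rmorph_sum; apply: eq_bigr => a _; rewrite rmorphXn wV.
Qed.

Let orth a c : \sum_(x < M) w ^+ (x * a) * w^-1 ^+ (x * c) = (M * (a == c %[mod M]))%:R.
Proof.
have -> : \sum_(x < M) w ^+ (x * a) * w^-1 ^+ (x * c) = \sum_(x < M) (w ^+ a / w ^+ c) ^+ x.
  by apply: eq_bigr => x _; rewrite expr_div_n -!exprM mulnC (mulnC c) exprVn.
have [ac|ac] := eqVneq (a %% M)%N (c %% M)%N.
  have /eqP -> : w ^+ a == w ^+ c by rewrite (eq_prim_root_expr wM); apply/eqP.
  under eq_bigr do rewrite divff ?expf_neq0// expr1n.
  by rewrite sumr_const card_ord muln1.
rewrite muln0 sum_unity_root//.
  by rewrite expr_div_n -!exprM mulnC exprM (mulnC c) exprM (prim_expr_order wM) !expr1n divr1.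
apply: contra ac => /eqP h; rewrite -(eq_prim_root_expr wM); apply/eqP.
by rewrite -[LHS](divfK (expf_neq0 c w_neq0)) h mul1r.
Qed.

Lemma parseval : \sum_x dft_power x = (M * #|A|)%:R.
Proof.
apply: (@complexI R); rewrite rmorph_sum/= rmorph_nat.
under eq_bigr do rewrite dft_powerE mulr_suml.
rewrite exchange_big/= (eq_bigr (fun=> M%:R)) => [|a aA].
  by rewrite sumr_const natrM mulr_natr.
under eq_bigr do rewrite mulr_sumr.
rewrite exchange_big/= (bigD1 a)//= orth eqxx muln1 big1 ?addr0// => c /andP[_ ca].
rewrite orth !modn_small// [_ == _](_ : _ = false) ?muln0//.
by apply/negbTE; apply: contra ca => /eqP ac; apply/eqP/val_inj.
Qed.

Lemma dft_power0 : dft_power (Ordinal M0) = #|A|%:R ^+ 2.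
Proof.
have dE : dft (Ordinal M0) = (#|A|%:R : R)%:C.
  rewrite rmorph_nat /dft -sumr_const; apply: eq_bigr => a _.
  by rewrite mul0n expr0.
by rewrite /dft_power dE /= expr0n addr0.
Qed.

Lemma dft_power_ge0 x : 0 <= dft_power x.
Proof. by rewrite addr_ge0 ?sqr_ge0. Qed.

(** By orthogonality of characters, the sum is $M$ times the number of solutions of $a+b=c+d+n$ in
    [A]. *)
Lemma no_solution_dft n :
  (forall a b c d, a \in A -> b \in A -> c \in A -> d \in A ->
     (a + b <> c + d + n %[mod M])%N) ->
  \sum_(x < M) dft_power x ^+ 2 * Re (w ^+ (x * n)) = 0.
Proof.
move=> nsol; have : \sum_(x < M) (dft_power x ^+ 2)%:C * w^-1 ^+ (x * n) = 0.
  transitivity (\sum_(x < M) \sum_(a in A) \sum_(b in A) \sum_(c in A) \sum_(d in A)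
      w ^+ (x * (a + b)) * w^-1 ^+ (x * (c + d + n))).
    apply: eq_bigr => x _; rewrite rmorphXn/= dft_powerE exprMn /dft.
    rewrite !expr2 -!mulrA mulr_suml; apply: eq_bigr => a _.
    rewrite mulr_suml mulr_sumr; apply: eq_bigr => b _.
    rewrite mulr_suml !mulr_sumr; apply: eq_bigr => c _.
    rewrite mulr_suml !mulr_sumr; apply: eq_bigr => d _.
    by rewrite !mulnDr !exprD !mulrA.
  rewrite exchange_big big1//= => a aA; rewrite exchange_big big1//= => b bA.
  rewrite exchange_big big1//= => c cA; rewrite exchange_big big1//= => d dA.
  rewrite orth [_ == _](_ : _ = false) ?muln0//; apply/negbTE/eqP.
  exact: nsol.
move=> h; transitivity (Re (\sum_(x < M) (dft_power x ^+ 2)%:C * w^-1 ^+ (x * n))).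
  rewrite raddf_sum/=; apply: eq_bigr => x _.
  by rewrite wV -rmorphXn/=; case: (w ^+ _) => u v /=; rewrite mul0r subr0.
by rewrite h.
Qed.

(* Bogolyubov's argument: in an equation with no solution the contribution of
   the trivial character must be compensated by characters whose dft_power is large,
   and Parseval's identity bounds the number of these. *)
Lemma bogolyubov_finite (q : nat) : (0 < #|A|)%N -> (M <= q * #|A|)%N ->
  exists s : seq C, [/\ (size s <= 2 * q ^ 2)%N, forall z, z \in s -> `|z| = 1 &
   forall n, (forall z, z \in s -> 0 <= Re (z ^+ n)) ->
     exists a b c d, [/\ a \in A, b \in A, c \in A, d \in A &
     (a + b = c + d + n %[mod M])%N]].
Proof.
move=> A0 Mq; set N : R := #|A|%:R; have N0 : 0 < N by rewrite ltr0n.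
have q0 : (0 < q)%N by case: (q) Mq => //; lia.
have qN0 : 0 < (2 * q)%:R :> R by rewrite ltr0n; lia.
have MqN : M%:R <= q%:R * N by rewrite -natrM ler_nat.
(* The large spectrum. By Parseval its size times $N^2/(2q)$ is at most $MN\le qN^2$, whence the
   bound $2q^2$. *)
pose L := [pred x : 'I_M | N ^+ 2 <= dft_power x * (2 * q)%:R].
exists [seq w ^+ nat_of_ord x | x in L]; split.
- rewrite size_map -cardE -(ler_nat R).
  have : \sum_(x in L) N ^+ 2 <= \sum_(x in L) dft_power x * (2 * q)%:R.
    by apply: ler_sum => x; rewrite inE.
  rewrite sumr_const -mulr_suml => h.
  have h2 : \sum_(x in L) dft_power x <= M%:R * N.
    rewrite -natrM -parseval [leRHS](bigID (mem L))/= lerDl sumr_ge0// => x _.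
    exact: dft_power_ge0.
  have h3 : N ^+ 2 *+ #|L| <= N ^+ 2 * (2 * q ^ 2)%:R.
    apply: le_trans h _; apply: le_trans (ler_wpM2r (ltW qN0) h2) _.
    apply: (@le_trans _ _ (q%:R * N * N * (2 * q)%:R)).
      by rewrite ler_wpM2r ?(ltW qN0)// ler_wpM2r// ltW.
    rewrite (natrM _ 2 (q ^ 2)) natrX (natrM _ 2 q); have -> // : q%:R * N * N * (2%:R * q%:R) = N ^+ 2 * (2%:R * q%:R ^+ 2) by ring.
  by move: h3; rewrite -mulr_natr ler_pM2l// exprn_gt0.
- by move=> z /mapP[x _ ->]; rewrite normrX w1 expr1n.
move=> n zn; apply: contrapT => nsol.
have : \sum_(x < M) dft_power x ^+ 2 * Re (w ^+ (x * n)) = 0.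
  apply: no_solution_dft.
  by move=> a b c d aA bA cA dA abcd; apply: nsol; exists a, b, c, d.
apply/eqP; rewrite gt_eqF//.
(* Outside [L] the fourth powers sum to at most $N^2/(2q)\cdot MN\le N^4/2$, less than the $N^4$ of
   the trivial character. *)
have small : \sum_(x | x \notin L) dft_power x ^+ 2 < N ^+ 4.
  have h1 : (\sum_(x | x \notin L) dft_power x ^+ 2) * (2 * q)%:R <= N ^+ 2 * (M%:R * N).
    rewrite -natrM -parseval mulr_suml mulr_sumr [leRHS](bigID (mem L))/= addrC.
    apply: ler_wpDr; first by apply: sumr_ge0 => x _; rewrite mulr_ge0 ?sqr_ge0 ?dft_power_ge0.
    apply: ler_sum => x; rewrite inE -ltNge => /ltW xN.
    by rewrite expr2 -mulrA mulrC ler_wpM2r ?dft_power_ge0.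
  rewrite -(ltr_pM2r qN0); apply: le_lt_trans h1 _.
  apply: (@le_lt_trans _ _ (N ^+ 2 * (q%:R * N * N))).
    by rewrite ler_wpM2l ?sqr_ge0// ler_wpM2r// ltW.
  have qR : 0 < q%:R * N ^+ 4 by rewrite mulr_gt0 ?exprn_gt0// ltr0n.
  by rewrite natrM; nra.
apply: (@lt_le_trans _ _ (N ^+ 4 - \sum_(x | x \notin L) dft_power x ^+ 2)).
  by rewrite subr_gt0.
have L0 : Ordinal M0 \in L.
  by rewrite inE dft_power0 ler_peMr ?exprn_ge0 ?(ltW N0)// ler1n; lia.
rewrite [leRHS](bigID (mem L))/= lerD//.
  rewrite (bigD1 (Ordinal M0))//= dft_power0 mulr1 -exprM lerDl sumr_ge0// => x /andP[xL _].
  rewrite mulr_ge0 ?exprn_ge0 ?dft_power_ge0// exprM; apply: zn.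
  by apply/mapP; exists x; rewrite ?mem_enum.
rewrite -sumrN; apply: ler_sum => x _; rewrite -mulrN1 ler_wpM2l ?exprn_ge0 ?dft_power_ge0//.
have := normc_ge_Re (w ^+ (x * n)); rewrite normrX w1 expr1n (lecR _ 1) ler_norml.
by case/andP.
Qed.

End transform.
End fourier.

Lemma exprc_continuous (R : realType) n : continuous (fun z : R[i]^o => (z ^+ n : R[i]^o)).
Proof.
elim: n => [|n IH]; first exact: (@cst_continuous _ _ (1 : R[i]^o)).
have -> : (fun z : R[i]^o => (z ^+ n.+1 : R[i]^o)) = (fun z => z * (z ^+ n)).
  by apply/funext => z; rewrite exprS.
have h : continuous (fun z : R[i]^o => (z, (z ^+ n : R[i]^o))).
  by apply: pair_continuous; [move=> z; exact: cvg_id|exact: IH].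
exact: (comp_continuous h (@complex_mul_continuous R)).
Qed.

Lemma circle_closed (R : realType) : closed (@circle R).
Proof.
have -> : @circle R = (fun z : R[i]^o => Re `|z|) @^-1` [set 1].
  by apply/seteqP; split=> -[x y]; rewrite /circle /= normc_def; [case|move=> /= ->].
apply: closed_comp; last exact: closed_eq.
by move=> z _; apply: (comp_continuous (@norm_continuous _ R[i]^o)); exact: Re_continuous.
Qed.

(** * Powers of an element of a compact group *)

Section compact_group.
Variable G : compactGroupType.
Implicit Types x y g : G.

Lemma nbhs1_divl (W : set G) : nbhs 1%g W ->
  exists2 V, nbhs 1%g V & forall x y, V x -> V y -> W (x^-1 * y)%g.
Proof.
move=> hW; have c : continuous (fun p : G * G => (p.1^-1 * p.2)%g).
  apply: (@comp_continuous _ _ _ (fun p : G * G => (p.1^-1, p.2)%g) _ _ (@mulg_continuous G)).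
  apply: pair_continuous; last by move=> p; exact: cvg_snd.
  by apply: (comp_continuous _ (@invg_continuous G)) => p; exact: cvg_fst.
have : nbhs (1%g, 1%g) ((fun p : G * G => (p.1^-1 * p.2)%g) @^-1` W).
  by apply: c; rewrite /= invg1 mulg1.
move=> /nbhs_diagP[V hV VW]; exists V => // x y Vx Vy; exact: (VW x y).
Qed.

Lemma nbhs1_mul (W : set G) : nbhs 1%g W ->
  exists2 V, nbhs 1%g V & forall x y, V x -> V y -> W (x * y)%g.
Proof.
move=> hW; have : nbhs (1%g, 1%g) ((fun p : G * G => (p.1 * p.2)%g) @^-1` W).
  by apply: mulg_continuous; rewrite /= mulg1.
move=> /nbhs_diagP[V hV VW]; exists V => // x y Vx Vy; exact: (VW x y).
Qed.

Lemma mulg_left_continuous x : continuous (fun y => x * y)%g.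
Proof.
apply: (@comp_continuous _ _ _ (fun y => (x, y)) _ _ (@mulg_continuous G)).
by apply: pair_continuous => y; [exact: cvg_cst|exact: cvg_id].
Qed.

Lemma nbhs_translate x (V : set G) : nbhs 1%g V -> nbhs x [set y | V (x^-1 * y)%g].
Proof. by move=> hV; apply: mulg_left_continuous; rewrite /= mulVg. Qed.

Lemma closed_nbhs1 (W : set G) : nbhs 1%g W ->
  exists V, [/\ closed V, nbhs 1%g V & V `<=` W].
Proof.
move=> hW; have [] := @compact_regular G 1%g setT (@group_hausdorff G) (@group_compact G) (filterT) _ hW.
move=> B nB BW; exists (closure B); split => //; first exact: closed_closure.
by apply: filterS nB; exact: subset_closure.
Qed.

Section bogolyubov.
Variables (R : realType) (g : G) (W : set G).
Hypothesis hW : nbhs 1%g W.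

(** Among $m$ translates of [V] covering [G], one contains at least $N/m$ of the first $N$ powers of
    [g]. A solution of $a+b=c+d+n$ among these exponents writes $g^n$ as a product of two quotients
    of elements of [V]. *)
Lemma bogolyubov_bounded : exists k : nat, forall N : nat, exists s : seq R[i],
  [/\ (size s <= k)%N, forall z, z \in s -> `|z| = 1 &
   forall n, (n <= N)%N -> (forall z, z \in s -> 0 <= Re (z ^+ n)) -> W (g ^+ n)%g].
Proof.
have [V1 hV1 V1W] := nbhs1_mul hW; have [V hV VV1] := nbhs1_divl hV1.
have [t ht] := compact_finite_subcover (@group_compact G) (fun x => nbhs_translate x hV).
pose m := size t; exists (2 * (4 * m) ^ 2)%N => N.
have [->|N0] := eqVneq N 0%N.
  exists [::]; split => // n; rewrite leqn0 => /eqP -> _; rewrite expg0.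
  exact: nbhs_singleton.
(* Sums $a+b$ and $c+d+n$ stay below $4N$, so congruence modulo [M] is equality; and $4N\le 4m|A|$
   gives $q=4m$ in [bogolyubov_finite]. *)
pose M := (4 * N)%N; have M0 : (0 < M)%N by rewrite /M; lia.
have ltM u v w : (u < N)%N -> (v < N)%N -> (w <= N)%N -> (u + v + w < M)%N.
  by rewrite /M; lia.
pose P x (a : nat) := `[< V (x^-1 * g ^+ a)%g >].
pose A x : {set 'I_M} := [set a : 'I_M | (a < N)%N && P x a]%SET.
have [x xt Nx] : exists2 x, x \in t & (N <= m * #|A x|)%N.
  apply: contrapT => nA.
  have h1 : (N <= \sum_(x <- t) #|A x|)%N.
    have -> : N = (\sum_(a < M | (a < N)%N) 1)%N.
      rewrite -(big_ord_widen_cond M xpredT (fun=> 1%N)); last by rewrite /M; lia.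
      by rewrite sum1_card card_ord.
    under eq_bigr do rewrite -sum1_card.
    rewrite (exchange_big_dep (fun a : 'I_M => (a < N)%N)) /=; last first.
      by move=> x a _; rewrite inE => /andP[].
    apply: leq_sum => a aN; have [x xt Vx] := ht (g ^+ a)%g.
    rewrite (big_rem x)//= inE aN/= (_ : P x a = true)//.
    by apply/asboolP.
  have h2 : (m * \sum_(x <- t) #|A x| <= m * N.-1)%N.
    rewrite big_distrr/= -[X in (_ <= X * _)%N]count_predT mulnC -iter_addn_0 -big_const_seq.
    rewrite !big_seq; apply: leq_sum => x xt; rewrite leqNgt; apply/negP => Nx.
    by apply: nA; exists x => //; rewrite -(@prednK N) ?lt0n// 1?mulnC.
  move: h1 h2; rewrite /m; case: (t) => [|y t'] /=; first by rewrite big_nil; lia.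
  nia.
have wM := expi_prim_root R M0.
have [||s [ss s1 sP]] := @bogolyubov_finite R M _ M0 wM (norm_expi _) (A x) (4 * m)%N.
- by rewrite lt0n; apply: contraTneq Nx => ->; rewrite muln0 -ltnNge lt0n.
- by rewrite /M -mulnA leq_mul2l.
exists s; split => // n nN sn; have [a [b [c [d]]]] := sP n sn.
rewrite !inE => -[/andP[aN /asboolP Pa] /andP[bN /asboolP Pb]
  /andP[cN /asboolP Pc] /andP[dN /asboolP Pd]].
rewrite (modn_small (ltM _ _ _ cN dN nN)) modn_small; last first.
  by have := ltM _ _ _ aN bN (leq0n N); rewrite addn0.
move=> abcd.
have E u v : ((x^-1 * g ^+ u)^-1 * (x^-1 * g ^+ v) = (g ^+ u)^-1 * g ^+ v)%g.
  by rewrite invgM invgK -mulgA mulVKg.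
have gC u v : commute (g ^+ u)%g (g ^+ v)%g by apply: commuteX2.
have -> : (g ^+ n = ((x^-1 * g ^+ c)^-1 * (x^-1 * g ^+ a)) * ((x^-1 * g ^+ d)^-1 * (x^-1 * g ^+ b)))%g.
  rewrite !E; apply: (mulgI (g ^+ (d + c))%g); rewrite -expgnDr (addnC d) -abcd.
  by rewrite (addnC c) !expgnDr -!mulgA mulVKg [RHS]mulgA (gC d a) -mulgA mulVKg.
by apply: V1W; apply: VV1.
Qed.

Lemma bogolyubov : exists k (z : 'I_k -> R[i]), (forall i, `|z i| = 1) /\
  forall n, (forall i, 0 < Re (z i ^+ n)) -> W (g ^+ n)%g.
Proof.
have [k hk] := bogolyubov_bounded; have [s hs] := choice hk.
(* Lists padded with 1 to the common length [k] become points of a compact product of discs; a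
   cluster point as [N] grows serves all exponents. *)
pose T := prod_topology (fun _ : 'I_k => (R[i]^o : topologicalType)).
pose u (N : nat) : T := fun i => nth 1 (s N) i.
have u1 N i : `|u N i| = 1.
  have [_ s1 _] := hs N; have [iN|iN] := ltnP i (size (s N)).
    by apply: s1; rewrite mem_nth.
  by rewrite /u nth_default ?normr1.
have cT : compact [set f : T | forall i, `|f i| <= 1%:C].
  exact: (@tychonoff _ _ (fun=> [set z : R[i]^o | `|z| <= 1%:C]) (fun=> @disc_compact R 1)).
have FF : ProperFilter (u @ \oo) by exact: fmap_proper_filter.
have [|z [_ clz]] := cT _ FF.
  by exists 0%N => // N _ i; rewrite /= u1.
have pc i : continuous (fun f : T => f i : R[i]^o) by exact: proj_continuous.
exists k, z; split=> [i|n zn].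
  apply: contrapT => zi.
  have nz : nbhs z [set f : T | ~ @circle R (f i)].
    have : nbhs (z i : R[i]^o) (~` @circle R).
      by apply: open_nbhs_nbhs; split => //; rewrite openC; exact: circle_closed.
    exact: pc.
  by have [] := clz (range u) _ _ nz; [exists 0%N => // N _; exists N|move=> _ [[N _ <-]] []; exact: u1].
(* Strict positivity is open, hence passes from the cluster point to some list with $N\ge n$. *)
have nz : nbhs z [set f : T | forall i, i \in enum 'I_k -> 0 < Re (f i ^+ n)].
  apply: filter_all_seq => i _.
  have c : continuous (fun f : T => Re (f i ^+ n) : R).
    have ce : continuous (fun w : R[i]^o => w ^+ n : R[i]^o) by exact: exprc_continuous.
    exact: (comp_continuous (pc i) (comp_continuous ce (@Re_continuous R))).
  have o : nbhs (Re (z i ^+ n)) [set x : R | 0 < x].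
    by apply: open_nbhs_nbhs; split; [exact: open_gt|exact: zn].
  exact: (c z _ o).
have [|f [[N nN <-] fn]] := clz (u @` [set N | (n <= N)%N]) _ _ nz.
  by exists n => // N nN; exists N.
have [sk _ h] := hs N; apply: h nN _ => w ws.
have ik : (index w (s N) < k)%N by apply: leq_trans sk; rewrite index_mem.
have := fn (Ordinal ik) (mem_enum _ _); rewrite /u/= nth_index//.
exact: ltW.
Qed.

End bogolyubov.
End compact_group.

(** * Elements with p-power torsion characters *)

Lemma chain_compact (T : topologicalType) (C : set (set T)) :
  compact [set: T] -> C !=set0 -> total_on C subset ->
  (forall E, C E -> closed E /\ E !=set0) -> exists x, forall E, C E -> E x.
Proof.
move=> cT [E0 CE0] totC hC.
pose F := filter_from C id.
have FF : ProperFilter F.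
  apply: filter_from_proper; last by move=> E /hC[].
  apply: filter_from_filter; first by exists E0.
  move=> E E' CE CE'; have [EE'|E'E] := totC _ _ CE CE'.
    by exists E => // x Ex; split=> //; exact: EE'.
  by exists E' => // x Ex; split=> //; exact: E'E.
have [x [_ clx]] := cT F FF filterT.
exists x => E CE; have [cE _] := hC _ CE; apply: cE => B Bx.
by apply: clx Bx; exists E.
Qed.

Section closed_subgroups.
Variable K : compactGroupType.
Implicit Types (H : set K) (x y : K).

(* Closed submonoids of a compact group are subgroups. *)
Definition closed_subgroup H :=
  [/\ closed H, H 1%g & forall x y, H x -> H y -> H (x * y)%g].

Lemma closed_subgroupX H x n : closed_subgroup H -> H x -> H (x ^+ n)%g.
Proof.
move=> [_ H1 HM] Hx; elim: n => [|n IH]; first by rewrite expg0.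
by rewrite expgS; exact: HM.
Qed.

(** The powers of $x$ accumulate, so some $x^{m-n}$ with $n<m$ is close to 1 and $x^{m-n-1}$ is
    close to $x^{-1}$. *)
Lemma closed_subgroupV H x : closed_subgroup H -> H x -> H (x^-1)%g.
Proof.
move=> hH Hx; have [cH _ _] := hH; apply: cH => B xB.
have hW : nbhs 1%g [set w | B (x^-1 * w)%g].
  by apply: mulg_left_continuous; rewrite /= mulg1.
have [V hV VW] := nbhs1_divl hW.
pose u n := (x ^+ n)%g.
have FF : ProperFilter (u @ \oo) by exact: fmap_proper_filter.
have [y [_ cly]] := @group_compact K _ FF filterT.
have hy := nbhs_translate y hV.
have [|_ [[n _ <-] Vn]] := cly (range u) _ _ hy; first by exists 0%N => // n _; exists n.
have [|_ [[m nm <-] Vm]] := cly (u @` [set m | (n < m)%N]) _ _ hy.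
  by exists n.+1 => // m nm; exists m.
exists (x ^+ (m - n.+1))%g; split; first exact: closed_subgroupX.
have := VW _ _ Vn Vm; rewrite /= invgM invgK -mulgA mulVKg /u.
have -> : (x ^+ m = x ^+ n * (x * x ^+ (m - n.+1)))%g.
  by rewrite -expgS -expgnDr; congr (x ^+ _)%g; rewrite /= in nm; lia.
by rewrite mulKg mulKg.
Qed.

Lemma closed_subgroupI H H' : closed_subgroup H -> closed_subgroup H' ->
  closed_subgroup (H `&` H').
Proof.
move=> [c o m] [c' o' m']; split=> //; first exact: closedI.
by move=> x y [? ?] [? ?]; split; [exact: m|exact: m'].
Qed.

Lemma closed_subgroup_bigcap (C : set (set K)) :
  (forall H, C H -> closed_subgroup H) -> closed_subgroup (\bigcap_(H in C) H).
Proof.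
move=> hC; split.
- by apply: closed_bigI => H /hC[].
- by move=> H /hC[].
- by move=> x y hx hy H CH; have [_ _ m] := hC _ CH; apply: m; [exact: hx|exact: hy].
Qed.

Definition monothetic x := closure (range (fun n => x ^+ n)%g).

Lemma closed_subgroup_monothetic x : closed_subgroup (monothetic x).
Proof.
split; first exact: closed_closure.
  by apply: subset_closure; exists 0%N.
move=> y z cy cz B /(@mulg_continuous K (y, z))[[A1 A2] /= [hA1 hA2] AB].
have [_ [[n _ <-] An]] := cy _ hA1; have [_ [[m _ <-] Am]] := cz _ hA2.
exists (x ^+ n * x ^+ m)%g; split; first by exists (n + m)%N => //; rewrite expgnDr.
by apply: (AB (_, _)).
Qed.

Lemma monothetic_id x : monothetic x x.
Proof. by apply: subset_closure; exists 1%N => //; rewrite expg1. Qed.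

Lemma monothetic_sub H x : closed_subgroup H -> H x -> monothetic x `<=` H.
Proof.
move=> hH Hx; have [cH _ _] := hH.
apply: (@subset_trans _ (closure H)); last exact: cH.
by apply: closureS => _ [n _ <-]; exact: closed_subgroupX.
Qed.

Section characters.
Variables (R : realType) (I : eqType) (chi : I -> K -> R[i]^o).
Hypotheses (chi_cont : forall i, continuous (chi i))
  (chiM : forall i x y, chi i (x * y)%g = chi i x * chi i y)
  (chi1 : forall i x, `|chi i x| = 1).

Let chi_neq0 i x : chi i x != 0. Proof. by rewrite -normr_eq0 chi1 oner_eq0. Qed.

Lemma character1 i : chi i 1%g = 1.
Proof. by apply: (mulIf (chi_neq0 i 1%g)); rewrite -chiM mulg1 mul1r. Qed.

Lemma characterV i x : chi i (x^-1)%g = (chi i x)^-1.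
Proof. by apply: (mulIf (chi_neq0 i x)); rewrite -chiM mulVg character1 mulVf. Qed.

Lemma characterX i x n : chi i (x ^+ n)%g = chi i x ^+ n.
Proof.
by elim: n => [|n IH]; rewrite ?expg0 ?character1// expgS chiM IH exprS.
Qed.

Lemma circle_subgroup_image H i : closed_subgroup H -> circle_subgroup (chi i @` H).
Proof.
move=> hH; have [cH H1 HM] := hH; split.
- apply: compact_closed; first exact: complex_hausdorff.
  apply: continuous_compact; first exact: continuous_subspaceT.
  by apply: subclosed_compact cH (@group_compact K) _.
- by move=> _ [x _ <-]; exact: chi1.
- by exists 1%g => //; exact: character1.
- move=> _ _ [x Hx <-] [y Hy <-]; exists (x * y^-1)%g; last by rewrite chiM characterV.
  by apply: HM => //; exact: closed_subgroupV.
Qed.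

Definition torsion_part H i n := H `&` [set x | chi i x ^+ n = 1].

Lemma closed_subgroup_torsion_part H i n :
  closed_subgroup H -> closed_subgroup (torsion_part H i n).
Proof.
move=> hH; apply: closed_subgroupI => //; split=> /=.
- have -> : [set x | chi i x ^+ n = 1] = (fun x => chi i x ^+ n : R[i]^o) @^-1` [set 1].
    by [].
  apply: closed_comp; last first.
    exact/accessible_closed_set1/hausdorff_accessible/complex_hausdorff.
  have ce := comp_continuous (@chi_cont i) (@exprc_continuous R n).
  by move=> x _; exact: ce.
- by rewrite character1 expr1n.
- by move=> x y xn yn; rewrite chiM exprMn xn yn mulr1.
Qed.

(** The descending chain condition for closed subgroups of a torus: along a chain, the joint image
    under finitely many characters stabilises. *)
Lemma characters_dcc (s : seq I) (C : set (set K)) : C !=set0 -> total_on C subset ->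
  (forall H, C H -> closed_subgroup H) ->
  exists2 H0, C H0 & forall H, C H -> H `<=` H0 ->
    forall x, H0 x -> exists2 y, H y & forall i, i \in s -> chi i y = chi i x.
Proof.
elim: s C => [|i s IH] C [H' CH'] totC hC.
  by exists H' => // H CH _ x _; exists 1%g; have [] := hC _ CH.
(* The image under one character is the circle for all members, or finite for some; in the latter
   case a member of least order is chosen. *)
have [H1 CH1 H1P] : exists2 H1, C H1 &
    forall H, C H -> H `<=` H1 -> chi i @` H = chi i @` H1.
  have [[H2 [CH2 [n Hn]]]|noidx] :=
      pselect (exists H, C H /\ exists n, circle_index (chi i @` H) n); last first.
    exists H' => // H CH _.
    have full E : C E -> chi i @` E = @circle R.
      move=> CE; have [//|[n En]] := circle_subgroupP (circle_subgroup_image i (hC _ CE)).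
      by exfalso; apply: noidx; exists E; split => //; exists n.
    by rewrite !full.
  pose Q n := `[< exists2 H, C H & circle_index (chi i @` H) n >].
  have exQ : exists n, Q n by exists n; apply/asboolP; exists H2.
  case: (ex_minnP exQ) => m /asboolP[H1 CH1 H1m] mmin.
  exists H1 => // H CH HH1.
  have hHi := circle_subgroup_image i (hC _ CH); have hH1i := circle_subgroup_image i (hC _ CH1).
  have [_ c _ _] := hHi; have [_ c1 _ _] := hH1i.
  have HiH1 : chi i @` H `<=` chi i @` H1 by exact: image_subset.
  have [Hc|[n' Hn']] := circle_subgroupP hHi.
    by apply/seteqP; split => //; rewrite Hc.
  have nm : (n' <= m)%N by exact: circle_index_leq HiH1 H1m Hn'.
  have mn : (m <= n')%N by apply: mmin; apply/asboolP; exists H.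
  have nE : n' = m by apply/eqP; rewrite eqn_leq nm.
  by apply: circle_index_eq c c1 _ H1m; rewrite -nE.
(* The induction runs on the kernels of [chi i]. *)
pose C' := [set torsion_part H i 1 | H in C].
have [|||_ [H2 CH2 <-] H2P] := IH C'.
- by exists (torsion_part H' i 1); exists H'.
- move=> _ _ [E CE <-] [E' CE' <-]; have [EE'|E'E] := totC _ _ CE CE'; [left|right].
    by move=> x [Ex ?]; split => //; exact: EE'.
  by move=> x [Ex ?]; split => //; exact: E'E.
- by move=> _ [E CE <-]; apply: closed_subgroup_torsion_part; exact: hC.
have [H0 [CH0 H01 H02]] : exists H0, [/\ C H0, H0 `<=` H1 & H0 `<=` H2].
  by have [h12|h21] := totC _ _ CH1 CH2; [exists H1; split|exists H2; split].
exists H0 => // H CH HH0 x H0x.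
have [_ _ HM] := hC _ CH; have [_ _ H0M] := hC _ CH0.
have : (chi i @` H) (chi i x).
  by rewrite (H1P _ CH (subset_trans HH0 H01)); exists x => //; exact: H01.
move=> [y Hy yx].
have [|||z [Hz zi] zs] := H2P (torsion_part H i 1) _ _ (x * y^-1)%g _.
- by exists H.
- by move=> w [Hw ?]; split => //; exact/H02/HH0.
- split; last by rewrite /= expr1 chiM characterV yx divff.
  apply: H02; apply: H0M => //; apply: closed_subgroupV (hC _ CH0) _; exact: HH0.
exists (z * y)%g => [|j]; first exact: HM.
rewrite inE => /orP[/eqP ->|js]; first by rewrite chiM yx -[chi i z]expr1 zi mul1r.
by rewrite chiM zs// -chiM -mulgA mulVg mulg1.
Qed.

End characters.
End closed_subgroups.

(** * Minimal closed subgroups outside a subgroup *)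

Section minimal_subgroup.
Variables (K : compactGroupType) (R : realType) (I : eqType) (chi : I -> K -> R[i]^o).
Hypotheses (chi_cont : forall i, continuous (chi i))
  (chiM : forall i x y, chi i (x * y)%g = chi i x * chi i y)
  (chi1 : forall i x, `|chi i x| = 1).
Variables (D M0 : set K) (s : seq I).
Hypotheses (hD : closed_subgroup D) (hM0 : closed_subgroup M0).
Hypothesis M0s : forall x y, D x -> D y -> (forall i, i \in s -> chi i x = chi i y) ->
  M0 x -> M0 y.

(** Zorn's lemma. Not lying in [M0] survives the intersection of a chain because, within [D],
    finitely many characters decide membership in [M0]. *)
Lemma minimal_subgroup : ~ (D `<=` M0) -> exists H,
  [/\ closed_subgroup H, H `<=` D, ~ (H `<=` M0) &
   forall H', closed_subgroup H' -> H' `<=` H -> ~ (H' `<=` M0) -> H `<=` H'].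
Proof.
move=> DM0; pose P (H : set K) := [/\ closed_subgroup H, H `<=` D & ~ (H `<=` M0)].
pose T := {H : set K | P H}; pose Q (t u : T) := `[< sval u `<=` sval t >].
have PD : P D by split.
have [||A totA|[H [hH HD HM]] Hmin] := @ZL_preorder T (exist _ D PD) Q.
- by move=> t; apply/asboolP.
- by move=> t u v /asboolP h1 /asboolP h2; apply/asboolP; exact: subset_trans h2 h1.
- have [[t0 At0]|A0] := pselect (A !=set0); last first.
    by exists (exist _ D PD) => t At; case: A0; exists t.
  pose C := [set sval t | t in A].
  have hC H : C H -> P H by move=> [t _ <-]; exact: svalP.
  have totC : total_on C subset.
    by move=> _ _ [t At <-] [u Au <-]; have [/asboolP|/asboolP] := totA _ _ At Au; [right|left].
  have C0 : C !=set0 by exists (sval t0), t0.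
  have hCs H : C H -> closed_subgroup H by move=> /hC[].
  have [H0 CH0 H0P] := characters_dcc chi_cont chiM chi1 s C0 totC hCs.
  have [hH0 H0D H0M] := hC _ CH0.
  have [c [H0c cM]] : exists c, H0 c /\ ~ M0 c.
    apply: contrapT => nc; apply: H0M => x H0x; apply: contrapT => Mx.
    by apply: nc; exists x.
  (* Members of the chain contain points that [s] cannot tell from [c]; by compactness so does their
     intersection, and such a point is outside [M0]. *)
  pose E H := H `&` [set x | forall i, i \in s -> chi i x = chi i c].
  have cE H : closed H -> closed (E H).
    move=> cH; apply: closedI => //.
    have -> : [set x | forall i, i \in s -> chi i x = chi i c] =
        \bigcap_(i in [set` s]) (chi i @^-1` [set chi i c]) by apply/seteqP; split.
    apply: closed_bigI => i _; apply: closed_comp; first by move=> x _; exact: chi_cont.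
    exact/accessible_closed_set1/hausdorff_accessible/complex_hausdorff.
  have [||||x Ex] := @chain_compact K [set E H | H in C].
  - exact: group_compact.
  - by exists (E H0), H0.
  - move=> _ _ [H CH <-] [H' CH' <-]; have [HH'|H'H] := totC _ _ CH CH'; [left|right].
      by move=> x [? ?]; split => //; exact: HH'.
    by move=> x [? ?]; split => //; exact: H'H.
  - move=> _ [H CH <-]; split; first by apply: cE; have [[]] := hC _ CH.
    have [HH0|H0H] := totC _ _ CH CH0; last by exists c; split => //; exact: H0H.
    by have [y Hy yc] := H0P _ CH HH0 _ H0c; exists y.
  have xC H : C H -> H x by move=> CH; have [|] := Ex (E H); [exists H|].
  have PB : P (\bigcap_(H in C) H).
    split; first exact: closed_subgroup_bigcap.
      by move=> y yC; apply: H0D; exact: yC.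
    move=> sub; apply: cM; apply: (M0s (H0D _ (xC _ CH0)) (H0D _ H0c)).
      by have [_] := Ex (E H0) (ex_intro2 _ _ H0 CH0 erefl).
    by apply: sub => H /xC.
  exists (exist _ _ PB) => t At; apply/asboolP => y; apply; exists t => //.
exists H; split => // H' hH' H'H H'M.
have PH' : P H' by split => //; exact: subset_trans H'H HD.
have /Hmin/asboolP : Q (exist _ H (And3 hH HD HM)) (exist _ H' PH') by exact/asboolP.
exact.
Qed.

(** If [chi i] mapped [H] onto the circle, every torsion part would be a proper subgroup, hence
    inside [M0]. Then [H] meets [M0] in a set whose image contains all roots of unity, so is the
    circle; as the kernel lies in [M0] too, so would [H]. *)
Lemma minimal_subgroup_torsion H i : closed_subgroup H -> H `<=` D -> ~ (H `<=` M0) ->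
  (forall H', closed_subgroup H' -> H' `<=` H -> ~ (H' `<=` M0) -> H `<=` H') ->
  exists2 n, (0 < n)%N & forall x, H x -> chi i x ^+ n = 1.
Proof.
move=> hH HD HM Hmin.
have hHi := circle_subgroup_image chi_cont chiM chi1 i hH; have [_ Hic _ _] := hHi.
have [full|[n Hn]] := circle_subgroupP hHi; last first.
  exists n => [|x Hx]; first by case: Hn.
  by apply: circle_index_torsion Hic Hn _; exists x.
exfalso; apply: HM.
have tM n : (0 < n)%N -> torsion_part chi H i n `<=` M0.
  move=> n0; apply: contrapT => nM.
  have := Hmin _ (closed_subgroup_torsion_part chi_cont chiM chi1 i n hH) (@subIsetl _ _ _) nM.
  have [z zc zn] := circle_nontorsion R n0.
  have : (chi i @` H) z by rewrite full.
  by move=> [x Hx xz] /(_ x Hx)[_ /=]; rewrite xz.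
have hHM : closed_subgroup (H `&` M0) by exact: closed_subgroupI.
have HMi : chi i @` (H `&` M0) = @circle R.
  apply: circle_subgroup_full; first exact: circle_subgroup_image.
  move=> n z n0 zn; have : (chi i @` H) z.
    rewrite full /circle/=; apply: (@pexpIrn _ n); rewrite ?nnegrE//.
    by rewrite -normrX zn normr1 expr1n.
  move=> [x Hx xz]; exists x => //; split => //; apply: (tM n) => //.
  by split => //=; rewrite xz.
have [_ _ HMul] := hH; have [_ _ MMul] := hM0.
move=> x Hx; have : (chi i @` (H `&` M0)) (chi i x) by rewrite HMi; exact: chi1.
move=> [y [Hy My] yx].
have -> : x = (x * y^-1 * y)%g by rewrite -mulgA mulVg mulg1.
apply: (MMul _ _ _ My); apply: (tM 1%N) => //; split.
  by apply: HMul => //; exact: closed_subgroupV.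
rewrite /= expr1 chiM (characterV chiM chi1) yx divff//.
by rewrite -normr_eq0 chi1 oner_eq0.
Qed.

Lemma torsion_lcm (H : set K) (t : seq I) :
  (forall i, exists2 n, (0 < n)%N & forall x, H x -> chi i x ^+ n = 1) ->
  exists2 n, (0 < n)%N & forall i x, i \in t -> H x -> chi i x ^+ n = 1.
Proof.
move=> Ht; elim: t => [|i t [n n0 IH]]; first by exists 1%N.
have [m m0 mi] := Ht i; exists (m * n)%N; first by rewrite muln_gt0 m0.
move=> j x; rewrite inE => /orP[/eqP ->|jt] Hx; first by rewrite exprM mi// expr1n.
by rewrite mulnC exprM IH// expr1n.
Qed.

Lemma exists_p_element : ~ (D `<=` M0) -> exists p h,
  [/\ prime p, D h, ~ M0 h & forall i, exists b, chi i h ^+ (p ^ b) = 1].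
Proof.
move=> /minimal_subgroup[H [hH HD HM Hmin]].
have Ht i := minimal_subgroup_torsion i hH HD HM Hmin.
have [h [Hh Mh]] : exists h, H h /\ ~ M0 h.
  apply: contrapT => nc; apply: HM => x Hx; apply: contrapT => Mx.
  by apply: nc; exists x.
have [r r0 rs] := torsion_lcm s Ht.
(* With [d] the order of [h] modulo [M0] and [p] a prime factor of it, $h^{d/p}$ has order exactly
   [p] modulo [M0]. *)
pose Q d := (0 < d)%N && `[< M0 (h ^+ d)%g >].
have exQ : exists d, Q d.
  exists r; rewrite /Q r0; apply/asboolP; have [_ M1 _] := hM0.
  have [_ H1 _] := hH.
  apply: (M0s _ _ _ M1); [exact: HD|apply: HD; exact: closed_subgroupX|].
  by move=> i si; rewrite (character1 chiM chi1) (characterX chiM chi1) rs.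
case: (ex_minnP exQ) => d /andP[d0 /asboolP Md] dmin.
have d1 : (1 < d)%N.
  by rewrite ltn_neqAle d0 andbT; apply/eqP => dE; apply: Mh; rewrite -dE expg1 in Md.
have pp := pdiv_prime d1; set p := pdiv d in pp.
have p0 : (0 < p)%N by exact: prime_gt0.
pose h' := (h ^+ (d %/ p))%g.
have Hh' : H h' by exact: closed_subgroupX.
have Mh' : ~ M0 h'.
  move=> M; have := dmin (d %/ p)%N; rewrite /Q divn_gt0// dvdn_leq ?pdiv_dvd//=.
  have /asboolP -> := M => /(_ isT).
  by rewrite leqNgt ltn_Pdiv// prime_gt1.
have Mh'p : M0 (h' ^+ p)%g by rewrite -expgnA divnK// pdiv_dvd.
clearbody h'; exists p, h'; split => //; first exact: HD.
move=> i; have [n n0 ni] := Ht i.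
exists (logn p n); have nE := partnC p n0.
(* Raising to the prime-to-p part [m] does not lead into [M0], by Bezout. So by minimality [h'] lies
   in the closed subgroup generated by $h'^m$, on which [chi i] has p-power order. *)
pose m := (n`_p^')%N.
have mcop : coprime m p by rewrite coprime_sym prime_coprime// /m -p'natE// part_pnat.
have Mm : ~ M0 (h' ^+ m)%g.
  move=> M; have [[u v] uv] : exists uv : nat * nat, (uv.1 * m = uv.2 * p + 1)%N.
    case: (egcdnP p (_ : 0 < m)%N) => [|u v]; first by rewrite /m part_gt0.
    by move: mcop; rewrite /coprime => /eqP -> uv _; exists (u, v).
  apply: Mh'; have [_ _ MMul] := hM0.
  have -> : h' = (((h' ^+ p) ^+ v)^-1 * (h' ^+ m) ^+ u)%g.
    by rewrite /= in uv; rewrite -!expgnA (mulnC m u) uv (mulnC p v) expgnDr expg1 mulKg.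
  by apply: MMul; [apply: closed_subgroupV|]; rewrite ?closed_subgroupX//; exact: closed_subgroupX.
have hm := closed_subgroup_monothetic (h' ^+ m)%g.
have : monothetic (h' ^+ m)%g h'.
  apply: (Hmin _ hm) => //; first by apply: monothetic_sub => //; exact: closed_subgroupX.
  by move=> sub; apply: Mm; apply: sub; exact: monothetic_id.
have : torsion_part chi H i (p ^ logn p n)%N (h' ^+ m)%g.
  split; first exact: closed_subgroupX.
  rewrite /= (characterX chiM chi1) -exprM -p_part mulnC nE; exact: ni.
move=> /(monothetic_sub (closed_subgroup_torsion_part chi_cont chiM chi1 i _ hH)) sub.
by move=> /sub[].
Qed.

End minimal_subgroup.

(** * Characters of the integers and topological p-elements *)

Lemma prod_topology_continuous (T : topologicalType) (I : Type) (K : I -> topologicalType)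
    (f : T -> prod_topology K) :
  (forall i, continuous (fun t => f t i)) -> continuous f.
Proof.
move=> cf t; apply/cvg_sup => i.
by apply: (@continuous_comp_initial (prod_topology K) _ _ (fun u => u i)); exact: cf.
Qed.

Section bohr.
Variables (R : realType) (G : compactGroupType).
Local Notation torus := (prod_topology (fun _ : R[i] => (R[i]^o : topologicalType))).

Definition bohr_set : set (torus * G) := [set u | forall z, `|u.1 z| = 1].

(* All unitary characters of the integers at once, together with [G]: the closed
   subgroup generated by a point whose torus component is the family of all
   points of the circle projects onto the Bohr compactification of the integers. *)
Definition bohr : Type := set_type bohr_set.

HB.instance Definition _ := Topological.on bohr.

Implicit Types x y : bohr.

Lemma bohr_norm x z : `|(val x).1 z| = 1.
Proof. by have := set_valP x; apply. Qed.

Lemma bohr_mul_subproof x y :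
  ((fun z => (val x).1 z * (val y).1 z) : torus, ((val x).2 * (val y).2)%g) \in bohr_set.
Proof. by apply: mem_set => z /=; rewrite normrM !bohr_norm mul1r. Qed.

Lemma bohr_inv_subproof x :
  ((fun z => ((val x).1 z)^*%C) : torus, ((val x).2^-1)%g) \in bohr_set.
Proof. by apply: mem_set => z /=; rewrite normcJ bohr_norm. Qed.

Lemma bohr_one_subproof : ((fun=> 1) : torus, 1%g : G) \in bohr_set.
Proof. by apply: mem_set => z /=; rewrite normr1. Qed.

Definition bohr_mul x y : bohr := exist (fun u => u \in bohr_set) _ (bohr_mul_subproof x y).
Definition bohr_inv x : bohr := exist (fun u => u \in bohr_set) _ (bohr_inv_subproof x).
Definition bohr_one : bohr := exist (fun u => u \in bohr_set) _ bohr_one_subproof.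

Lemma bohrP x y : (forall z, (val x).1 z = (val y).1 z) -> (val x).2 = (val y).2 -> x = y.
Proof.
move=> xy1 xy2; apply: val_inj; case: (val x) (val y) xy1 xy2 => [f g] [f' g'] /= ff' ->.
by congr (_, _); apply: functional_extensionality_dep.
Qed.

Lemma bohr_conj x z : ((val x).1 z)^*%C * (val x).1 z = 1.
Proof. by rewrite mulrC -sqr_normc bohr_norm expr1n. Qed.

Lemma bohr_mulA : associative bohr_mul.
Proof. by move=> x y z; apply: bohrP => [w|] /=; rewrite ?mulrA ?mulgA. Qed.
Lemma bohr_mul1 : left_id bohr_one bohr_mul.
Proof. by move=> x; apply: bohrP => [w|] /=; rewrite ?mul1r ?mul1g. Qed.
Lemma bohr_mulr1 : right_id bohr_one bohr_mul.
Proof. by move=> x; apply: bohrP => [w|] /=; rewrite ?mulr1 ?mulg1. Qed.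
Lemma bohr_mulV : left_inverse bohr_one bohr_inv bohr_mul.
Proof. by move=> x; apply: bohrP => [w|] /=; rewrite ?bohr_conj ?mulVg. Qed.
Lemma bohr_mulrV : right_inverse bohr_one bohr_inv bohr_mul.
Proof. by move=> x; apply: bohrP => [w|] /=; rewrite 1?mulrC ?bohr_conj ?mulgV. Qed.

HB.instance Definition _ := isGroup.Build bohr
  bohr_mulA bohr_mul1 bohr_mulr1 bohr_mulV bohr_mulrV.

Definition bohr_character (z : R[i]) x : R[i]^o := (val x).1 z.

Definition bohr_proj x : G := (val x).2.

Lemma bohr_val_continuous : continuous (fun x : bohr => val x : torus * G).
Proof. exact: initial_continuous. Qed.

Lemma bohr_character_continuous z : continuous (bohr_character z).
Proof.
have c1 : continuous (fun u : torus * G => u.1) by move=> u; exact: cvg_fst.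
have c2 : continuous (fun f : torus => f z : R[i]^o) by exact: proj_continuous.
exact: (comp_continuous bohr_val_continuous (comp_continuous c1 c2)).
Qed.

Lemma bohr_proj_continuous : continuous bohr_proj.
Proof.
have c2 : continuous (fun u : torus * G => u.2) by move=> u; exact: cvg_snd.
exact: (comp_continuous bohr_val_continuous c2).
Qed.

Lemma continuous_bohr (T : topologicalType) (f : T -> bohr) :
  (forall z, continuous (fun t => bohr_character z (f t))) ->
  continuous (fun t => bohr_proj (f t)) -> continuous f.
Proof.
move=> c1 c2; apply: (@continuous_comp_initial bohr _ _ set_val).
have -> : set_val \o f = fun t => ((val (f t)).1 : torus, (val (f t)).2).
  by apply/funext => t; exact: surjective_pairing.
by apply: pair_continuous => //; exact: prod_topology_continuous.
Qed.

Lemma bohr_mul_continuous : continuous (fun u : bohr * bohr => (u.1 * u.2)%g).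
Proof.
have c1 : continuous (fun u : bohr * bohr => u.1) by move=> u; exact: cvg_fst.
have c2 : continuous (fun u : bohr * bohr => u.2) by move=> u; exact: cvg_snd.
apply: continuous_bohr => [z|].
  have := pair_continuous (comp_continuous c1 (@bohr_character_continuous z))
    (comp_continuous c2 (@bohr_character_continuous z)).
  by move=> /comp_continuous/(_ (@complex_mul_continuous R)).
have := pair_continuous (comp_continuous c1 bohr_proj_continuous)
  (comp_continuous c2 bohr_proj_continuous).
by move=> /comp_continuous/(_ (@mulg_continuous G)).
Qed.

Lemma bohr_inv_continuous : continuous (fun x : bohr => (x^-1)%g).
Proof.
apply: continuous_bohr => [z|].
  exact: (comp_continuous (@bohr_character_continuous z) (@conjc_continuous R)).
exact: (comp_continuous bohr_proj_continuous (@invg_continuous G)).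
Qed.

Lemma bohr_hausdorff : hausdorff_space bohr.
Proof.
move=> x y xy; apply: bohrP => [z|].
  apply: (@complex_hausdorff R) => A B nA nB.
  have [w [Aw Bw]] := xy _ _ (bohr_character_continuous nA) (bohr_character_continuous nB).
  by exists (bohr_character z w).
apply: (@group_hausdorff G) => A B nA nB.
have [w [Aw Bw]] := xy _ _ (bohr_proj_continuous nA) (bohr_proj_continuous nB).
by exists (bohr_proj w).
Qed.

Lemma bohr_compact : compact [set: bohr].
Proof.
apply: compact_set_type.
have -> : bohr_set = [set f : torus | forall z, @circle R (f z)] `*` [set: G].
  by apply/seteqP; split=> [u|u []].
apply: compact_setX; last exact: group_compact.
apply: (@tychonoff _ (fun _ : R[i] => (R[i]^o : topologicalType)) (fun=> @circle R)) => _.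
apply: subclosed_compact (@disc_compact R 1) _; first exact: circle_closed.
by move=> z; rewrite /circle/= => ->.
Qed.

HB.instance Definition _ := isCompactGroup.Build bohr
  bohr_mul_continuous bohr_inv_continuous bohr_hausdorff bohr_compact.

Lemma bohr_characterM z x y :
  bohr_character z (x * y)%g = bohr_character z x * bohr_character z y.
Proof. by []. Qed.

Lemma bohr_character_norm z x : `|bohr_character z x| = 1.
Proof. exact: bohr_norm. Qed.

Lemma bohr_projX x n : bohr_proj (x ^+ n)%g = (bohr_proj x ^+ n)%g.
Proof.
by elim: n => [|n IH]; rewrite ?expg0// !expgS -IH.
Qed.

Lemma bohr_generator_subproof (g : G) :
  ((fun z => if `|z| == 1 then z else 1) : torus, g) \in bohr_set.
Proof. by apply: mem_set => z /=; case: eqP => //; rewrite normr1. Qed.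

(** Indices off the unit circle give no unitary character and receive the dummy value 1. *)
Definition bohr_generator g : bohr :=
  exist (fun u => u \in bohr_set) _ (bohr_generator_subproof g).

End bohr.

Section topological_p_element.
Variables (R : realType) (G : compactGroupType).
Local Notation chi := (@bohr_character R G).
Local Notation pr := (@bohr_proj R G).

(** Bogolyubov's theorem passes from powers to their closure: the condition on characters is open
    and [W] is closed. *)
Lemma bogolyubov_monothetic (g : G) (W : set G) : nbhs 1%g W -> closed W ->
  exists s : seq R[i], forall c, monothetic (bohr_generator R g) c ->
    (forall z, z \in s -> 0 < Re (chi z c)) -> W (pr c).
Proof.
move=> hW cW; have [k [z [z1 zW]]] := bogolyubov R g hW.
exists [seq z i | i : 'I_k] => c Dc cz.
apply: cW => B hB.
have cB : nbhs c [set d | B (pr d)] by exact: bohr_proj_continuous hB.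
have nc : nbhs c [set d | forall w, w \in [seq z i | i : 'I_k] -> 0 < Re (chi w d)].
  apply: filter_all_seq => w ws.
  have o : nbhs (Re (chi w c)) [set x : R | 0 < x].
    by apply: open_nbhs_nbhs; split; [exact: open_gt|exact: cz].
  exact: (comp_continuous (@bohr_character_continuous R G w) (@Re_continuous R) o).
have [_ [[n _ <-] [nB nz]]] := Dc _ (filterI cB nc).
exists (pr (bohr_generator R g ^+ n)%g); split => //.
rewrite bohr_projX; apply: zW => i.
have := nz (z i) (map_f _ (mem_enum _ _)).
rewrite (characterX (@bohr_characterM R G) (@bohr_character_norm R G)).
by rewrite /bohr_character/= z1 eqxx.
Qed.

Theorem exists_topological_p_element : nontrivial_group G ->
  exists p (x : G), [/\ prime p, x <> 1%g &
    forall W, nbhs 1%g W -> exists n, forall m, W (x ^+ (p ^ n * m))%g].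
Proof.
move=> [g g1].
have chiX := characterX (@bohr_characterM R G) (@bohr_character_norm R G).
pose D := monothetic (bohr_generator R g).
have hD : closed_subgroup D by exact: closed_subgroup_monothetic.
have Dg : D (bohr_generator R g) by exact: monothetic_id.
have [W [cW hW Wg]] : exists W, [/\ closed W, nbhs (1%g : G) W & ~ W g].
  have := @group_hausdorff G; rewrite open_hausdorff => /(_ 1%g g).
  case; first by apply/eqP => /esym.
  move=> [P Q] /= [/set_mem P1 /set_mem Qg] [oP oQ PQ].
  have [W [cW hW WP]] := closed_nbhs1 (open_nbhs_nbhs (conj oP P1)).
  exists W; split => // /WP Pg; have : (P `&` Q) g by [].
  by rewrite (eqP PQ).
have [s hs] := bogolyubov_monothetic g hW cW.
pose N := D `&` [set x | pr x = 1%g].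
(* The kernel [N] of the projection is enlarged to a subgroup decided by the characters in [s]. It
   misses the generator: otherwise the generator divided by an element of [N] would be trivial on
   [s] and still project to [g], outside [W]. *)
pose M0 := D `&` [set x | exists2 n, N n & forall z, z \in s -> chi z n = chi z x].
have hN : closed_subgroup N.
  apply: closed_subgroupI => //; split=> //.
    have -> : [set x | pr x = 1%g] = pr @^-1` [set 1%g] by [].
    apply: closed_comp; first by move=> x _; exact: bohr_proj_continuous.
    exact/accessible_closed_set1/hausdorff_accessible/group_hausdorff.
  by move=> x y /= x1 y1; rewrite /bohr_proj/= [X in (X * _)%g]x1 [X in (_ * X)%g]y1 mulg1.
have hM0 : closed_subgroup M0.
  apply: closed_subgroupI => //; have [cN N1 NM] := hN; split; last 1 first.
  - move=> x y [n Nn nx] [m Nm my]; exists (n * m)%g; first exact: NM.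
    by move=> z zs; rewrite !bohr_characterM nx// my.
  (* Closed as the projection of a compact set of pairs. *)
  - pose E := [set q : bohr R G * bohr R G | N q.1] `&`
      \bigcap_(z in [set` s]) [set q | chi z q.1 = chi z q.2].
    have -> : [set x | exists2 n, N n & forall z, z \in s -> chi z n = chi z x] = snd @` E.
      apply/seteqP; split=> [x [n Nn nx]|_ [[n x] [/= Nn nx] <-]].
        by exists (n, x).
      by exists n.
    have c1 : continuous (fun q : bohr R G * bohr R G => q.1) by move=> q; exact: cvg_fst.
    have c2 : continuous (fun q : bohr R G * bohr R G => q.2) by move=> q; exact: cvg_snd.
    apply: compact_closed; first exact: group_hausdorff.
    apply: continuous_compact; first exact: continuous_subspaceT.
    have cT : compact [set: bohr R G * bohr R G].
      by rewrite -setXTT; apply: compact_setX; exact: group_compact.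
    apply: subclosed_compact cT _ => //; apply: closedI.
      by apply: (@closed_comp _ _ (fun q : bohr R G * bohr R G => q.1) N) => // q _; exact: c1.
    apply: closed_bigI => z _.
    apply: closed_eq_fun.
      exact: (comp_continuous c1 (@bohr_character_continuous R G z)).
    exact: (comp_continuous c2 (@bohr_character_continuous R G z)).
  - by exists 1%g.
have [||p [h [pp Dh Mh hb]]] := @exists_p_element _ R _ chi (@bohr_character_continuous R G)
  (@bohr_characterM R G) (@bohr_character_norm R G) D M0 s hD hM0.
- move=> x y Dx Dy xy [_ [n Nn nx]]; split => //; exists n => // z zs.
  by rewrite nx// xy.
- move=> /(_ _ Dg)[_ [n [Dn n1] ng]].
  have [_ _ DM] := hD.
  apply: Wg; have -> : g = pr (n^-1 * bohr_generator R g)%g.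
    by rewrite /bohr_proj /= [X in (X^-1 * _)%g]n1 invg1 mul1g.
  apply: hs; first exact: (DM _ _ (closed_subgroupV hD Dn) Dg).
  move=> z zs; rewrite bohr_characterM.
  rewrite (characterV (@bohr_characterM R G) (@bohr_character_norm R G)) -ng// mulVf.
    by rewrite ltr01.
  by rewrite -normr_eq0 bohr_character_norm oner_eq0.
exists p, (pr h); split => //.
  move=> h1; apply: Mh; split => //; exists h => //.
move=> V /closed_nbhs1[V' [cV' hV' V'V]].
have [t ht] := bogolyubov_monothetic g hV' cV'.
have [b bh] : exists b, forall z, z \in t -> chi z h ^+ (p ^ b) = 1.
  elim: t {ht} => [|z t [b bt]]; first by exists 0%N.
  have [c cz] := hb z; exists (c + b)%N => w; rewrite inE expnD => /orP[/eqP ->|wt].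
    by rewrite exprM cz expr1n.
  by rewrite mulnC exprM bt// expr1n.
exists b => m; apply: V'V; rewrite -bohr_projX; apply: ht.
  exact: (closed_subgroupX _ hD Dh).
by move=> z zt; rewrite chiX exprM bh// expr1n ltr01.
Qed.

End topological_p_element.

(** * Homomorphisms from the p-adic integers *)

Section padic_residues.
Variables (p : nat) (pp : prime p).
Implicit Types z w : padic p.

Definition residue z n : nat := val z n.

Lemma padic_modulus n : ((Zp_trunc (p ^ n.+1)).+2 = p ^ n.+1)%N.
Proof. by rewrite Zp_cast// -(expn0 p) ltn_exp2l// prime_gt1. Qed.

Lemma residue_lt z n : (residue z n < p ^ n.+1)%N.
Proof. by rewrite -(padic_modulus n) ltn_ord. Qed.

Lemma residueS z n : (residue z n.+1 %% p ^ n.+1 = residue z n)%N.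
Proof.
have : residue z n = (residue z n.+1 %% (Zp_trunc (p ^ n.+1)).+2)%N.
  by rewrite /residue [in LHS](set_valP z n).
by rewrite padic_modulus.
Qed.

Lemma residue_mod z n k : (n <= k)%N -> (residue z k %% p ^ n.+1 = residue z n)%N.
Proof.
move=> /subnK <-; elim: (k - n)%N => [|j IH].
  by rewrite add0n modn_small// residue_lt.
by rewrite -IH addSn -(residueS z (j + n)) modn_dvdm// dvdn_exp2l// ltnS leq_addl.
Qed.

Lemma residueM z w n : residue (z * w)%g n = ((residue z n + residue w n) %% p ^ n.+1)%N.
Proof.
have : residue (z * w)%g n = ((residue z n + residue w n) %% (Zp_trunc (p ^ n.+1)).+2)%N.
  by [].
by rewrite padic_modulus.
Qed.

Lemma residue1 n : residue 1%g n = 0%N.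
Proof. by []. Qed.

Lemma residueX z u n : residue (z ^+ u)%g n = ((u * residue z n) %% p ^ n.+1)%N.
Proof.
elim: u => [|u IH]; first by rewrite expg0 residue1 mod0n.
by rewrite expgS residueM IH modnDmr mulSn.
Qed.

Lemma residue_inj z w : residue z =1 residue w -> z = w.
Proof. by move=> zw; apply: padicP => n; apply: val_inj; exact: zw. Qed.

Lemma padic_nat_subproof (a : nat) : (fun n => inZp a) \in @padic_set p.
Proof.
apply: mem_set => n; apply: val_inj => /=.
by rewrite modn_dvdm// padic_trunc_dvd.
Qed.

Definition padic_nat a : padic p :=
  exist (fun u => u \in @padic_set p) _ (padic_nat_subproof a).

Lemma residue_nat a n : (residue (padic_nat a) n = a %% p ^ n.+1)%N.
Proof.
have : residue (padic_nat a) n = (a %% (Zp_trunc (p ^ n.+1)).+2)%N by [].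
by rewrite padic_modulus.
Qed.

(** A nonzero p-adic integer is a unit times $p^w$, and modulo $p^{k+1}$ the unit is inverted by a
    natural number [u]. *)
Lemma padic_multiple_power z : z <> 1%g -> exists w v : nat, forall k, (v <= k)%N ->
  exists u, residue (z ^+ u)%g k = residue (padic_nat (p ^ w)) k.
Proof.
move=> z1; have [v zv] : exists v, residue z v != 0%N.
  apply: contrapT => nz; apply: z1; apply: residue_inj => n; rewrite residue1.
  by apply: contrapT => /eqP zn; apply: nz; exists n.
have b0 : (0 < residue z v)%N by rewrite lt0n.
have [c cp bE] := pfactor_coprime pp b0.
exists (logn p (residue z v)), v; set w := logn p _ in bE *.
move=> k kv; have wv : (w < v.+1)%N.
  rewrite -(ltn_exp2l _ _ (prime_gt1 pp)) (leq_ltn_trans _ (residue_lt z v))//.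
  by rewrite bE leq_pmull//; case: (c) bE b0 => // ->; rewrite mul0n.
pose q := (residue z k %/ p ^ v.+1)%N.
(* The cofactor of $p^w$ in the residue at level [k]; it is coprime to [p] since [c] is and
   $w<v+1$. *)
pose c' := (q * p ^ (v.+1 - w) + c)%N.
have aE : residue z k = (c' * p ^ w)%N.
  rewrite (divn_eq (residue z k) (p ^ v.+1)) residue_mod// -/q mulnDl -mulnA -expnD subnK ?(ltnW wv)//.
  by rewrite -bE.
have c'p : coprime c' (p ^ k.+1).
  rewrite coprime_sym coprimeXl// /c' /coprime.
  have -> : (v.+1 - w = (v - w).+1)%N by lia.
  by rewrite expnSr mulnA gcdnMDl.
have c'0 : (0 < c')%N.
  rewrite lt0n; apply/eqP => c0; move: c'p; rewrite c0 /coprime gcd0n => /eqP pk.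
  by have := ltn_exp2l 0 k.+1 (prime_gt1 pp); rewrite pk.
case: (egcdnP (p ^ k.+1) c'0) => u s; move/eqP: c'p => -> us _.
exists u; rewrite residueX residue_nat aE mulnA us mulnDl mul1n -mulnA (mulnC (p ^ k.+1)%N).
by rewrite mulnA modnMDl.
Qed.

End padic_residues.

Section padic_power.
Variables (p : nat) (pp : prime p) (G : compactGroupType) (x : G).
Hypothesis hx : forall W, nbhs 1%g W -> exists n, forall m, W (x ^+ (p ^ n * m))%g.
Implicit Types z w : padic p.

Lemma cvg_mulg (u v : nat -> G) (a b : G) : u @ \oo --> a -> v @ \oo --> b ->
  (fun n => u n * v n)%g @ \oo --> (a * b)%g.
Proof.
move=> ua vb; apply: (@cvg_comp _ _ _ (fun n => (u n, v n)) (fun q : G * G => (q.1 * q.2)%g)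
  _ (nbhs (a, b))); first exact: cvg_pair.
exact: (@mulg_continuous G (a, b)).
Qed.

(** Beyond level $j$ the exponents change by multiples of $p^{j+1}$, whose powers are near 1 by
    [hx]; hence a cluster point is the limit. *)
Lemma power_residue_cvg z : exists y : G, (fun k => x ^+ residue z k)%g @ \oo --> y.
Proof.
pose u k := (x ^+ residue z k)%g.
have FF : ProperFilter (u @ \oo) by exact: fmap_proper_filter.
have [y [_ cly]] := @group_compact G _ FF filterT.
exists y => B yB.
have hW : nbhs (1%g : G) [set w | B (y * w)%g].
  by apply: mulg_left_continuous; rewrite /= mulg1.
have [V hV VW] := nbhs1_mul hW; have [n hn] := hx hV.
have [|_ [[j nj <-] Vj]] := cly (u @` [set j | (n <= j)%N]) _ _ (nbhs_translate y hV).
  by exists n => // j nj; exists j.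
exists j => // k jk.
have := VW _ _ Vj (hn (p ^ (j.+1 - n) * (residue z k %/ p ^ j.+1))%N).
rewrite /= mulnA -expnD subnKC; last by rewrite leqW.
rewrite -!mulgA mulVKg -expgnDr -(residue_mod pp z jk) addnC mulnC -divn_eq.
by [].
Qed.

Definition padic_power z : G := projT1 (cid (power_residue_cvg z)).

Lemma padic_power_cvg z : (fun k => x ^+ residue z k)%g @ \oo --> padic_power z.
Proof. exact: projT2 (cid (power_residue_cvg z)). Qed.

Lemma padic_power_unique z y : (fun k => x ^+ residue z k)%g @ \oo --> y -> padic_power z = y.
Proof. by move=> zy; apply: cvg_unique zy; [exact: group_hausdorff|exact: padic_power_cvg]. Qed.

Lemma padic_powerM z w : padic_power (z * w)%g = (padic_power z * padic_power w)%g.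
Proof.
(* The carry of the addition at level [k]; it contributes a power of $x^{p^{k+1}}$, which tends to
   1. *)
pose e k := ((residue z k + residue w k) %/ p ^ k.+1)%N.
have e1 : (fun k => x ^+ (p ^ k.+1 * e k))%g @ \oo --> (1%g : G).
  move=> B /hx[n hn]; exists n => // k /= nk.
  have := hn (p ^ (k.+1 - n) * e k)%N.
  by rewrite mulnA -expnD subnKC// leqW.
apply: (@cvg_unique _ (@group_hausdorff G)
  ((fun k => x ^+ residue z k * x ^+ residue w k)%g @ \oo)); last first.
  by apply: cvg_mulg; exact: padic_power_cvg.
have := cvg_mulg (@padic_power_cvg (z * w)%g) e1; rewrite mulg1.
have -> // : (fun k => x ^+ residue (z * w)%g k * x ^+ (p ^ k.+1 * e k))%g =
  (fun k => x ^+ residue z k * x ^+ residue w k)%g.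
by apply/funext => k; rewrite -!expgnDr (residueM pp) addnC mulnC -divn_eq.
Qed.

Lemma padic_power_nat a : padic_power (padic_nat p a) = (x ^+ a)%g.
Proof.
apply: padic_power_unique; apply: cvg_near_cst; exists a => // k /= ak.
rewrite (residue_nat pp) modn_small//; apply: (leq_ltn_trans ak).
by apply: ltn_trans (ltnSn k) _; exact: ltn_expl (prime_gt1 pp).
Qed.

Lemma padic_powerX z u : padic_power (z ^+ u)%g = (padic_power z ^+ u)%g.
Proof.
elim: u => [|u IH]; last by rewrite !expgS padic_powerM IH.
rewrite !expg0 -[RHS](expg0 x) -padic_power_nat; congr padic_power.
by apply: (residue_inj (p := p)) => n; rewrite (residue_nat pp) mod0n.
Qed.

Lemma padic_power1 : padic_power 1%g = 1%g.
Proof. by rewrite -(expg0 1%g) padic_powerX expg0. Qed.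

Lemma padic_powerV z : padic_power (z^-1)%g = ((padic_power z)^-1)%g.
Proof. by apply: (mulIg (padic_power z)); rewrite -padic_powerM !mulVg padic_power1. Qed.

Lemma padic_power_near1 (W : set G) : nbhs 1%g W ->
  exists n, forall z, residue z n = 0%N -> W (padic_power z).
Proof.
move=> /closed_nbhs1[V [cV hV VW]]; have [n hn] := hx hV.
exists n => z zn; apply/VW/cV => B /padic_power_cvg[N _ NB].
pose k := maxn n N; exists (x ^+ residue z k)%g; split; last exact/NB/leq_maxr.
have /eqP/dvdnP[q ->] : (residue z k %% p ^ n.+1 = 0)%N.
  by rewrite (residue_mod pp) ?zn// leq_maxl.
by rewrite mulnC expnSr -mulnA.
Qed.

Lemma padic_power_continuous : continuous padic_power.
Proof.
move=> z B zB.
have hW : nbhs (1%g : G) [set w | B (padic_power z * w)%g].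
  by apply: mulg_left_continuous; rewrite /= mulg1.
have [n hn] := padic_power_near1 hW.
have := (@continuous_to_discrete _ _ _).1 (@padic_val_continuous p n) z.
apply: filterS => w wz; rewrite /= -(mulVKg z w) padic_powerM; apply: hn.
have : residue w n = residue z n by congr nat_of_ord.
move=> wzn; have := residueM pp (z^-1)%g w n; rewrite wzn -(residueM pp) mulVg residue1.
exact.
Qed.

(** Multiples of [z] approximate $p^w$, and the kernel is closed, so it contains $p^w$. *)
Lemma padic_power_ker z : padic_power z = 1%g -> z <> 1%g ->
  exists w : nat, (x ^+ (p ^ w) = 1)%g.
Proof.
move=> z1 /(padic_multiple_power pp)[w [v hw]]; exists w.
apply: contrapT => xw.
have [W [hW Wx]] : exists W : set G, nbhs 1%g W /\ ~ W (x ^+ (p ^ w))%g.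
  have := @group_hausdorff G; rewrite open_hausdorff => /(_ 1%g (x ^+ (p ^ w))%g).
  case; first by apply/eqP => /esym.
  move=> [P Q] /= [/set_mem P1 /set_mem Qx] [oP oQ PQ].
  exists P; split; first exact: open_nbhs_nbhs.
  by move=> Px; have : (P `&` Q) (x ^+ (p ^ w))%g by []; rewrite (eqP PQ).
have [n hn] := padic_power_near1 hW.
have [u uz] := hw (maxn v n) (leq_maxl v n).
apply: Wx.
have -> : (x ^+ (p ^ w) = padic_power ((z ^+ u)^-1 * padic_nat p (p ^ w)))%g.
  by rewrite padic_powerM padic_powerV padic_powerX z1 expg1n invg1 mul1g padic_power_nat.
apply: hn; rewrite -(residue_mod pp _ (leq_maxr v n)) (residueM pp) -uz -(residueM pp).
by rewrite mulVg residue1 mod0n.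
Qed.

End padic_power.

(** * Topological joins *)

Local Open Scope quotient_scope.

Lemma torsion_or_padic (R : realType) (G : compactGroupType) : nontrivial_group G ->
  (exists n (g : G), [/\ (1 < n)%N, (g ^+ n = 1)%g &
     forall i, (0 < i < n)%N -> (g ^+ i <> 1)%g]) \/
  exists p, prime p /\ exists iota : padic p -> G,
    [/\ continuous iota, forall z w, iota (z * w)%g = (iota z * iota w)%g &
        forall z, iota z = 1%g -> z = 1%g].
Proof.
move=> /(exists_topological_p_element R)[p [x [pp x1 hx]]].
have [[z [z1 zn1]]|inj] := pselect (exists z, padic_power pp hx z = 1%g /\ z <> 1%g); last first.
  right; exists p; split => //; exists (padic_power pp hx); split.
  - exact: padic_power_continuous.
  - exact: padic_powerM.
  - by move=> z z1; apply: contrapT => zn1; apply: inj; exists z.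
left; have [w xw] := padic_power_ker z1 zn1.
have ex : exists n, (0 < n)%N && (x ^+ n == 1)%g.
  by exists (p ^ w)%N; rewrite expn_gt0 prime_gt0//= xw.
case: (ex_minnP ex) => n /andP[n0 /eqP xn] nmin; exists n, x; split => //.
  by rewrite ltn_neqAle n0 andbT; apply/eqP => nE; apply: x1; rewrite -[LHS]expg1 nE.
by move=> i /andP[i0 i_n] xi; have := nmin i; rewrite i0 xi eqxx => /(_ isT); rewrite leqNgt i_n.
Qed.

Section join_pi.
Variables (R : realType) (X Y : topologicalType).

Lemma join_pi_continuous :
  continuous (fun q : X * Y * unit_interval R => join_pi q.1.1 q.1.2 q.2).
Proof.
have -> : (fun q : X * Y * unit_interval R => join_pi q.1.1 q.1.2 q.2) =
  (\pi_(quotient_topology {eq_quot (join_equiv R X Y)}) : pre_join R X Y -> join R X Y).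
  by apply/funext => -[[x y] t].
exact: pi_continuous.
Qed.

Lemma join_pi1 x y y' : join_pi x y (unit_interval1 R) = join_pi x y' (unit_interval1 R) :> join R X Y.
Proof. by apply/eqmodP/asboolP; apply: Or32. Qed.

Lemma join_pi0 x x' y : join_pi x y (unit_interval0 R) = join_pi x' y (unit_interval0 R) :> join R X Y.
Proof. by apply/eqmodP/asboolP; apply: Or33. Qed.

End join_pi.

Section join_map.
Variables (R : realType) (X Y Z : topologicalType).

Definition join_map (h : Y -> Z) (w : join R X Y) : join R X Z :=
  let: (x, y, t) := (repr (w : {eq_quot join_equiv R X Y}) : pre_join R X Y) in
  join_pi x (h y) t.

Lemma join_mapE h x y t : join_map h (join_pi x y t) = join_pi x (h y) t.
Proof.
rewrite /join_map; set w := join_pi x y t.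
have : join_rel (repr (w : {eq_quot join_equiv R X Y})) (x, y, t).
  by apply/eqmodP; rewrite reprK.
case: (repr _) => [[x' y'] t'] /asboolP[[-> -> ->]//|[/= -> -> ->]|[/= -> -> ->]].
  exact: join_pi1.
exact: join_pi0.
Qed.

Lemma join_map_continuous (h : Y -> Z) : continuous h -> continuous (join_map h).
Proof.
move=> ch; apply/quotient_continuous.
have -> : join_map h \o \pi_(quotient_topology {eq_quot (join_equiv R X Y)}) =
    fun q : pre_join R X Y => join_pi q.1.1 (h q.1.2) q.2.
  by apply/funext => -[[x y] t]; exact: join_mapE.
have c11 : continuous (fun q : X * Y * unit_interval R => q.1.1).
  by move=> q; apply: cvg_comp; [exact: cvg_fst|exact: cvg_fst].
have c12 : continuous (fun q : X * Y * unit_interval R => q.1.2).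
  by move=> q; apply: cvg_comp; [exact: cvg_fst|exact: cvg_snd].
have c2 : continuous (fun q : X * Y * unit_interval R => q.2) by move=> q; exact: cvg_snd.
have := pair_continuous (pair_continuous c11 (comp_continuous c12 ch)) c2.
by move=> /comp_continuous/(_ (@join_pi_continuous R X Z)).
Qed.

End join_map.

Lemma hom1 (G H : compactGroupType) (f : H -> G) :
  (forall z w, f (z * w)%g = (f z * f w)%g) -> f 1%g = 1%g.
Proof. by move=> fM; apply: (mulgI (f 1%g)); rewrite -fM !mulg1. Qed.

Lemma join_act_map (R : realType) (X : topologicalType) (G H : compactGroupType)
    (iota : H -> G) (a : right_action G X) (b : right_action H X) (w : join R X H) h :
  (forall z w, iota (z * w)%g = (iota z * iota w)%g) ->
  (forall x z, b x z = a x (iota z)) ->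
  join_map iota (join_act b w h) = join_act a (join_map iota w) (iota h).
Proof.
move=> iotaM ba.
have -> : w = \pi_(quotient_topology {eq_quot (join_equiv R X H)})
   (repr (w : {eq_quot join_equiv R X H})) by rewrite [RHS]reprK.
case: (repr _) => -[x z] t.
rewrite -[\pi_ _ _]/(join_pi x z t) join_actE !join_mapE join_actE.
by rewrite iotaM ba.
Qed.

Lemma BU_restrict (R : realType) (G H : compactGroupType) (iota : H -> G) :
  continuous iota -> (forall z w, iota (z * w)%g = (iota z * iota w)%g) ->
  (forall z, iota z = 1%g -> z = 1%g) -> BU R H -> BU R G.
Proof.
move=> ci iM iinj BUH X X0 cX hX a afree [f [cf fa]].
have i1 := hom1 iM.
have bc : continuous (fun q : X * H => a q.1 (iota q.2)).
  have c1 : continuous (fun q : X * H => q.1) by move=> q; exact: cvg_fst.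
  have c2 : continuous (fun q : X * H => q.2) by move=> q; exact: cvg_snd.
  have := pair_continuous c1 (comp_continuous c2 ci).
  by move=> /comp_continuous/(_ (@ract_continuous _ _ a)).
have b1 x : a x (iota 1%g) = x by rewrite i1 ract1.
have bM x g h : a x (iota (g * h)%g) = a (a x (iota g)) (iota h) by rewrite iM ractM.
pose b := @RightAction H X (fun x h => a x (iota h)) b1 bM bc.
have bfree : free_action b by move=> x g /afree/iinj.
apply: (BUH X X0 cX hX b bfree); exists (f \o join_map iota); split.
  exact: (comp_continuous (join_map_continuous ci) cf).
by move=> z h /=; rewrite (@join_act_map _ _ _ _ _ a).
Qed.

(** The homotopy is $f[x,1,t]$. At $t=0$ the join forgets $x$; at $t=1$ it forgets the group
    coordinate, so the end map commutes with the action of $g$. *)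
Lemma BU_torsion (R : realType) (G : compactGroupType) (n : nat) (g : G) :
  (1 < n)%N -> (g ^+ n = 1)%g -> (forall i, (0 < i < n)%N -> (g ^+ i <> 1)%g) -> BU R G.
Proof.
move=> n1 gn gi X [x0 _] cX hX a afree [f [cf fa]].
pose H (q : X * unit_interval R) := f (join_pi q.1 1%g q.2).
have iterE i x : iter i (a^~ g) x = a x (g ^+ i)%g.
  by elim: i => [|i IH]; rewrite ?expg0 ?ract1// iterS IH -ractM -expgSr.
have c1 : continuous (fun q : X * unit_interval R => q.1) by move=> q; exact: cvg_fst.
have c2 : continuous (fun q : X * unit_interval R => q.2) by move=> q; exact: cvg_snd.
apply: (@no_equivariant_null_homotopy R X n (a^~ g) H x0 (H (x0, unit_interval0 R)) n1 cX hX).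
- have := pair_continuous (fun x : X => cvg_id) (@cst_continuous X _ g).
  by move=> /comp_continuous/(_ (@ract_continuous _ _ a)).
- by move=> x; rewrite iterE gn ract1.
- by move=> x i /gi gi1; rewrite iterE => /afree.
- have := pair_continuous (pair_continuous c1 (@cst_continuous _ _ (1%g : G))) c2.
  by move=> /comp_continuous/(_ (@join_pi_continuous R X G))/comp_continuous/(_ cf).
- by move=> x; rewrite /H /= (join_pi0 R x x0).
- by move=> x; rewrite /H /= -fa join_actE mul1g (join_pi1 R _ 1%g g).
Qed.

(** * Characters of C*-algebras *)

Section cstar_norm.
Variables (R : realType) (A : cstarAlgType R).
Implicit Types a b : A.

(** The norm has values in [R[i]]; this is the same norm as an element of [R]. *)
Definition rnorm a : R := Re `|a|.

Lemma rnormE a : `|a| = (rnorm a)%:C.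
Proof. by rewrite /rnorm RRe_real// ger0_real. Qed.

Lemma rnorm_ge0 a : 0 <= rnorm a.
Proof. by rewrite -(@ler0c R) -rnormE. Qed.

Lemma rnormD a b : rnorm (a + b) <= rnorm a + rnorm b.
Proof. by rewrite -lecR rmorphD/= -!rnormE ler_normD. Qed.

Lemma rnormN a : rnorm (- a) = rnorm a.
Proof. by rewrite /rnorm normrN. Qed.

Lemma rnormM a b : rnorm (cmul a b) <= rnorm a * rnorm b.
Proof. by rewrite -lecR rmorphM/= -!rnormE norm_cmul_le. Qed.

Lemma cmul0 a : cmul a 0 = 0.
Proof. by apply: (addrI (cmul a 0)); rewrite -cmulDr !addr0. Qed.

Lemma cmulN a b : cmul a (- b) = - cmul a b.
Proof. by apply: (addrI (cmul a b)); rewrite -cmulDr !subrr cmul0. Qed.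

Lemma rnorm_lt_ball a b (e : R) : rnorm (a - b) < e -> ball a e%:C b.
Proof. by rewrite -ball_normE/= rnormE ltcR. Qed.

Lemma ball_rnorm_lt a b (e : R) : ball a e%:C b -> rnorm (a - b) < e.
Proof. by rewrite -ball_normE/= rnormE ltcR. Qed.

Lemma nbhs_rnormP a (B : set A) : nbhs a B <->
  exists2 e : R, 0 < e & forall b, rnorm (a - b) < e -> B b.
Proof.
rewrite nbhs_ballP; split=> [[e /= e0 eB]|[e e0 eB]].
  have [eE re0] := complex_gt0 e0; exists (Re e) => // b.
  by move=> /rnorm_lt_ball; rewrite eE; exact: eB.
by exists e%:C => [|b /ball_rnorm_lt]; [rewrite /= (ltcR 0)|exact: eB].
Qed.

Lemma cmul_continuous a : continuous (cmul a).
Proof.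
move=> b B /nbhs_rnormP[e e0 eB]; apply/nbhs_rnormP.
have a1 : 0 < rnorm a + 1 by rewrite ltr_wpDl ?rnorm_ge0.
exists (e / (rnorm a + 1)) => [|c bc]; first by rewrite divr_gt0.
apply: eB; rewrite -cmulN -cmulDr; apply: le_lt_trans (rnormM _ _) _.
apply: (@le_lt_trans _ _ ((rnorm a + 1) * rnorm (b - c))).
  by rewrite ler_wpM2r ?rnorm_ge0// lerDl.
by rewrite mulrC -ltr_pdivlMr.
Qed.

Lemma neumann_solution a : rnorm a < 1 -> exists b, b = cone A + cmul a b.
Proof.
move=> a1; set r := rnorm a in a1; have r0 : 0 <= r by exact: rnorm_ge0.
pose b n := iter n (fun b => cone A + cmul a b) 0.
have b0 : b 0%N = 0 by [].
have bS n : b n.+1 = cone A + cmul a (b n) by [].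
clearbody b.
set c := rnorm (cone A).
have bd n : rnorm (b n - b n.+1) <= r ^+ n * c.
  elim: n => [|n IH]; first by rewrite bS b0 cmul0 addr0 sub0r rnormN mul1r.
  have -> : b n.+1 - b n.+2 = cmul a (b n - b n.+1).
    by rewrite (bS n.+1) cmulDr cmulN {1}(bS n) opprD addrACA subrr add0r.
  by apply: le_trans (rnormM _ _) _; rewrite exprS -mulrA ler_wpM2l.
have key (x y z u v : R) : x <= y + z -> z <= u * v * c ->
    (1 - r) * y <= u * c * (1 - v) -> (1 - r) * x <= u * c * (1 - r * v).
  have r1 : 0 <= 1 - r by rewrite subr_ge0 ltW.
  move=> /(ler_wpM2l r1) h1 /(ler_wpM2l r1) h2 h3; lra.
(* A geometric sum multiplied by $1-r$ to avoid division. *)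
have bNk N k : (1 - r) * rnorm (b N - b (N + k)%N) <= r ^+ N * c * (1 - r ^+ k).
  elim: k => [|k IH].
    by rewrite addn0 !subrr /rnorm normr0 /= !mulr0.
  have -> : b N - b (N + k.+1)%N = (b N - b (N + k)%N) + (b (N + k)%N - b (N + k).+1).
    by rewrite addnS addrA subrK.
  rewrite exprS; apply: key (rnormD _ _) _ IH.
  by have := bd (N + k)%N; rewrite exprD.
have [l bl] : exists l : A, b @ \oo --> l.
  suff : cvg (b @ \oo) by move=> /cvg_ex[l ?]; exists l.
  apply: cauchy_cvg; apply: cauchy_exP => e e0.
  have [<- {e0}] := complex_gt0 e0; set d := Re e => d0.
  have d1 : 0 < d * (1 - r) by rewrite mulr_gt0// subr_gt0.
  have : (fun n => r ^+ n * c) @ \oo --> (0 : R).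
    rewrite -[X in _ --> X](mul0r c); apply: cvgMl; apply: cvg_expr.
    by rewrite ger0_norm.
  move=> /cvgrPdist_lt/(_ _ d1)[N _ hN]; exists (b N), N => // n /= Nn.
  apply: rnorm_lt_ball; rewrite -(subnKC Nn).
  have r1 : 0 < 1 - r by rewrite subr_gt0.
  rewrite -(ltr_pM2l r1); apply: le_lt_trans (bNk N _) _.
  have := hN N (leqnn N); rewrite /= sub0r normrN ger0_norm; last first.
    by rewrite mulr_ge0 ?exprn_ge0 ?rnorm_ge0.
  rewrite [d * _]mulrC; apply: le_lt_trans.
  rewrite ler_piMr// ?mulr_ge0 ?exprn_ge0 ?rnorm_ge0//.
  by rewrite gerBl exprn_ge0.
exists l; apply: (@cvg_unique _ (@norm_hausdorff _ A) (b n.+1 @[n --> \oo])).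
  by move=> B /bl[N _ NB]; exists N => // n /= Nn; apply: NB => /=; exact: leqW.
have -> : (fun n => b n.+1) = (fun n => cone A + cmul a (b n)) by apply/funext.
apply: cvgD; first exact: cvg_cst.
by apply: (@cvg_comp _ _ _ b (cmul a)); [exact: bl|exact: cmul_continuous].
Qed.

End cstar_norm.

Section characters.
Variables (R : realType) (A : cstarAlgType R).
Local Notation C := (R[i]^o).
Local Notation fun_space := (prod_topology (fun _ : A => (C : topologicalType))).

Definition character_set : set fun_space :=
  [set chi : fun_space | [/\ forall a b, chi (a + b) = chi a + chi b,
     forall (c : R[i]) a, chi (c *: a) = c * chi a,
     forall a b, chi (cmul a b) = chi a * chi b &
     chi (cone A) = 1]].

Definition character : Type := set_type character_set.

HB.instance Definition _ := Topological.on character.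

Definition char_eval (x : character) (a : A) : C := (val x : fun_space) a.

Implicit Types x y : character.

Lemma charD x a b : char_eval x (a + b) = char_eval x a + char_eval x b.
Proof. by have [h _ _ _] := set_valP x; exact: h. Qed.

Lemma charZ x (c : R[i]) a : char_eval x (c *: a) = c * char_eval x a.
Proof. by have [_ h _ _] := set_valP x; exact: h. Qed.

Lemma charM x a b : char_eval x (cmul a b) = char_eval x a * char_eval x b.
Proof. by have [_ _ h _] := set_valP x; exact: h. Qed.

Lemma char1 x : char_eval x (cone A) = 1.
Proof. by have [_ _ _ h] := set_valP x. Qed.

Lemma charN x a : char_eval x (- a) = - char_eval x a.
Proof. by rewrite -scaleN1r charZ mulN1r. Qed.

Lemma charP x y : (forall a, char_eval x a = char_eval y a) -> x = y.
Proof. by move=> xy; apply: val_inj; apply: functional_extensionality_dep. Qed.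

(** If $l=\chi(a)$ exceeded the norm of $a$, a Neumann series would give $b=1+l^{-1}ab$, and
    applying $\chi$ yields $\chi(b)=1+\chi(b)$. *)
Lemma char_contractive x a : `|char_eval x a| <= `|a|.
Proof.
rewrite rnormE real_leNgt ?ger0_real//; last by rewrite (ler0c (rnorm a)) rnorm_ge0.
apply/negP => xa.
set l := char_eval x a in xa.
have l0 : l != 0.
  by rewrite -normr_gt0 (le_lt_trans _ xa)// (ler0c (rnorm a)) rnorm_ge0.
have [|b bE] := @neumann_solution R A (l^-1 *: a).
  rewrite -(ltcR _ 1) -rnormE normrZ normfV mulrC ltr_pdivrMr ?normr_gt0//.
  by rewrite mul1r rnormE.
have := congr1 (char_eval x) bE; rewrite charD char1 charM charZ -/l mulVf// mul1r.
move=> /eqP; rewrite -subr_eq0 opprD addrCA subrr addr0 oppr_eq0 => /eqP.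
by apply/eqP; rewrite oner_eq0.
Qed.

Lemma char_eval_continuous a : continuous (fun x => char_eval x a).
Proof.
have c1 : continuous (fun x : character => val x : fun_space) by exact: initial_continuous.
have c2 : continuous (fun f : fun_space => f a : C) by exact: proj_continuous.
exact: (comp_continuous c1 c2).
Qed.

Lemma continuous_character (T : topologicalType) (f : T -> character) :
  (forall a, continuous (fun t => char_eval (f t) a)) -> continuous f.
Proof.
move=> cf; apply: (@continuous_comp_initial character _ _ set_val).
exact: prod_topology_continuous.
Qed.

Lemma character_hausdorff : hausdorff_space character.
Proof.
move=> x y xy; apply: charP => a; apply: (@complex_hausdorff R) => B B' nB nB'.
have [w [Bw B'w]] := xy _ _ (@char_eval_continuous a x _ nB) (@char_eval_continuous a y _ nB').
by exists (char_eval w a).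
Qed.

Lemma character_set_closed : closed character_set.
Proof.
have c (a : A) : continuous (fun f : fun_space => f a : C) by exact: proj_continuous.
have cadd2 a b : continuous (fun f : fun_space => f a + f b : C).
  by move=> chi; exact: (@cvgD R[i] C _ _ _ _ _ _ _ (c a chi) (c b chi)).
have cmul2 a b : continuous (fun f : fun_space => f a * f b : C).
  have := pair_continuous (@c a) (@c b).
  by move=> /comp_continuous/(_ (@complex_mul_continuous R)).
have -> : character_set = [set chi : fun_space | forall a b, chi (a + b) = chi a + chi b] `&`
    ([set chi : fun_space | forall (l : R[i]) a, chi (l *: a) = l * chi a] `&`
    ([set chi : fun_space | forall a b, chi (cmul a b) = chi a * chi b] `&`
     [set chi : fun_space | chi (cone A) = 1])).
  by apply/seteqP; split=> chi; [move=> [? ? ? ?]; do 3 split => //|move=> [? [? [? ?]]]; split].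
have cap (S : Type) (f g : S -> fun_space -> C) : (forall s, continuous (f s)) ->
    (forall s, continuous (g s)) -> closed [set chi | forall s, f s chi = g s chi].
  move=> cf cg; have -> : [set chi | forall s, f s chi = g s chi] =
      \bigcap_s [set chi | f s chi = g s chi].
    by apply/seteqP; split=> [chi h s _|chi h s]; [exact: h|exact: (h s I)].
  by apply: closed_bigI => s _; exact: closed_eq_fun.
apply: closedI; last apply: closedI; last apply: closedI.
- have := cap (A * A)%type (fun ab chi => chi (ab.1 + ab.2)) (fun ab chi => chi ab.1 + chi ab.2).
  rewrite (_ : [set _ | _] = [set chi : fun_space | forall a b, chi (a + b) = chi a + chi b]).
    apply; first by move=> ab; exact: c.
    by move=> ab; exact: cadd2.
  by apply/seteqP; split=> [chi h a b|chi h [a b]]; [exact: (h (a, b))|exact: h].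
- have := cap (R[i] * A)%type (fun la chi => chi (la.1 *: la.2)) (fun la chi => la.1 * chi la.2).
  rewrite (_ : [set _ | _] = [set chi : fun_space | forall (l : R[i]) a, chi (l *: a) = l * chi a]).
    apply; first by move=> la; exact: c.
    move=> la.
    have := pair_continuous (@cst_continuous fun_space _ (la.1 : C)) (@c la.2).
    by move=> /comp_continuous/(_ (@complex_mul_continuous R)).
  by apply/seteqP; split=> [chi h l a|chi h [l a]]; [exact: (h (l, a))|exact: h].
- have := cap (A * A)%type (fun ab chi => chi (cmul ab.1 ab.2)) (fun ab chi => chi ab.1 * chi ab.2).
  rewrite (_ : [set _ | _] = [set chi : fun_space | forall a b, chi (cmul a b) = chi a * chi b]).
    apply; first by move=> ab; exact: c.
    by move=> ab; exact: cmul2.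
  by apply/seteqP; split=> [chi h a b|chi h [a b]]; [exact: (h (a, b))|exact: h].
- apply: closed_eq_fun; first exact: c.
  exact: cst_continuous.
Qed.

Lemma character_compact : compact [set: character].
Proof.
apply: compact_set_type.
have cD : compact [set f : fun_space | forall a, `|f a| <= (rnorm a)%:C].
  exact: (@tychonoff _ (fun _ : A => (C : topologicalType)) (fun a => [set z : C | `|z| <= (rnorm a)%:C])
    (fun a => @disc_compact R (rnorm a))).
apply: subclosed_compact cD _; first exact: character_set_closed.
move=> chi hchi a; rewrite -rnormE.
exact: (@char_contractive (exist (fun u => u \in character_set) chi (mem_set hchi)) a).
Qed.

End characters.

(** * Noncommutative joins *)

Lemma urysohn_compact (R : realType) (X : topologicalType) (A B : set X) :
  hausdorff_space X -> compact [set: X] -> closed A -> closed B -> A `&` B = set0 ->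
  exists f : X -> R, [/\ continuous f, forall x, A x -> f x = 0 & forall x, B x -> f x = 1].
Proof.
move=> hX cX cA cB AB; have := compact_normal hX cX => /(@normal_separatorP R X).
move=> /(_ A B cA cB AB)/(@uniform_separatorP X R)[f [cf _ f0 f1]].
exists f; split => // x; first by move=> Ax; apply: f0; exists x.
by move=> Bx; apply: f1; exists x.
Qed.

Section uniform_functions.
Variables (R : realType) (A : cstarAlgType R).

Lemma nbhs_uniformP (T : choiceType) (F : {uniform T -> A}) (B : set {uniform T -> A}) :
  nbhs F B <-> exists2 e : R, 0 < e &
    forall F' : {uniform T -> A}, (forall t, rnorm (F t - F' t) < e) -> B F'.
Proof.
rewrite uniform_nbhs; split=> [[E [entE EB]]|[e e0 eB]].
  move: entE; rewrite -entourage_ballE => -[e /= e0 eE].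
  have [eR re0] := complex_gt0 e0; exists (Re e) => // F' FF'; apply: EB => t _.
  by apply: eE => /=; rewrite -eR; apply: rnorm_lt_ball; exact: FF'.
exists [set q | rnorm (q.1 - q.2) < e]; split; last by move=> F' FF'; apply: eB => t; exact: FF'.
rewrite -entourage_ballE; exists e%:C; first by rewrite /= (ltcR 0).
by move=> q /ball_rnorm_lt.
Qed.

Lemma uniform_eval_continuous (T : choiceType) (t : T) :
  continuous (fun F : {uniform T -> A} => (F : T -> A) t).
Proof.
move=> F B /nbhs_rnormP[e e0 eB]; apply/nbhs_uniformP; exists e => // F' FF'.
exact/eB/FF'.
Qed.

Lemma uniform_comp_continuous (T U : choiceType) (h : U -> T) :
  continuous (fun F : {uniform T -> A} => (F : T -> A) \o h : {uniform U -> A}).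
Proof.
move=> F B /nbhs_uniformP[e e0 eB]; apply/nbhs_uniformP; exists e => // F' FF'.
by apply: eB => u; exact: FF'.
Qed.

End uniform_functions.

(** * Torsion elements acting on the character space *)

Section T1_torsion.
Variables (R : realType) (G : compactGroupType) (A : cstarAlgType R).
Hypothesis A1 : cone A <> 0.
Variable d : coaction G A.
Hypothesis dfree : free_coaction d.
Local Notation C := (R[i]^o).
Local Notation I := (unit_interval R).

Lemma cone_scale_inj (c c' : R[i]) : c *: cone A = c' *: cone A -> c = c'.
Proof.
move=> /eqP; rewrite -subr_eq0 -scalerBl scaler_eq0 subr_eq0 => /orP[/eqP//|/eqP].
by move/A1.
Qed.

Lemma star_hom_char_subproof (f : A -> A) (x : character A) : unital_star_hom f ->
  (fun a => char_eval x (f a)) \in @character_set R A.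
Proof.
move=> [fD fZ fM f1 _]; apply: mem_set; split=> [a b|c a|a b|].
- by rewrite fD charD.
- by rewrite fZ charZ.
- by rewrite fM charM.
- by rewrite f1 char1.
Qed.

Definition star_hom_char (f : A -> A) (hf : unital_star_hom f) (x : character A) : character A :=
  exist (fun u => u \in @character_set R A) _ (star_hom_char_subproof x hf).

Lemma star_hom_charE f hf x a : char_eval (@star_hom_char f hf x) a = char_eval x (f a).
Proof. by []. Qed.

Definition gact_char (g : G) := star_hom_char (gact_star_hom d g).

(** If $x$ is fixed by $g$, it takes equal values at 1 and $g$ on every sum $\sum a\,\delta(b)$.
    Such a sum lies within 1/2 of a Urysohn function equal to 0 at 1 and 1 at $g$, which is
    impossible. *)
Lemma gact_char_free (g : G) (x : character A) : gact_char g x = x -> g = 1%g.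
Proof.
move=> gx; apply: contrapT => g1.
have [u [cu u0 u1]] : exists u : G -> R, [/\ continuous u, forall h, [set 1%g] h -> u h = 0 &
    forall h, [set g] h -> u h = 1].
  have acc := hausdorff_accessible (@group_hausdorff G).
  apply: urysohn_compact; [exact: group_hausdorff|exact: group_compact| | |].
  - exact: accessible_closed_set1.
  - exact: accessible_closed_set1.
  - by rewrite -subset0 => h [/= -> /esym].
pose F : {uniform G -> A} := fun h => (u h)%:C *: cone A.
have cF : tensor_CG F.
  move=> h; apply: (@cvgZl _ _ _ _ _ (fun h => (u h)%:C : C)).
  exact: (comp_continuous cu (@real_complex_continuous R)).
have : nbhs F [set F' : {uniform G -> A} | forall t, rnorm (F t - F' t) < 2^-1].
  by apply/nbhs_uniformP; exists 2^-1 => //; rewrite invr_gt0.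
move=> /(dfree cF)[_ [[s ->] hs]].
pose S h := \sum_(ab <- s) cmul ab.1 (delta d ab.2 h).
have SE : char_eval x (S g) = char_eval x (S 1%g).
  rewrite /S; elim: (s) => [|[a b] s' IH]; first by rewrite !big_nil.
  rewrite !big_cons !charD IH !charM /=; congr (_ * _ + _).
  by rewrite /delta gact1 -[in RHS]gx.
have near h : `|char_eval x (F h) - char_eval x (S h)| < (2^-1)%:C.
  rewrite -charN -charD; apply: le_lt_trans (char_contractive _ _) _.
  by rewrite rnormE ltcR; exact: hs.
have FE h : char_eval x (F h) = (u h)%:C by rewrite charZ char1 mulr1.
have := near 1%g; have := near g; rewrite !FE SE (u0 1%g erefl) (u1 g erefl).
set v := char_eval x _ => h1 h0.
have := le_lt_trans (ler_normB _ _) (ltrD h1 h0).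
have -> : (1%:C - v - (0%:C - v) : R[i]) = 1 by rewrite opprB addrA subrK -rmorphB subr0.
have h2 : 2^-1 + 2^-1 = 1 :> R by lra.
by rewrite normr1 -rmorphD/= h2 ltxx.
Qed.

Lemma gact_charX (g : G) i x : iter i (gact_char g) x = gact_char (g ^+ i)%g x.
Proof.
elim: i x => [|i IH] x.
  by rewrite expg0; apply: charP => a; rewrite star_hom_charE gact1.
rewrite iterSr IH; apply: charP => a; rewrite !star_hom_charE expgS.
by rewrite gactM.
Qed.

Lemma star_hom_char_continuous f (hf : unital_star_hom f) : continuous (star_hom_char hf).
Proof. by apply: continuous_character => a; exact: char_eval_continuous. Qed.

Theorem T1_torsion (n : nat) (g : G) :
  (1 < n)%N -> (g ^+ n = 1)%g -> (forall i, (0 < i < n)%N -> (g ^+ i <> 1)%g) ->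
  ~ exists phi : A -> I -> {uniform G -> A},
      nc_join_star_hom d phi /\ nc_join_equivariant d phi.
Proof.
move=> n1 gn gi [phi [[phiJ phiH] phiE]].
have [h0 h0E] : exists h0 : A -> R[i], forall a, phi a (unit_interval0 R) 1%g = h0 a *: cone A.
  suff ex a : exists c, phi a (unit_interval0 R) 1%g = c *: cone A.
    by exists (fun a => projT1 (cid (ex a))) => a; exact: projT2 (cid (ex a)).
  by have [_ _ [h _ h0] _] := phiJ a; exists (h 1%g); rewrite h0.
(* The scalar is unique because the algebra is nonzero, so [h0] inherits the algebra laws. *)
have chi0P : h0 \in @character_set R A.
  have [pD pZ pM p1 _] := phiH (unit_interval0 R) 1%g.
  apply: mem_set; split=> [a b|c a|a b|]; apply: cone_scale_inj; rewrite -h0E.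
  - by rewrite pD !h0E scalerDl.
  - by rewrite pZ h0E scalerA.
  - by rewrite pM !h0E -cscaleAl -cscaleAr cmul1x scalerA.
  - by rewrite p1 scale1r.
pose chi0 : character A := exist (fun u => u \in @character_set R A) _ chi0P.
(* Composition with [phi] evaluated at time $t$ and at the unit of $G$. *)
pose H (q : character A * I) := star_hom_char (phiH q.2 1%g) q.1.
apply: (@no_equivariant_null_homotopy R (character A) n (gact_char g) H chi0 chi0 n1).
- exact: character_compact.
- exact: character_hausdorff.
- exact: star_hom_char_continuous.
- by move=> x; rewrite gact_charX gn; apply: charP => a; rewrite star_hom_charE gact1.
- by move=> x i /gi gi1; rewrite gact_charX => /gact_char_free.
- apply: continuous_character => a [x t] B hB.
  move: hB => /nbhs_ballP[e' /= /complex_gt0[<-]]; set e := Re e' => e0 eB.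
  have e20 : 0 < e / 2 by rewrite divr_gt0.
  have [cphi _ _ _] := phiJ a; set b := phi a t 1%g in eB.
  have c1 : nbhs t [set t' | rnorm (b - phi a t' 1%g) < e / 2].
    have cphi1 : continuous (fun t' => phi a t' 1%g).
      exact: (comp_continuous cphi (@uniform_eval_continuous R A _ 1%g)).
    have := cphi1 t [set b' | rnorm (b - b') < e / 2].
    by apply; apply/nbhs_rnormP; exists (e / 2).
  have c2 : nbhs x [set x' | `|char_eval x b - char_eval x' b| < (e / 2)%:C].
    have := @char_eval_continuous R A b x [set z | `|char_eval x b - z| < (e / 2)%:C].
    apply; apply/nbhs_ballP.
    by exists (e / 2)%:C => //=; rewrite (ltcR 0).
  exists ([set x' | `|char_eval x b - char_eval x' b| < (e / 2)%:C],
    [set t' | rnorm (b - phi a t' 1%g) < e / 2]) => [//|[x' t'] /= [xx' tt']].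
  apply: eB; rewrite /ball/= star_hom_charE.
  have -> : char_eval x b - char_eval x' (phi a t' 1%g) =
      (char_eval x b - char_eval x' b) + char_eval x' (b - phi a t' 1%g).
    by rewrite charD charN addrA subrK.
  rewrite -/e [e in X in _ < X](splitr e) rmorphD; apply: le_lt_trans (ler_normD _ _) _.
  apply: ltrD => //; apply: le_lt_trans (char_contractive _ _) _.
  by rewrite rnormE ltcR.
- move=> x; apply: charP => a; rewrite star_hom_charE h0E charZ char1 mulr1.
  by [].
- move=> x; apply: charP => a; rewrite !star_hom_charE /=.
  have [_ _ _ [c cE]] := phiJ a.
  (* At time 1, [phi a] is $\delta(c)$ with $c$ its value at the unit; equivariance turns
     translation by $g$ into $g$ acting on $c$. *)
  have := congr1 (fun f => f g (unit_interval1 R) 1%g) (phiE a).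
  rewrite /nc_join_delta /id_comult /= mul1g cE => <-.
  by rewrite /delta gact1.
Qed.

End T1_torsion.

(** * Restriction of coactions to the p-adic integers *)

Lemma padic_nbhs_residue (p : nat) (z : padic p) (U : set (padic p)) : nbhs z U ->
  exists n, forall w, (forall m, (m <= n)%N -> residue w m = residue z m) -> U w.
Proof.
move=> /nbhs_interior zU; apply: contrapT => hn.
have cyl n : closed [set w : padic p | residue w n = residue z n].
  have -> : [set w : padic p | residue w n = residue z n] =
      (fun w : padic p => val w n : discrete_topology 'Z_(p ^ n.+1)) @^-1` [set val z n].
    by apply/seteqP; split=> w /=; [exact: val_inj|move=> wz; congr nat_of_ord].
  apply: closed_comp; first by move=> w _; exact: padic_val_continuous.
  exact: (@discrete_closed (discrete_topology 'Z_(p ^ n.+1))).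
(* Cylinders around [z] minus the interior of [U]: a decreasing chain of closed sets. Were all
   nonempty, they would share a point, which can only be [z]. *)
pose E n := [set w : padic p | forall m, (m <= n)%N -> residue w m = residue z m] `&` ~` U^°.
have [||S [n _ <-]|x Ex] := @chain_compact _ (range E) (@padic_compact p).
- by exists (E 0%N), 0%N.
- move=> _ _ [m _ <-] [n _ <-].
  wlog mn : m n / (m <= n)%N.
    by move=> wl; have [/wl//|/ltnW/wl[]] := leqP m n; [right|left].
  by right=> w [wz Uw]; split => // k km; apply: wz; exact: leq_trans km mn.
- split.
    apply: closedI; last exact/open_closedC/open_interior.
    have -> : [set w : padic p | forall m, (m <= n)%N -> residue w m = residue z m] =
        \bigcap_(m in [set m | (m <= n)%N]) [set w : padic p | residue w m = residue z m].
      by apply/seteqP; split.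
    by apply: closed_bigI => m _; exact: cyl.
  apply: contrapT => E0; apply: hn; exists n => w wz; apply: contrapT => Uw.
  by apply: E0; exists w; split => // /interior_subset.
- have [_] := Ex (E 0%N) (ex_intro2 _ _ 0%N I erefl); apply.
  suff -> : x = z by exact: nbhs_singleton.
  apply: residue_inj => n; have [xz _] := Ex (E n) (ex_intro2 _ _ n I erefl).
  exact: xz.
Qed.

Lemma padic_uniformly_continuous (p : nat) (R : realType) (A : cstarAlgType R)
    (F : padic p -> A) (e : R) : prime p -> continuous F -> 0 < e ->
  exists n, forall z w, residue z n = residue w n -> rnorm (F z - F w) < e.
Proof.
move=> pp cF e0.
have e20 : 0 < e / 2 by rewrite divr_gt0.
have hn z : exists n, forall w, residue w n = residue z n -> rnorm (F z - F w) < e / 2.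
  have : nbhs z [set w | rnorm (F z - F w) < e / 2].
    have := cF z [set b | rnorm (F z - b) < e / 2].
    by apply; apply/nbhs_rnormP; exists (e / 2).
  move=> /padic_nbhs_residue[n nE]; exists n => w wz; apply: nE => m mn.
  by rewrite -!(residue_mod pp _ mn) wz.
pose n z := projT1 (cid (hn z)).
have nE z w : residue w (n z) = residue z (n z) -> rnorm (F z - F w) < e / 2.
  exact: (projT2 (cid (hn z))).
have nU z : nbhs z [set w | residue w (n z) = residue z (n z)].
  have := (@continuous_to_discrete _ _ _).1 (@padic_val_continuous p (n z)) z.
  by apply: filterS => w wz; rewrite /= /residue; congr nat_of_ord.
have [s sE] := @compact_finite_subcover _ _ (@padic_compact p) nU.
exists (\max_(z <- s) n z)%N => w w' ww'.
have [z zs wz] := sE w.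
have nz : (n z <= \max_(z <- s) n z)%N by rewrite (big_rem z)//= leq_maxl.
have w'z : residue w' (n z) = residue z (n z).
  by rewrite -(residue_mod pp _ nz) -ww' (residue_mod pp _ nz).
have -> : F w - F w' = (F z - F w') + - (F z - F w) by rewrite opprB [RHS]addrC addrA subrK.
rewrite (splitr e); apply: le_lt_trans (rnormD _ _) _; rewrite rnormN ltrD//.
  exact: nE.
exact: nE.
Qed.

Section T1_restrict.
Variables (R : realType) (p : nat) (G : compactGroupType) (iota : padic p -> G).
Hypotheses (pp : prime p) (ci : continuous iota).
Hypothesis iM : forall z w, iota (z * w)%g = (iota z * iota w)%g.
Hypothesis iinj : forall z, iota z = 1%g -> z = 1%g.

Lemma hom_injective : injective iota.
Proof.
move=> z w zw; apply: (mulIg (w^-1)%g); rewrite mulgV; apply: iinj.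
by rewrite iM zw -iM mulgV (hom1 iM).
Qed.

(* An element of [C(Z_p)] constant on the cosets of [p^(n+1) Z_p] is a
   combination of their indicator functions, which extend to [G] since the
   cosets have disjoint closed images. *)
Lemma extend_residue_function (A : cstarAlgType R) (F : padic p -> A) (n : nat) :
  (forall z w, residue z n = residue w n -> F z = F w) ->
  exists F1 : G -> A, continuous F1 /\ forall z, F1 (iota z) = F z.
Proof.
move=> FE.
have ex (c : 'I_(p ^ n.+1)) : exists u : G -> R, [/\ continuous u,
    forall z, residue z n = c -> u (iota z) = 1 &
    forall z, residue z n <> c -> u (iota z) = 0].
  have cl (D : set nat) : closed (iota @` [set z | D (residue z n)]).
    apply: (compact_closed (@group_hausdorff G)).
    apply: continuous_compact; first exact: continuous_subspaceT.
    apply: (subclosed_compact _ (@padic_compact p) (@subsetT _ _)).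
    have -> : [set z : padic p | D (residue z n)] =
        (fun w : padic p => val w n : discrete_topology 'Z_(p ^ n.+1)) @^-1` [set i | D (nat_of_ord i)].
      by [].
    apply: closed_comp; first by move=> w _; exact: padic_val_continuous.
    exact: (@discrete_closed (discrete_topology 'Z_(p ^ n.+1))).
  have [|u [cu u0 u1]] := @urysohn_compact R G _ _ (@group_hausdorff G) (@group_compact G)
    (cl [set m : nat | m <> c]) (cl [set m : nat | m = c]).
    by rewrite -subset0 => _ [[z /= zc <-] [w /= wc /hom_injective wz]]; apply: zc; rewrite -wz.
  by exists u; split => // z zc; [apply: u1|apply: u0]; exists z.
pose u c := projT1 (cid (ex c)).
have uP c : [/\ continuous (u c), forall z, residue z n = c -> u c (iota z) = 1 &
    forall z, residue z n <> c -> u c (iota z) = 0] := projT2 (cid (ex c)).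
exists (fun g => \sum_c (u c g)%:C *: F (padic_nat p c)); split.
  apply: continuous_big => [|c _]; first exact: add_continuous.
  have [cu _ _] := uP c; move=> g; apply: (@cvgZl _ _ _ _ _ (fun h => (u c h)%:C : R[i]^o)).
  exact: (comp_continuous cu (@real_complex_continuous R)).
move=> z; rewrite (bigD1 (Ordinal (residue_lt pp z n)))//= big1 ?addr0.
  have [_ -> // _] := uP (Ordinal (residue_lt pp z n)).
  rewrite scale1r; apply: FE; rewrite (residue_nat pp) modn_small//.
  exact: residue_lt.
move=> c /eqP cz; have [_ _ ->] := uP c; first by rewrite scale0r.
by move=> zc; apply: cz; apply: val_inj.
Qed.

Variables (A : cstarAlgType R) (d : coaction G A).

Lemma restrict_gact1 a : gact d (iota 1%g) a = a.
Proof. by rewrite (hom1 iM) gact1. Qed.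

Lemma restrict_gactM z w a : gact d (iota (z * w)%g) a = gact d (iota z) (gact d (iota w) a).
Proof. by rewrite iM gactM. Qed.

Lemma restrict_gact_continuous a : continuous (fun z => gact d (iota z) a).
Proof. exact: (comp_continuous ci (@gact_continuous _ _ _ d a)). Qed.

Definition restrict_coaction : coaction (padic p) A :=
  Coaction (fun z => gact_star_hom d (iota z)) restrict_gact1 restrict_gactM
    restrict_gact_continuous.

(** Half of [e] replaces [F] by a function of one residue, which extends to $G$; the other half is
    the approximation on $G$, restricted along [iota]. *)
Lemma restrict_free : free_coaction d -> free_coaction restrict_coaction.
Proof.
move=> dfree F cF B /nbhs_uniformP[e e0 eB].
have e20 : 0 < e / 2 by rewrite divr_gt0.
have [n nF] := padic_uniformly_continuous pp cF e20.
pose F0 (z : padic p) := F (padic_nat p (residue z n)).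
have [|F1 [cF1 F1E]] := @extend_residue_function A F0 n.
  by move=> z w; rewrite /F0 => ->.
have : nbhs (F1 : {uniform G -> A})
    [set F' : {uniform G -> A} | forall t, rnorm (F1 t - F' t) < e / 2].
  by apply/nbhs_uniformP; exists (e / 2).
move=> /(dfree _ cF1)[_ [[s ->] hs]].
exists (fun z => \sum_(ab <- s) cmul ab.1 (delta restrict_coaction ab.2 z)); split.
  by exists s.
apply: eB => z.
rewrite -(subrK (F0 z) (F z)) -addrA (splitr e).
apply: le_lt_trans (rnormD _ _) _; apply: ltrD.
  by apply: nF; rewrite (residue_nat pp) modn_small//; exact: residue_lt.
by rewrite -F1E; exact: hs.
Qed.

Lemma restrict_nc_join (f : unit_interval R -> {uniform G -> A}) : nc_join d f ->
  nc_join restrict_coaction (fun t => f t \o iota).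
Proof.
move=> [cf ct [h ch f0] [a f1]]; split.
- exact: (comp_continuous cf (@uniform_comp_continuous R A _ _ iota)).
- by move=> t; exact: (comp_continuous ci (ct t)).
- by exists (h \o iota); [exact: (comp_continuous ci ch)|rewrite f0].
- by exists a; rewrite f1.
Qed.

End T1_restrict.

Theorem T1_restrict (R : realType) (p : nat) (G : compactGroupType) (iota : padic p -> G) :
  prime p -> continuous iota -> (forall z w, iota (z * w)%g = (iota z * iota w)%g) ->
  (forall z, iota z = 1%g -> z = 1%g) -> T1 R (padic p) -> T1 R G.
Proof.
move=> pp ci iM iinj T1p A A1 d dfree [phi [[phiJ phiH] phiE]].
apply: (T1p A A1 _ (@restrict_free R p G iota pp ci iM iinj A d dfree)).
exists (fun a t => phi a t \o iota); split.
  split=> [a|t z]; first exact: restrict_nc_join.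
  exact: phiH.
move=> a; apply/funext => z; apply/funext => t; apply/funext => w.
rewrite /nc_join_delta /id_comult /= iM.
exact: (congr1 (fun f => f (iota z) t (iota w)) (phiE a)).
Qed.

Theorem lemma3p2 (R : realType) :
  ((forall p : nat, prime p -> BU R (padic p)) ->
     forall G : compactGroupType, nontrivial_group G -> BU R G) /\
  ((forall p : nat, prime p -> T1 R (padic p)) ->
     forall G : compactGroupType, nontrivial_group G -> T1 R G).
Proof.
split=> hp G /(torsion_or_padic R)[[n [g [n1 gn gi]]]|[p [pp [iota [ci iM iinj]]]]].
- exact: BU_torsion n1 gn gi.
- exact: BU_restrict ci iM iinj (hp p pp).
- by move=> A A1 d dfree; exact: (T1_torsion A1 dfree n1 gn gi).
- exact: T1_restrict pp ci iM iinj (hp p pp).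
Qed.
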